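(* Let $\gamma$ be a name for an ordinal (a set, not a proper class) with $\gamma\ge\omega^\omega$, given by a first-order formula without parameters. If there is a transitive model of $\mathsf{GB}+\mathsf{ETR}_{\gamma\cdot\omega}$, then there is a transitive $M\models\mathsf{ZF}$ which is $(\mathsf{GB}+\mathsf{ETR}_\gamma)$-realizable but not $(\mathsf{GB}+\mathsf{ETR}_{\gamma\cdot\omega})$-realizable.
   Context: Models of second-order set theory are pairs $(M,\mathcal X)$ with $\mathcal X\subseteq\mathcal P(M)$; transitive means $M$ is transitive with true $\in$. $\mathsf{GB}$ consists of $\mathsf{ZF}$, Extensionality for classes, Class Replacement, Elementary Comprehension (comprehension for formulas without class quantifiers, with set and class parameters). For a well-order $\Delta$, $\mathsf{ETR}_\Delta$ is the schema: for every first-order $\varphi(x,Y,A)$ (class parameter $A$) and every well-founded class relation $R$ of rank $\le\Delta$, there is a class $S\subseteq\mathrm{dom}R\times V$ with $S_r=\{x:\varphi(x,S\restriction r,A)\}$ for all $r\in\mathrm{dom}R$, where $S_r=\{x:(r,x)\in S\}$, $S\restriction r=S\cap(\{r':r'<_Rr\}\times V)$, $<_R$ the transitive closure of $R$. $M$ is $T$-realizable if there is $\mathcal X\subseteq\mathcal P(M)$ with $(M,\mathcal X)\models T$. *)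

(* Defs.v *)
From Stdlib Require Import Relation_Operators.

(** * The ambient universe of sets *)

(** Aczel's iterative sets.  With excluded middle and choice they satisfy ZFC,
    set-theoretic equality being the bisimulation [veq], not Leibniz equality. *)
Inductive V : Type := sup (A : Type) (f : A -> V).

Definition idx (x : V) : Type := let (A, _) := x in A.

Definition el (x : V) : idx x -> V :=
  match x return idx x -> V with sup _ f => f end.

Fixpoint veq (x y : V) {struct x} : Prop :=
  match x, y with
  | sup A f, sup B g =>
      (forall i, exists j, veq (f i) (g j)) /\
      (forall j, exists i, veq (f i) (g j))
  end.

Definition mem (x y : V) : Prop := exists i : idx y, veq x (el y i).

Declare Scope set_scope.
Delimit Scope set_scope with set.
Infix "≈" := veq (at level 70, no associativity) : set_scope.
Infix "∈" := mem (at level 70, no associativity) : set_scope.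
Open Scope set_scope.

Definition incl (x y : V) : Prop := forall z, z ∈ x -> z ∈ y.
Infix "⊆" := incl (at level 70, no associativity) : set_scope.

Definition vempty : V := sup Empty_set (fun e => match e with end).

Definition vpair (x y : V) : V := sup bool (fun b => if b then x else y).

(** Kuratowski pairs. *)
Definition kpair (x y : V) : V := vpair (vpair x x) (vpair x y).

Definition vcup (x y : V) : V :=
  sup (idx x + idx y)
    (fun k => match k with inl i => el x i | inr j => el y j end).

Definition vsucc (x : V) : V := vcup x (vpair x x).

Definition bigcup (J : Type) (F : J -> V) : V :=
  sup {j : J & idx (F j)} (fun k => el (F (projT1 k)) (projT2 k)).

(** { z ∈ x | P z } *)
Definition vsep (x : V) (P : V -> Prop) : V :=
  sup {i : idx x | P (el x i)} (fun k => el x (proj1_sig k)).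

Definition transitive (x : V) : Prop := forall y, y ∈ x -> y ⊆ x.

Definition ordinal (x : V) : Prop :=
  transitive x /\ forall y, y ∈ x -> transitive y.

Fixpoint vnat (n : nat) : V :=
  match n with O => vempty | S m => vsucc (vnat m) end.

Definition omega : V := sup nat vnat.

(** Ordinal arithmetic on von Neumann ordinals:
    a + b = a ∪ { a + c | c < b },
    a · b = sup { a · c + a | c < b },
    a ^ b = max (1, sup { a ^ c · a | c < b })   (for a ≥ 1). *)
Fixpoint oadd (a b : V) {struct b} : V :=
  match b with sup J g => vcup a (sup J (fun j => oadd a (g j))) end.

Fixpoint omul (a b : V) {struct b} : V :=
  match b with sup J g => bigcup J (fun j => oadd (omul a (g j)) a) end.

Fixpoint oexp (a b : V) {struct b} : V :=
  match b with
  | sup J g => vcup (vnat 1) (bigcup J (fun j => omul (oexp a (g j)) a))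
  end.

(** * First-order formulas *)

(** Formulas without class quantifiers, whose free set variables are in [X] and
    whose class variables are in [C]; in [fAll p] the bound variable is [None].
    The language of ZF is the case [C := Empty_set]. *)
Inductive fml (C X : Set) : Set :=
| fMem : X -> X -> fml C X
| fEq : X -> X -> fml C X
| fCls : X -> C -> fml C X
| fBot : fml C X
| fImp : fml C X -> fml C X -> fml C X
| fAll : fml C (option X) -> fml C X.

Arguments fMem {C X}.
Arguments fEq {C X}.
Arguments fCls {C X}.
Arguments fBot {C X}.
Arguments fImp {C X}.
Arguments fAll {C X}.

Definition ext {X : Set} (a : V) (e : X -> V) (o : option X) : V :=
  match o with None => a | Some i => e i end.

Fixpoint sat {C X : Set} (M : V) (cl : C -> V) (e : X -> V) (p : fml C X)
    {struct p} : Prop :=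
  match p with
  | fMem i j => e i ∈ e j
  | fEq i j => e i ≈ e j
  | fCls i c => e i ∈ cl c
  | fBot => False
  | fImp q r => sat M cl e q -> sat M cl e r
  | fAll q => forall a, a ∈ M -> sat M cl (ext a e) q
  end.

Definition no_class (c : Empty_set) : V := match c with end.

(** Satisfaction in (M, ∈) of formulas in the language of ZF. *)
Definition sat_set {X : Set} (M : V) (e : X -> V) (p : fml Empty_set X) : Prop :=
  sat M no_class e p.

(** * ZF and GB *)

Record ZF (M : V) : Prop := {
  zf_extensionality : forall x y, x ∈ M -> y ∈ M ->
    (forall z, z ∈ M -> (z ∈ x <-> z ∈ y)) -> x ≈ y;
  zf_foundation : forall x, x ∈ M -> (exists y, y ∈ M /\ y ∈ x) ->
    exists y, y ∈ M /\ y ∈ x /\ ~ exists z, z ∈ M /\ z ∈ x /\ z ∈ y;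
  zf_pairing : forall x y, x ∈ M -> y ∈ M ->
    exists p, p ∈ M /\ forall z, z ∈ M -> (z ∈ p <-> z ≈ x \/ z ≈ y);
  zf_union : forall x, x ∈ M ->
    exists u, u ∈ M /\
      forall z, z ∈ M -> (z ∈ u <-> exists y, y ∈ M /\ y ∈ x /\ z ∈ y);
  zf_powerset : forall x, x ∈ M ->
    exists p, p ∈ M /\
      forall y, y ∈ M -> (y ∈ p <-> forall z, z ∈ M -> z ∈ y -> z ∈ x);
  zf_infinity :
    exists w, w ∈ M /\
      (exists o, o ∈ M /\ o ∈ w /\ forall z, z ∈ M -> ~ z ∈ o) /\
      (forall x, x ∈ M -> x ∈ w ->
        exists s, s ∈ M /\ s ∈ w /\
          forall z, z ∈ M -> (z ∈ s <-> z ∈ x \/ z ≈ x));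
  zf_separation : forall (p : fml Empty_set (option nat)) (e : nat -> V) a,
    (forall i, e i ∈ M) -> a ∈ M ->
    exists b, b ∈ M /\
      forall x, x ∈ M -> (x ∈ b <-> x ∈ a /\ sat_set M (ext x e) p);
  (* in [p], [None] is y and [Some None] is x *)
  zf_replacement : forall (p : fml Empty_set (option (option nat)))
      (e : nat -> V) a,
    (forall i, e i ∈ M) -> a ∈ M ->
    (forall x y y', x ∈ M -> x ∈ a -> y ∈ M -> y' ∈ M ->
      sat_set M (ext y (ext x e)) p -> sat_set M (ext y' (ext x e)) p -> y ≈ y') ->
    exists b, b ∈ M /\
      forall y, y ∈ M ->
        (y ∈ b <-> exists x, x ∈ M /\ x ∈ a /\ sat_set M (ext y (ext x e)) p)
}.

(** A second-order structure with true ∈: the classes are subsets of M. *)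
Definition so_structure (M X : V) : Prop := forall A, A ∈ X -> A ⊆ M.

Definition functional (F : V) : Prop :=
  forall x y y', kpair x y ∈ F -> kpair x y' ∈ F -> y ≈ y'.

(** In [gb_comprehension] the type [C] of class variables is arbitrary, in
    particular possibly empty, so that [X] is forced to be nonempty. *)
Record GB (M X : V) : Prop := {
  gb_zf : ZF M;
  gb_class_extensionality : forall A B, A ∈ X -> B ∈ X ->
    (forall x, x ∈ M -> (x ∈ A <-> x ∈ B)) -> A ≈ B;
  gb_class_replacement : forall F a, F ∈ X -> functional F -> a ∈ M ->
    exists b, b ∈ M /\
      forall y, y ∈ M -> (y ∈ b <-> exists x, x ∈ M /\ x ∈ a /\ kpair x y ∈ F);
  gb_comprehension : forall (C : Set) (p : fml C (option nat))
      (cl : C -> V) (e : nat -> V),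
    (forall c, cl c ∈ X) -> (forall i, e i ∈ M) ->
    exists A, A ∈ X /\ forall x, x ∈ M -> (x ∈ A <-> sat M cl (ext x e) p)
}.

(** * Elementary transfinite recursion *)

Definition class_relation (R : V) : Prop :=
  forall p, p ∈ R -> exists x y, p ≈ kpair x y.

Definition rel (R x y : V) : Prop := kpair x y ∈ R.

(** dom R is the class on which R is a relation, i.e. the field of R. *)
Definition dom (R x : V) : Prop := exists y, rel R x y \/ rel R y x.

(** Well-foundedness as seen by (M, X). *)
Definition wf_relation (X R : V) : Prop :=
  forall C, C ∈ X -> (exists x, x ∈ C) ->
    exists m, m ∈ C /\ forall y, y ∈ C -> ~ rel R y m.

(** [rho] is the rank function of R: rho(r) = sup { rho(r') + 1 | r' R r }. *)
Definition rank_function (R rho : V) : Prop :=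
  functional rho /\
  forall r, dom R r -> exists u, kpair r u ∈ rho /\
    forall d, d ∈ u <->
      exists r' v, rel R r' r /\ kpair r' v ∈ rho /\ (d ∈ v \/ d ≈ v).

(** (M, X) sees that the rank sup { rho(r) + 1 | r ∈ dom R } is at most delta. *)
Definition rank_le (X R delta : V) : Prop :=
  exists rho, rho ∈ X /\ rank_function R rho /\
    forall r u, dom R r -> kpair r u ∈ rho -> u ∈ delta.

Definition lt_rel (R : V) : V -> V -> Prop := clos_trans V (rel R).

Definition restr (R S r : V) : V :=
  vsep S (fun p => exists r' x, lt_rel R r' r /\ p ≈ kpair r' x).

Inductive etr_var : Set := varY | varA.

Definition etr_cl (Y A : V) (c : etr_var) : V :=
  match c with varY => Y | varA => A end.

(** ETR for well-founded relations of rank at most the ordinal [delta]. *)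
Definition ETR_ord (delta M X : V) : Prop :=
  forall (phi : fml etr_var unit) (A R : V),
    A ∈ X -> R ∈ X ->
    class_relation R -> wf_relation X R -> rank_le X R delta ->
    exists S, S ∈ X /\
      (forall p, p ∈ S -> exists r x, dom R r /\ x ∈ M /\ p ≈ kpair r x) /\
      (forall r, dom R r -> forall x, x ∈ M ->
        (kpair r x ∈ S <-> sat M (etr_cl (restr R S r) A) (fun _ => x) phi)).

(** * Names for ordinals *)

(** [denotes gamma M g]: g is the unique element of M satisfying gamma in M. *)
Definition denotes (gamma : fml Empty_set unit) (M g : V) : Prop :=
  g ∈ M /\ sat_set M (fun _ => g) gamma /\
  forall h, h ∈ M -> sat_set M (fun _ => h) gamma -> h ≈ g.

(** [gamma] need not denote in every model, but what it denotes in a transitive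
    model of ZF is an ordinal ≥ lb. *)
Definition ordinal_name_ge (lb : V) (gamma : fml Empty_set unit) : Prop :=
  forall M g, transitive M -> ZF M -> denotes gamma M g -> ordinal g /\ lb ⊆ g.

(** A (second-order) theory is represented by its satisfaction relation. *)
Definition theory : Type := V -> V -> Prop.

(** GB + ETR_γ, holding only in models in which γ denotes. *)
Definition GB_ETR (gamma : fml Empty_set unit) : theory := fun M X =>
  GB M X /\ exists g, denotes gamma M g /\ ETR_ord g M X.

(** GB + ETR_{γ·ω}; ordinal multiplication is absolute to transitive models. *)
Definition GB_ETR_omega (gamma : fml Empty_set unit) : theory := fun M X =>
  GB M X /\ exists g, denotes gamma M g /\ ETR_ord (omul g omega) M X.

Definition transitive_model (T : theory) (M X : V) : Prop :=
  transitive M /\ so_structure M X /\ T M X.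

Definition realizable (T : theory) (M : V) : Prop :=
  exists X, so_structure M X /\ T M X.

(* Main.v *)
From Stdlib Require Import Relation_Operators Setoid Morphisms Classical ClassicalEpsilon Lia.
Require Import Defs.

(** Let (M, X) be a transitive model of GB + ETR_{γ·ω}.  By ∈-induction on M it suffices to
    find a transitive N ∈ M which is (GB + ETR_γ)-realizable and in which γ has the same value.

    A universal evaluation game, whose positions code formulas with parameters and which can
    call classes coded by positions, itself included, is evaluated along a clock running
    through the ordinals below γ·ω; its winning positions form a class S of X by ETR_{γ·ω}.
    Reflection gives a stage N of the cumulative hierarchy of M which contains winning
    answers to all positions in N whenever M does; the game over N is then the restriction
    of the game over M.  Let X' consist of the subsets of N whose membership question is
    settled by the game over N before some clock below γ·ω.  A first-order formula costs
    finitely many steps, which gives comprehension, and replacement is reflected from (M, X).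
    A recursion of rank γ is solved by a self-calling position: if it starts at time l, then
    rank ξ is settled at time l + ξ + k for a finite k, and l + γ + ω < γ·ω. *)

(** * Sets up to bisimulation *)

(** The family X is not an object of (M, X), so it cannot itself be reflected; X' has to be read off
    from a single class. The game is built for this: membership in each member of X' is one question
    to S, so that Separation and Replacement over N are obtained from the axioms of (M, X).
    Self-calls may run in a circle, and nothing in the syntax prevents it. The clock makes
    evaluation total regardless, as a recursion on time alone, and only codes whose answers have
    settled enter X'. Making every position the joint denial of its moves leaves a single kind of
    witness, a winning move. Once these are reflected, absoluteness of the game, elementarity for
    the formula naming γ and the bound needed for Replacement all follow. Witnesses found at one
    stage raise new questions, hence a chain of length ω with union N. Its links are cofinal in N,
    but Replacement survives, since the questions about the elements of one set all lie in one
    link. *)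

Lemma veq_refl x : x ≈ x.
Proof. induction x as [A f IH]; simpl; split; intros i; exists i; auto. Qed.

Lemma veq_sym x : forall y, x ≈ y -> y ≈ x.
Proof.
  induction x as [A f IH]; intros [B g] [H1 H2]; simpl; split.
  - intros j; destruct (H2 j) as [i Hi]; exists i; auto.
  - intros i; destruct (H1 i) as [j Hj]; exists j; auto.
Qed.

Lemma veq_trans x : forall y z, x ≈ y -> y ≈ z -> x ≈ z.
Proof.
  induction x as [A f IH]; intros [B g] [C h] [H1 H2] [H3 H4]; simpl; split.
  - intros i; destruct (H1 i) as [j Hj]; destruct (H3 j) as [k Hk]; exists k; eauto.
  - intros k; destruct (H4 k) as [j Hj]; destruct (H2 j) as [i Hi]; exists i; eauto.
Qed.

#[global] Instance veq_equivalence : Equivalence veq.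
Proof. split; [exact veq_refl | exact veq_sym | exact veq_trans]. Qed.

Lemma mem_veq_r x y z : y ≈ z -> x ∈ y -> x ∈ z.
Proof.
  destruct y as [A f], z as [B g]; intros [H _] [i Hi]; simpl in *.
  destruct (H i) as [j Hj]; exists j; simpl; etransitivity; eauto.
Qed.

#[global] Instance mem_proper : Proper (veq ==> veq ==> iff) mem.
Proof.
  assert (H : forall x x' y y', x ≈ x' -> y ≈ y' -> x ∈ y -> x' ∈ y').
  { intros x x' y y' Hx Hy H; apply (mem_veq_r _ _ _ Hy); destruct H as [i Hi].
    exists i; etransitivity; [symmetry|]; eauto. }
  intros x x' Hx y y' Hy; split; apply H; auto; symmetry; auto.
Qed.

Lemma el_mem x i : el x i ∈ x.
Proof. exists i; reflexivity. Qed.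

Lemma mem_sup A f x : x ∈ sup A f <-> exists i, x ≈ f i.
Proof. reflexivity. Qed.

Lemma veq_ext x y : (forall z, z ∈ x <-> z ∈ y) -> x ≈ y.
Proof.
  destruct x as [A f], y as [B g]; intros H; split.
  - intros i; apply (proj1 (H (f i))); exists i; reflexivity.
  - intros j; destruct (proj2 (H (g j))) as [i Hi].
    + exists j; reflexivity.
    + exists i; symmetry; exact Hi.
Qed.

Lemma incl_antisym x y : x ⊆ y -> y ⊆ x -> x ≈ y.
Proof. intros; apply veq_ext; firstorder. Qed.

#[global] Instance incl_proper : Proper (veq ==> veq ==> iff) incl.
Proof.
  intros x x' Hx y y' Hy; unfold incl.
  setoid_rewrite Hx; setoid_rewrite Hy; reflexivity.
Qed.

Lemma mem_ind (P : V -> Prop) :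
  (forall x, (forall y, y ∈ x -> P y) -> P x) -> forall x, P x.
Proof.
  (* [P] need not respect ≈, and an element of [x] is only bisimilar to some [f i], so the claim is
     strengthened to all sets bisimilar to [x]. *)
  intros H x; cut (forall x', x' ≈ x -> P x'); [intros K; apply K; reflexivity|].
  induction x as [A f IH]; intros x' Hx'; apply H; intros y Hy.
  rewrite Hx' in Hy; destruct Hy as [i Hi]; exact (IH i y Hi).
Qed.

Lemma mem_irrefl x : ~ x ∈ x.
Proof. induction x as [x IH] using mem_ind; intros H; exact (IH x H H). Qed.

Lemma mem_minimal (P : V -> Prop) x :
  P x -> exists y, P y /\ forall z, z ∈ y -> ~ P z.
Proof.
  induction x as [x IH] using mem_ind; intros Hx.
  destruct (classic (exists z, z ∈ x /\ P z)) as [[z [Hz Pz]] | H].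
  - exact (IH z Hz Pz).
  - exists x; split; auto; intros z Hz Pz; apply H; eauto.
Qed.

Lemma mem_empty x : ~ x ∈ vempty.
Proof. intros [[] _]. Qed.

Lemma mem_pair z x y : z ∈ vpair x y <-> z ≈ x \/ z ≈ y.
Proof.
  split.
  - intros [[|] H]; auto.
  - intros [H | H]; [exists true | exists false]; auto.
Qed.

Lemma mem_cup z x y : z ∈ vcup x y <-> z ∈ x \/ z ∈ y.
Proof.
  split.
  - intros [[i | j] H]; [left; exists i | right; exists j]; auto.
  - intros [[i H] | [j H]]; [exists (inl i) | exists (inr j)]; auto.
Qed.

Lemma mem_succ z x : z ∈ vsucc x <-> z ∈ x \/ z ≈ x.
Proof. unfold vsucc; rewrite mem_cup, mem_pair; tauto. Qed.

Lemma mem_bigcup z J F : z ∈ bigcup J F <-> exists j, z ∈ F j.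
Proof.
  split.
  - intros [[j i] H]; exists j, i; exact H.
  - intros [j [i H]]; exists (existT _ j i); exact H.
Qed.

(** [vsep] selects indices, so membership tests [P] at a bisimilar set only; hence the condition
    that [P] respects ≈. *)
Lemma mem_sep z x (P : V -> Prop) :
  (forall a b, a ≈ b -> P a -> P b) -> z ∈ vsep x P <-> z ∈ x /\ P z.
Proof.
  intros HP; split.
  - intros [[i Hi] H]; simpl in H; split.
    + exists i; exact H.
    + apply (HP (el x i)); auto; symmetry; exact H.
  - intros [[i Hi] H]; exists (exist _ i (HP _ _ Hi H)); exact Hi.
Qed.

Lemma sep_sub z x P : z ∈ vsep x P -> z ∈ x.
Proof. intros [[i Hi] H]; exists i; exact H. Qed.

#[global] Instance vpair_proper : Proper (veq ==> veq ==> veq) vpair.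
Proof. intros x x' Hx y y' Hy; apply veq_ext; intros z; rewrite !mem_pair, Hx, Hy; tauto. Qed.

#[global] Instance vcup_proper : Proper (veq ==> veq ==> veq) vcup.
Proof. intros x x' Hx y y' Hy; apply veq_ext; intros z; rewrite !mem_cup, Hx, Hy; tauto. Qed.

#[global] Instance vsucc_proper : Proper (veq ==> veq) vsucc.
Proof. intros x x' Hx; unfold vsucc; rewrite Hx; reflexivity. Qed.

#[global] Instance kpair_proper : Proper (veq ==> veq ==> veq) kpair.
Proof. intros x x' Hx y y' Hy; unfold kpair; rewrite Hx, Hy; reflexivity. Qed.

#[global] Instance transitive_proper : Proper (veq ==> iff) transitive.
Proof. intros x x' Hx; unfold transitive; setoid_rewrite Hx; reflexivity. Qed.

#[global] Instance ordinal_proper : Proper (veq ==> iff) ordinal.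
Proof. intros x x' Hx; unfold ordinal; setoid_rewrite Hx; reflexivity. Qed.

#[global] Instance rel_proper : Proper (veq ==> veq ==> veq ==> iff) rel.
Proof. intros R R' HR x x' Hx y y' Hy; unfold rel; rewrite HR, Hx, Hy; reflexivity. Qed.

#[global] Instance dom_proper : Proper (veq ==> veq ==> iff) dom.
Proof. intros R R' HR x x' Hx; unfold dom; setoid_rewrite HR; setoid_rewrite Hx; reflexivity. Qed.

Lemma pair_inj a b c d : vpair a b ≈ vpair c d ->
  (a ≈ c /\ b ≈ d) \/ (a ≈ d /\ b ≈ c).
Proof.
  intros H.
  assert (Hz : forall z, (z ≈ a \/ z ≈ b) <-> (z ≈ c \/ z ≈ d))
    by (intros z; rewrite <- !mem_pair, H; tauto).
  pose proof (proj1 (Hz a) (or_introl (veq_refl a))) as Ha.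
  pose proof (proj1 (Hz b) (or_intror (veq_refl b))) as Hb.
  pose proof (proj2 (Hz c) (or_introl (veq_refl c))) as Hc.
  pose proof (proj2 (Hz d) (or_intror (veq_refl d))) as Hd.
  destruct Ha as [Ha | Ha], Hb as [Hb | Hb]; auto.
  - left; split; auto; destruct Hd as [Hd | Hd]; symmetry; auto.
    rewrite Hd, Ha, Hb; reflexivity.
  - left; split; auto.
    + destruct Hc as [Hc | Hc]; symmetry; auto. rewrite Hc, Ha, Hb; reflexivity.
Qed.

Lemma kpair_inj a b c d : kpair a b ≈ kpair c d <-> a ≈ c /\ b ≈ d.
Proof.
  split; [|intros [-> ->]; reflexivity].
  unfold kpair; intros H; apply pair_inj in H.
  destruct H as [[H1 H2] | [H1 H2]]; apply pair_inj in H1; apply pair_inj in H2.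
  - assert (Hac : a ≈ c) by tauto; split; auto.
    destruct H2 as [[_ H2] | [H2 H3]]; auto.
    rewrite H3, <- Hac, H2; reflexivity.
  - assert (Hac : a ≈ c) by tauto; assert (Had : a ≈ d) by tauto; split; auto.
    assert (Hbc : b ≈ c) by tauto. rewrite Hbc, <- Hac, Had; reflexivity.
Qed.

(** * Ordinals *)

Lemma ordinal_mem a b : ordinal a -> b ∈ a -> ordinal b.
Proof.
  intros [Ta Ea] Hb; split; [apply Ea; auto|].
  intros c Hc; apply Ea; exact (Ta b Hb c Hc).
Qed.

Lemma ordinal_total a b : ordinal a -> ordinal b -> a ∈ b \/ a ≈ b \/ b ∈ a.
Proof.
  revert b; induction a as [a IHa] using mem_ind; intros b.
  induction b as [b IHb] using mem_ind; intros Ha Hb.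
  destruct (classic (a ∈ b \/ b ∈ a)) as [H | H]; [tauto|].
  right; left; apply incl_antisym; intros c Hc.
  - destruct (IHa c Hc b (ordinal_mem _ _ Ha Hc) Hb) as [K | [K | K]]; auto.
    + rewrite K in Hc; tauto.
    + elim H; right; exact (proj1 Ha c Hc b K).
  - destruct (IHb c Hc Ha (ordinal_mem _ _ Hb Hc)) as [K | [K | K]]; auto.
    + elim H; left; exact (proj1 Hb c Hc a K).
    + rewrite <- K in Hc; tauto.
Qed.

Lemma ordinal_incl a b : ordinal a -> ordinal b -> a ⊆ b -> a ∈ b \/ a ≈ b.
Proof.
  intros Ha Hb H; destruct (ordinal_total a b Ha Hb) as [K | [K | K]]; auto.
  elim (mem_irrefl b (H b K)).
Qed.

Lemma ordinal_incl_total a b : ordinal a -> ordinal b -> a ⊆ b \/ b ∈ a.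
Proof.
  intros Ha Hb; destruct (ordinal_total a b Ha Hb) as [K | [K | K]]; auto; left.
  - exact (proj1 Hb a K).
  - rewrite K; intros z; auto.
Qed.

Lemma ordinal_incl_mem a b c : ordinal a -> ordinal c -> a ⊆ b -> b ∈ c -> a ∈ c.
Proof.
  intros Ha Hc H Hb.
  destruct (ordinal_incl a b Ha (ordinal_mem _ _ Hc Hb) H) as [K | K].
  - exact (proj1 Hc b Hb a K).
  - rewrite K; exact Hb.
Qed.

Lemma ordinal_empty : ordinal vempty.
Proof. split; intros y Hy; elim (mem_empty _ Hy). Qed.

Lemma ordinal_succ a : ordinal a -> ordinal (vsucc a).
Proof.
  intros [Ta Ea]; split.
  - intros y Hy z Hz; rewrite mem_succ in *; destruct Hy as [Hy | Hy].
    + left; exact (Ta y Hy z Hz).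
    + rewrite Hy in Hz; auto.
  - intros y Hy; rewrite mem_succ in Hy; destruct Hy as [Hy | ->]; auto.
Qed.

Lemma ordinal_nat n : ordinal (vnat n).
Proof. induction n; [apply ordinal_empty | apply ordinal_succ; auto]. Qed.

Lemma mem_self_succ a : a ∈ vsucc a.
Proof. rewrite mem_succ; right; reflexivity. Qed.

Lemma incl_succ a : a ⊆ vsucc a.
Proof. intros z Hz; rewrite mem_succ; auto. Qed.

Lemma nat_mem m n : m < n -> vnat m ∈ vnat n.
Proof.
  induction 1; simpl; [apply mem_self_succ | rewrite mem_succ; auto].
Qed.

Lemma nat_inj m n : vnat m ≈ vnat n -> m = n.
Proof.
  intros H; destruct (PeanoNat.Nat.lt_trichotomy m n) as [K | [K | K]]; auto;
    apply nat_mem in K; rewrite H in K; elim (mem_irrefl _ K).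
Qed.

Lemma nat_incl_omega n : vnat n ⊆ omega.
Proof.
  intros z Hz; induction n as [|n IH]; [elim (mem_empty _ Hz)|].
  simpl in Hz; rewrite mem_succ in Hz; destruct Hz as [Hz | Hz]; auto.
  exists n; exact Hz.
Qed.

Lemma ordinal_omega : ordinal omega.
Proof.
  split.
  - intros y [m Hm]; rewrite Hm; apply nat_incl_omega.
  - intros y [m Hm]; rewrite Hm; apply ordinal_nat.
Qed.

(** * Ordinal addition, multiplication and closure properties of γ·ω *)

Lemma mem_oadd z a b : z ∈ oadd a b <-> z ∈ a \/ exists c, c ∈ b /\ z ≈ oadd a c.
Proof.
  (* [oadd] recurses on a presentation of [b]; an equation in terms of members presupposes that
     bisimilar presentations give the same sum. *)
  cut (forall b b', b ≈ b' -> oadd a b ≈ oadd a b').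
  { intros E; destruct b as [J g]; simpl; rewrite mem_cup; apply or_iff_compat_l; split.
    - intros [j Hj]; exists (g j); split; auto; exists j; reflexivity.
    - intros [c [[j Hj] Hc]]; exists j; rewrite Hc; apply E; exact Hj. }
  intros x; induction x as [A f IH]; intros [B h] [H1 H2]; apply veq_ext; intros y.
  simpl; rewrite !mem_cup, !mem_sup; apply or_iff_compat_l; split.
  - intros [i Hi]; destruct (H1 i) as [j Hj]; exists j; rewrite Hi; auto.
  - intros [j Hj]; destruct (H2 j) as [i Hi]; exists i; rewrite Hj; symmetry; auto.
Qed.

#[global] Instance oadd_proper : Proper (veq ==> veq ==> veq) oadd.
Proof.
  intros a a' Ha b; induction b as [b IH] using mem_ind; intros b' Hb.
  apply veq_ext; intros z; rewrite !mem_oadd, Ha; apply or_iff_compat_l; split.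
  - intros [c [Hc Hz]]; exists c; rewrite <- Hb; split; auto.
    rewrite Hz; apply IH; auto; reflexivity.
  - intros [c [Hc Hz]]; rewrite <- Hb in Hc; exists c; split; auto.
    rewrite Hz; symmetry; apply IH; auto; reflexivity.
Qed.

Lemma oadd_incl_l a b : a ⊆ oadd a b.
Proof. intros z Hz; rewrite mem_oadd; auto. Qed.

Lemma oadd_mem_r a b c : c ∈ b -> oadd a c ∈ oadd a b.
Proof. intros H; rewrite mem_oadd; right; exists c; split; auto; reflexivity. Qed.

Lemma oadd_incl_r a b c : c ⊆ b -> oadd a c ⊆ oadd a b.
Proof. intros H z; rewrite !mem_oadd; firstorder. Qed.

Lemma ordinal_oadd a b : ordinal a -> ordinal b -> ordinal (oadd a b).
Proof.
  intros Ha; induction b as [b IH] using mem_ind; intros Hb; split.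
  - intros y Hy z Hz; rewrite mem_oadd in *; destruct Hy as [Hy | [c [Hc Hy]]].
    + left; exact (proj1 Ha y Hy z Hz).
    + rewrite Hy, mem_oadd in Hz; destruct Hz as [Hz | [d [Hd Hz]]]; auto.
      right; exists d; split; auto; exact (proj1 Hb c Hc d Hd).
  - intros y Hy; rewrite mem_oadd in Hy; destruct Hy as [Hy | [c [Hc Hy]]].
    + exact (proj2 Ha y Hy).
    + rewrite Hy; apply IH; auto; exact (ordinal_mem _ _ Hb Hc).
Qed.

Lemma oadd_empty a : oadd a vempty ≈ a.
Proof.
  apply veq_ext; intros z; rewrite mem_oadd; split; auto.
  intros [H | [c [Hc _]]]; auto; elim (mem_empty _ Hc).
Qed.

Lemma oadd_succ a b : oadd a (vsucc b) ≈ vsucc (oadd a b).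
Proof.
  apply veq_ext; intros z; rewrite mem_succ, !mem_oadd.
  setoid_rewrite mem_succ; split.
  - intros [H | [c [[Hc | Hc] Hz]]]; auto.
    + left; right; exists c; auto.
    + right; rewrite Hz, Hc; reflexivity.
  - intros [[H | [c [Hc Hz]]] | Hz]; auto; right.
    + exists c; auto.
    + exists b; split; auto; right; reflexivity.
Qed.

Lemma oadd_assoc a b c : oadd (oadd a b) c ≈ oadd a (oadd b c).
Proof.
  induction c as [c IH] using mem_ind; apply veq_ext; intros z.
  rewrite (mem_oadd z a (oadd b c)), (mem_oadd z (oadd a b) c), (mem_oadd z a b); split.
  - intros [[H | [d [Hd Hz]]] | [d [Hd Hz]]]; auto; right.
    + exists d; split; auto; apply oadd_incl_l; auto.
    + exists (oadd b d); split; [apply oadd_mem_r; auto | rewrite Hz; auto].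
  - intros [H | [d [Hd Hz]]]; auto.
    rewrite mem_oadd in Hd; destruct Hd as [Hd | [e [He Hd]]].
    + left; right; exists d; auto.
    + right; exists e; split; auto; rewrite Hz, Hd; symmetry; auto.
Qed.

Lemma oadd_mono_l a b c : ordinal a -> ordinal b -> ordinal c ->
  a ⊆ b -> oadd a c ⊆ oadd b c.
Proof.
  intros Ha Hb; induction c as [c IH] using mem_ind; intros Hc H z Hz.
  rewrite mem_oadd in Hz; destruct Hz as [Hz | [d [Hd Hz]]].
  - apply oadd_incl_l; auto.
  - assert (Od := ordinal_mem _ _ Hc Hd).
    rewrite Hz; apply (ordinal_incl_mem _ (oadd b d)).
    + apply ordinal_oadd; auto.
    + apply ordinal_oadd; auto.
    + apply IH; auto.
    + apply oadd_mem_r; auto.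
Qed.

Lemma mem_omul z a b : z ∈ omul a b <-> exists c, c ∈ b /\ z ∈ oadd (omul a c) a.
Proof.
  cut (forall b b', b ≈ b' -> omul a b ≈ omul a b').
  { intros E; destruct b as [J g]; simpl; rewrite mem_bigcup; split.
    - intros [j Hj]; exists (g j); split; auto; exists j; reflexivity.
    - intros [c [[j Hj] Hc]]; exists j; rewrite <- (E _ _ Hj); exact Hc. }
  intros x; induction x as [A f IH]; intros [B h] [H1 H2]; apply veq_ext; intros y.
  simpl; rewrite !mem_bigcup; split.
  - intros [i Hi]; destruct (H1 i) as [j Hj]; exists j; rewrite <- (IH i _ Hj); auto.
  - intros [j Hj]; destruct (H2 j) as [i Hi]; exists i; rewrite (IH i _ Hi); auto.
Qed.

#[global] Instance omul_proper : Proper (veq ==> veq ==> veq) omul.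
Proof.
  intros a a' Ha b; induction b as [b IH] using mem_ind; intros b' Hb.
  apply veq_ext; intros z; rewrite !mem_omul; split.
  - intros [c [Hc Hz]]; exists c; rewrite <- Hb; split; auto.
    rewrite <- (IH c Hc c (veq_refl c)), <- Ha; auto.
  - intros [c [Hc Hz]]; rewrite <- Hb in Hc; exists c; split; auto.
    rewrite (IH c Hc c (veq_refl c)), Ha; auto.
Qed.

Lemma ordinal_omul a b : ordinal a -> ordinal (omul a b).
Proof.
  intros Ha; induction b as [b IH] using mem_ind; split.
  - intros y Hy z Hz; rewrite mem_omul in *; destruct Hy as [c [Hc Hy]].
    exists c; split; auto.
    exact (proj1 (ordinal_oadd _ _ (IH c Hc) Ha) y Hy z Hz).
  - intros y Hy; rewrite mem_omul in Hy; destruct Hy as [c [Hc Hy]].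
    exact (proj2 (ordinal_oadd _ _ (IH c Hc) Ha) y Hy).
Qed.

Lemma omul_incl_mem a b c : c ∈ b -> oadd (omul a c) a ⊆ omul a b.
Proof. intros H z Hz; rewrite mem_omul; eauto. Qed.

Lemma mem_omul_omega z a : z ∈ omul a omega <-> exists n, z ∈ omul a (vnat n).
Proof.
  rewrite mem_omul; split.
  - intros [c [[n Hn] Hz]]; simpl in Hn; exists (S n); rewrite mem_omul.
    exists c; split; auto; rewrite Hn; apply mem_self_succ.
  - intros [n Hz]; rewrite mem_omul in Hz; destruct Hz as [c [Hc Hz]].
    exists c; split; auto; exact (nat_incl_omega n c Hc).
Qed.

Fixpoint osucc (n : nat) (a : V) : V :=
  match n with O => a | S m => vsucc (osucc m a) end.

#[global] Instance osucc_proper n : Proper (veq ==> veq) (osucc n).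
Proof. intros a b H; induction n; simpl; [exact H | apply vsucc_proper; exact IHn]. Qed.

Lemma osucc_add m n a : osucc m (osucc n a) = osucc (m + n) a.
Proof. induction m; simpl; congruence. Qed.

Lemma osucc_incl n a : a ⊆ osucc n a.
Proof. induction n; simpl; intros z Hz; auto; apply incl_succ; auto. Qed.

Lemma osucc_mono_n m n a : m <= n -> osucc m a ⊆ osucc n a.
Proof. induction 1; intros z Hz; auto; apply incl_succ; auto. Qed.

Lemma ordinal_osucc n a : ordinal a -> ordinal (osucc n a).
Proof. intros; induction n; simpl; auto using ordinal_succ. Qed.

Lemma oadd_osucc n a b : oadd a (osucc n b) ≈ osucc n (oadd a b).
Proof. induction n; cbn [osucc]; [reflexivity | rewrite oadd_succ, IHn; reflexivity]. Qed.

Lemma succ_mono a b : ordinal a -> ordinal b -> a ⊆ b -> vsucc a ⊆ vsucc b.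
Proof.
  intros Ha Hb H z; rewrite !mem_succ; intros [Hz | Hz]; auto.
  rewrite Hz; apply ordinal_incl; auto.
Qed.

Lemma osucc_mono n a b : ordinal a -> ordinal b -> a ⊆ b -> osucc n a ⊆ osucc n b.
Proof.
  intros Ha Hb H; induction n; simpl; auto.
  apply succ_mono; auto using ordinal_osucc.
Qed.

Lemma mem_succ_incl a b : ordinal b -> a ∈ b -> vsucc a ⊆ b.
Proof.
  intros Hb Ha z; rewrite mem_succ; intros [Hz | ->]; auto.
  exact (proj1 Hb a Ha z Hz).
Qed.

(** The successor of a member of x is included in x, and equality would make x a successor. *)
Lemma nonsucc_osucc n a x : ordinal x -> (forall y, y ∈ x -> ~ x ≈ vsucc y) ->
  a ∈ x -> osucc n a ∈ x.
Proof.
  intros Hx H Ha; induction n; simpl; auto.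
  destruct (ordinal_incl (vsucc (osucc n a)) x) as [K | K]; auto.
  - apply ordinal_succ; exact (ordinal_mem _ _ Hx IHn).
  - apply mem_succ_incl; auto.
  - elim (H _ IHn); symmetry; exact K.
Qed.

Lemma osucc_empty n : osucc n vempty = vnat n.
Proof. induction n; simpl; congruence. Qed.

Lemma omul_nat_succ a n : ordinal a -> omul a (vnat (S n)) ≈ oadd (omul a (vnat n)) a.
Proof.
  intros Ha; apply incl_antisym; [|apply omul_incl_mem, mem_self_succ].
  intros z Hz; rewrite mem_omul in Hz; destruct Hz as [c [Hc Hz]].
  simpl in Hc; rewrite mem_succ in Hc; destruct Hc as [Hc | Hc]; [|rewrite <- Hc; auto].
  apply oadd_incl_l; apply (omul_incl_mem _ _ _ Hc); auto.
Qed.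

(** If l < γ·n, then ω ≤ γ gives l + γ + ω ≤ γ·n + γ + γ = γ·(n+2) < γ·(n+3). This is the room that
    a recursion of length γ needs when it starts at time l. *)
Lemma omul_omega_closed g l : ordinal g -> omega ⊆ g -> l ∈ omul g omega ->
  oadd l (oadd g omega) ∈ omul g omega.
Proof.
  intros Hg Hw Hl; rewrite mem_omul_omega in Hl; destruct Hl as [n Hn].
  assert (Og : forall n, ordinal (omul g (vnat n))) by (intros; apply ordinal_omul; auto).
  pose proof ordinal_omega as Ow.
  assert (Ol := ordinal_mem _ _ (Og n) Hn).
  rewrite mem_omul_omega; exists (S (S (S n))).
  apply (ordinal_incl_mem _ (omul g (vnat (S (S n))))); auto.
  - repeat apply ordinal_oadd; auto.
  - rewrite (omul_nat_succ g (S n)), (omul_nat_succ g n), oadd_assoc by auto.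
    intros z Hz; apply (oadd_mono_l l (omul g (vnat n))) in Hz; auto using ordinal_oadd.
    + revert z Hz; apply oadd_incl_r, oadd_incl_r; auto.
    + exact (proj1 (Og n) l Hn).
  - rewrite (omul_nat_succ g (S (S n))) by auto.
    rewrite <- (oadd_empty (omul g (vnat (S (S n))))) at 1.
    apply oadd_mem_r, Hw; exists 0; reflexivity.
Qed.

Lemma empty_mem_omul_omega g : ordinal g -> omega ⊆ g -> vempty ∈ omul g omega.
Proof.
  intros Hg Hw; rewrite mem_omul_omega; exists 1; rewrite omul_nat_succ by auto.
  rewrite mem_oadd; right; exists vempty; split; [apply Hw; exists 0; reflexivity|].
  rewrite oadd_empty; symmetry; apply veq_ext; intros z; rewrite mem_omul.
  split; [intros [c [Hc _]]; elim (mem_empty _ Hc) | intros H; elim (mem_empty _ H)].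
Qed.

Lemma omul_omega_succ_closed g l : ordinal g -> omega ⊆ g -> l ∈ omul g omega ->
  vsucc l ∈ omul g omega.
Proof.
  intros Hg Hw Hl.
  assert (OG : ordinal (omul g omega)) by (apply ordinal_omul; auto).
  apply (ordinal_incl_mem _ (oadd l (oadd g omega))); auto.
  - apply ordinal_succ; exact (ordinal_mem _ _ OG Hl).
  - rewrite <- (oadd_empty l) at 1; rewrite <- oadd_succ.
    apply oadd_incl_r; intros z Hz; rewrite mem_succ in Hz.
    assert (H0 : vempty ∈ oadd g omega).
    { apply oadd_incl_l, Hw; exists 0; reflexivity. }
    destruct Hz as [Hz | ->]; auto; elim (mem_empty _ Hz).
  - apply omul_omega_closed; auto.
Qed.

(** The exponent 0 already suffices: ω^0·ω occurs in the union defining ω^ω, and k ≤ 1·k by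
    induction on k. *)
Lemma omega_incl_oexp : omega ⊆ oexp omega omega.
Proof.
  set (a := oexp omega (vnat 0)).
  assert (Ha : a ≈ vnat 1).
  { apply veq_ext; intros z; unfold a; simpl oexp; rewrite mem_cup, mem_bigcup.
    split; auto; intros [H | [[] _]]; auto. }
  assert (Oa : ordinal a) by (rewrite Ha; apply ordinal_nat).
  assert (Om : forall k, ordinal (omul a (vnat k))) by (intros; apply ordinal_omul; auto).
  assert (Hk : forall k, omul a (vnat k) ∈ omul a (vnat (S k))).
  { intros k; rewrite omul_nat_succ by auto.
    rewrite <- (oadd_empty (omul a (vnat k))) at 1.
    apply oadd_mem_r; rewrite Ha; apply mem_self_succ. }
  assert (Hi : forall k, vnat k ⊆ omul a (vnat k)).
  { induction k; intros z Hz; [elim (mem_empty _ Hz)|].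
    simpl in Hz; rewrite mem_succ in Hz; destruct Hz as [Hz | Hz].
    - exact (proj1 (Om (S k)) _ (Hk k) z (IHk z Hz)).
    - rewrite Hz; apply (ordinal_incl_mem _ (omul a (vnat k))); auto using ordinal_nat. }
  intros x [n Hn]; simpl in Hn; rewrite Hn; clear x Hn; unfold omega at 2; simpl.
  rewrite mem_cup; right; rewrite mem_bigcup; exists 0.
  change (vnat n ∈ omul a omega); rewrite mem_omul_omega; exists (S n).
  apply Hi; apply mem_self_succ.
Qed.

(** * A clocked evaluation game *)

(** The closure that the coding of positions calls for. It is weaker than ZF because the game over N
    is used before N is known to satisfy ZF. *)
Record nice (M : V) : Prop := {
  nice_trans : transitive M;
  nice_empty : vempty ∈ M;
  nice_pair : forall x y, x ∈ M -> y ∈ M -> vpair x y ∈ M;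
  nice_cup : forall x y, x ∈ M -> y ∈ M -> vcup x y ∈ M
}.

Lemma nice_kpair M x y : nice M -> x ∈ M -> y ∈ M -> kpair x y ∈ M.
Proof. intros H Hx Hy; unfold kpair; repeat apply (nice_pair M H); auto. Qed.

Lemma nice_succ M x : nice M -> x ∈ M -> vsucc x ∈ M.
Proof. intros H Hx; apply (nice_cup M H); auto; apply (nice_pair M H); auto. Qed.

Lemma nice_nat M n : nice M -> vnat n ∈ M.
Proof. intros H; induction n; [apply (nice_empty M H) | apply nice_succ; auto]. Qed.

Lemma kpair_mem_trans M x y : transitive M -> kpair x y ∈ M -> x ∈ M /\ y ∈ M.
Proof.
  intros HM H; assert (K : vpair x y ∈ M).
  { apply (HM _ H); unfold kpair; rewrite mem_pair; right; reflexivity. }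
  split; apply (HM _ K); rewrite mem_pair; [left | right]; reflexivity.
Qed.

(** The environment f with variable n set to y. An earlier value of n is not removed, so codes of
    formulas must bind fresh variables only. *)
Definition ins (n y f : V) : V := vcup f (vpair (kpair n y) (kpair n y)).

Lemma mem_ins z n y f : z ∈ ins n y f <-> z ∈ f \/ z ≈ kpair n y.
Proof. unfold ins; rewrite mem_cup, mem_pair; tauto. Qed.

#[global] Instance ins_proper : Proper (veq ==> veq ==> veq ==> veq) ins.
Proof. intros n n' Hn y y' Hy f f' Hf; unfold ins; rewrite Hn, Hy, Hf; reflexivity. Qed.

Lemma nice_ins M n y f : nice M -> n ∈ M -> y ∈ M -> f ∈ M -> ins n y f ∈ M.
Proof.
  intros; apply nice_cup; auto; apply nice_pair; auto; apply nice_kpair; auto.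
Qed.

(** A term is either a constant [(0, a)] or a variable [(1, n)], whose value is
    looked up in the environment [f], a set of pairs (variable, value). *)
Definition val (M t f a : V) : Prop :=
  t ≈ kpair (vnat 0) a \/
  exists n, n ∈ M /\ t ≈ kpair (vnat 1) n /\ kpair n a ∈ f.

Definition cMem (t u : V) : V := kpair (vnat 0) (kpair t u).
Definition cEq (t u : V) : V := kpair (vnat 1) (kpair t u).
Definition cNor (q r : V) : V := kpair (vnat 2) (kpair q r).
Definition cAll (n q : V) : V := kpair (vnat 3) (kpair n q).
Definition cCls (t u : V) : V := kpair (vnat 4) (kpair t u).
Definition cClos (q : V) : V := kpair (vnat 5) q.

(** A position [(q, f)] is a formula code [q] in an environment [f], and the moves lead
    to the positions of which [(q, f)] is the joint denial.  [(cCls t u, f)] asks whether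
    the value of [t] is in the class coded by the value of [u]; a class code [cClos q]
    binds variable 0 to its argument and variable 1 to itself, which gives recursion. *)
Definition move (M v w : V) : Prop :=
  exists q, q ∈ M /\ exists f, f ∈ M /\ v ≈ kpair q f /\
  ((exists t, t ∈ M /\ exists u, u ∈ M /\ q ≈ cMem t u /\ w ≈ vempty /\
      ~ exists a, a ∈ M /\ exists b, b ∈ M /\ val M t f a /\ val M u f b /\ a ∈ b) \/
   (exists t, t ∈ M /\ exists u, u ∈ M /\ q ≈ cEq t u /\ w ≈ vempty /\
      ~ exists a, a ∈ M /\ exists b, b ∈ M /\ val M t f a /\ val M u f b /\ a ≈ b) \/
   (exists r, r ∈ M /\ exists s, s ∈ M /\ q ≈ cNor r s /\
      (w ≈ kpair r f \/ w ≈ kpair s f)) \/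
   (exists n, n ∈ M /\ exists r, r ∈ M /\ q ≈ cAll n r /\
      exists y, y ∈ M /\ w ≈ kpair r (ins n y f)) \/
   (exists t, t ∈ M /\ exists u, u ∈ M /\ q ≈ cCls t u /\
      exists a, a ∈ M /\ exists c, c ∈ M /\ val M t f a /\ val M u f c /\ w ≈ kpair c a) \/
   (exists r, r ∈ M /\ q ≈ cClos r /\
      w ≈ kpair r (ins (vnat 1) q (ins (vnat 0) f vempty)))).

#[global] Instance val_proper : Proper (veq ==> veq ==> veq ==> veq ==> iff) val.
Proof.
  intros M M' HM t t' Ht f f' Hf a a' Ha; unfold val.
  setoid_rewrite HM; setoid_rewrite Ht; setoid_rewrite Hf; setoid_rewrite Ha.
  reflexivity.
Qed.

#[global] Instance move_proper M : Proper (veq ==> veq ==> iff) (move M).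
Proof.
  intros v v' Hv w w' Hw; unfold move.
  setoid_rewrite Hv; setoid_rewrite Hw; reflexivity.
Qed.

(** [win M xi v]: the position [v] evaluates to true with clock [xi].  A position that
    is evaluated within time [eta] keeps its value at all later clocks; at a limit clock
    the values of the moves are those occurring cofinally often. *)
Fixpoint win (M xi v : V) {struct xi} : Prop :=
  match xi with
  | sup J g => forall i, exists j, g i ⊆ g j /\
      forall w, w ∈ M -> move M v w -> ~ win M (g j) w
  end.

Lemma win_clock M c : forall d, c ≈ d -> forall v, win M c v <-> win M d v.
Proof.
  induction c as [C k IH]; intros [D l] [H1 H2] v; simpl; split; intros H i.
  - destruct (H2 i) as [i' Hi]; destruct (H i') as [j' [Hij Hj]].
    destruct (H1 j') as [j Hj']; exists j; split; [rewrite <- Hi, <- Hj'; exact Hij|].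
    intros w Hw Hm; rewrite <- (IH j' (l j) Hj' w); auto.
  - destruct (H1 i) as [i' Hi]; destruct (H i') as [j' [Hij Hj]].
    destruct (H2 j') as [j Hj']; exists j; split; [rewrite Hi, Hj'; exact Hij|].
    intros w Hw Hm; rewrite (IH j (l j') Hj' w); auto.
Qed.

Lemma win_iff M xi v : win M xi v <-> forall zeta, zeta ∈ xi ->
  exists eta, eta ∈ xi /\ zeta ⊆ eta /\ forall w, w ∈ M -> move M v w -> ~ win M eta w.
Proof.
  destruct xi as [J g]; simpl; split; intros H.
  - intros z [i Hi]; destruct (H i) as [j [Hij Hj]]; exists (g j).
    split; [exists j; reflexivity|]; split; auto; rewrite Hi; exact Hij.
  - intros i; destruct (H (g i)) as [eta [[j Hj] [Hi Hw]]]; [exists i; reflexivity|].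
    simpl in Hj; exists j; split; [rewrite <- Hj; exact Hi|].
    intros w H1 H2; rewrite <- (win_clock M _ _ Hj); auto.
Qed.

#[global] Instance win_proper M : Proper (veq ==> veq ==> iff) (win M).
Proof.
  intros x x' Hx v v' Hv; rewrite (win_clock M _ _ Hx v), !win_iff.
  setoid_rewrite Hv; reflexivity.
Qed.

Ltac kinv := repeat match goal with
  | H : kpair _ _ ≈ kpair _ _ |- _ => apply kpair_inj in H; destruct H
  | H : vnat _ ≈ vnat _ |- _ => apply nat_inj in H; try discriminate H
  end.

Ltac niceness := repeat match goal with
  | |- vnat _ ∈ _ => apply nice_nat; assumption
  | |- kpair _ _ ∈ _ => apply nice_kpair; [assumption | |]
  | |- ins _ _ _ ∈ _ => apply nice_ins; [assumption | | |]
  | |- vempty ∈ _ => apply nice_empty; assumption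
  | |- cMem _ _ ∈ _ => unfold cMem
  | |- cEq _ _ ∈ _ => unfold cEq
  | |- cNor _ _ ∈ _ => unfold cNor
  | |- cAll _ _ ∈ _ => unfold cAll
  | |- cCls _ _ ∈ _ => unfold cCls
  | |- cClos _ ∈ _ => unfold cClos
  | |- _ => assumption
  end.

Section Moves.
Context (M : V) (HM : nice M).

Ltac move_inv :=
  intros (q' & Hq' & f' & Hf' & Hv & Hm); unfold cMem, cEq, cNor, cAll, cCls, cClos in *;
  apply kpair_inj in Hv; destruct Hv as [Hv1 Hv2];
  setoid_rewrite <- Hv1 in Hm; setoid_rewrite <- Hv2 in Hm; clear q' f' Hq' Hf' Hv1 Hv2;
  destruct Hm as [(?t & ?Ht & ?u & ?Hu & ?Hq & Hm) | [(?t & ?Ht & ?u & ?Hu & ?Hq & Hm)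
   | [(?t & ?Ht & ?u & ?Hu & ?Hq & Hm) | [(?t & ?Ht & ?u & ?Hu & ?Hq & Hm)
   | [(?t & ?Ht & ?u & ?Hu & ?Hq & Hm) | (?t & ?Ht & ?Hq & Hm)]]]]];
  kinv.

(** The empty set is not a pair, so as a position it has no moves and is won at every clock. It
    serves as the constant true: a false atomic formula gets a move to it, a true one gets none. *)
Lemma move_empty w : ~ move M vempty w.
Proof.
  intros (q & _ & f & _ & H & _); apply (mem_empty (vpair q q)).
  rewrite H; unfold kpair; rewrite mem_pair; left; reflexivity.
Qed.

Lemma move_mem t u f w : t ∈ M -> u ∈ M -> f ∈ M ->
  move M (kpair (cMem t u) f) w <-> w ≈ vempty /\
    ~ exists a, a ∈ M /\ exists b, b ∈ M /\ val M t f a /\ val M u f b /\ a ∈ b.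
Proof.
  intros Ht Hu Hf; split.
  - move_inv. setoid_rewrite H0; setoid_rewrite H1; exact Hm.
  - intros H; exists (cMem t u); split; [niceness|]; exists f; do 2 (split; [auto; reflexivity|]).
    left; exists t; split; auto; exists u; split; auto; split; [reflexivity | exact H].
Qed.

Lemma move_eq t u f w : t ∈ M -> u ∈ M -> f ∈ M ->
  move M (kpair (cEq t u) f) w <-> w ≈ vempty /\
    ~ exists a, a ∈ M /\ exists b, b ∈ M /\ val M t f a /\ val M u f b /\ a ≈ b.
Proof.
  intros Ht Hu Hf; split.
  - move_inv. setoid_rewrite H0; setoid_rewrite H1; exact Hm.
  - intros H; exists (cEq t u); split; [niceness|]; exists f; do 2 (split; [auto; reflexivity|]).
    right; left; exists t; split; auto; exists u; split; auto; split; [reflexivity | exact H].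
Qed.

Lemma move_nor q r f w : q ∈ M -> r ∈ M -> f ∈ M ->
  move M (kpair (cNor q r) f) w <-> w ≈ kpair q f \/ w ≈ kpair r f.
Proof.
  intros Ht Hu Hf; split.
  - move_inv. setoid_rewrite H0; setoid_rewrite H1; exact Hm.
  - intros H; exists (cNor q r); split; [niceness|]; exists f; do 2 (split; [auto; reflexivity|]).
    do 2 right; left; exists q; split; auto; exists r; split; auto; split; [reflexivity | exact H].
Qed.

Lemma move_all n q f w : n ∈ M -> q ∈ M -> f ∈ M ->
  move M (kpair (cAll n q) f) w <-> exists y, y ∈ M /\ w ≈ kpair q (ins n y f).
Proof.
  intros Ht Hu Hf; split.
  - move_inv. setoid_rewrite H0; setoid_rewrite H1; exact Hm.
  - intros H; exists (cAll n q); split; [niceness|]; exists f; do 2 (split; [auto; reflexivity|]).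
    do 3 right; left; exists n; split; auto; exists q; split; auto; split; [reflexivity | exact H].
Qed.

Lemma move_cls t u f w : t ∈ M -> u ∈ M -> f ∈ M ->
  move M (kpair (cCls t u) f) w <->
    exists a, a ∈ M /\ exists c, c ∈ M /\ val M t f a /\ val M u f c /\ w ≈ kpair c a.
Proof.
  intros Ht Hu Hf; split.
  - move_inv. setoid_rewrite H0; setoid_rewrite H1; exact Hm.
  - intros H; exists (cCls t u); split; [niceness|]; exists f; do 2 (split; [auto; reflexivity|]).
    do 4 right; left; exists t; split; auto; exists u; split; auto; split; [reflexivity | exact H].
Qed.

Lemma move_clos q f w : q ∈ M -> f ∈ M ->
  move M (kpair (cClos q) f) w <->
    w ≈ kpair q (ins (vnat 1) (cClos q) (ins (vnat 0) f vempty)).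
Proof.
  intros Ht Hf; split.
  - move_inv. rewrite <- H0 in Hm; exact Hm.
  - intros H; exists (cClos q); split; [niceness|]; exists f; do 2 (split; [auto; reflexivity|]).
    do 5 right; exists q; split; auto; split; [reflexivity | exact H].
Qed.
End Moves.

(** * Halting *)

Section Halting.
Context (M G : V) (HM : nice M) (HG : ordinal G).

(** The value of v is B at every clock from ξ on. Only clocks below G count, since S records the
    game only up to γ·ω. *)
Definition halt (v : V) (B : Prop) (xi : V) : Prop :=
  forall xi', xi' ∈ G -> xi ⊆ xi' -> (win M xi' v <-> B).

Lemma halt_iff v v' B B' xi xi' : v ≈ v' -> (B <-> B') -> xi ⊆ xi' ->
  halt v B xi -> halt v' B' xi'.
Proof.
  intros Hv HB Hx H x Hx1 Hx2; rewrite <- HB, <- Hv; apply H; auto.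
  intros z Hz; auto.
Qed.

(** One evaluation step costs one tick. A true v is witnessed at the larger of ζ and ξ, where all
    moves have settled to false; a false v has a move that is won from ξ on, which rules out every η
    ≥ ξ. The argument is the same at successor and limit clocks. *)
Lemma halt_move v B xi : ordinal xi ->
  (B -> forall w, w ∈ M -> move M v w -> halt w False xi) ->
  (~ B -> exists w, w ∈ M /\ move M v w /\ halt w True xi) ->
  halt v B (vsucc xi).
Proof.
  intros Ox H1 H2 x Hx Hxx; rewrite win_iff.
  assert (O : ordinal x) by exact (ordinal_mem _ _ HG Hx).
  assert (Hxi : xi ∈ x) by apply Hxx, mem_self_succ.
  assert (HxG : forall y, y ∈ x -> y ∈ G) by exact (proj1 HG x Hx).
  split.
  - intros H; apply NNPP; intros nB; destruct (H2 nB) as [w [Hw [Hm Hh]]].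
    destruct (H xi Hxi) as [eta [He [Hi K]]]; apply (K w Hw Hm).
    apply (Hh eta); auto.
  - intros b z Hz.
    assert (Oz := ordinal_mem _ _ O Hz).
    destruct (ordinal_incl_total z xi Oz Ox) as [K | K].
    + exists xi; split; auto; split; auto; intros w Hw Hm Hwin.
      apply (H1 b w Hw Hm xi) in Hwin; auto; intros u; auto.
    + exists z; split; auto; split; [intros u; auto|]; intros w Hw Hm Hwin.
      apply (H1 b w Hw Hm z) in Hwin; auto; exact (proj1 Oz xi K).
Qed.

Lemma halt_empty xi : halt vempty True xi.
Proof.
  intros x Hx _; rewrite win_iff; split; auto; intros _ z Hz; exists z.
  split; auto; split; [intros u; auto|]; intros w _ Hm; elim (move_empty M w Hm).
Qed.

(** * The cost in clock time of connectives, quantifiers and calls *)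

Definition cNeg (q : V) : V := cNor q q.
Definition cAnd (q r : V) : V := cNor (cNeg q) (cNeg r).
Definition cEx (n q : V) : V := cNeg (cAll n q).

Lemma halt_mem t u f a b xi : t ∈ M -> u ∈ M -> f ∈ M -> a ∈ M -> b ∈ M ->
  (forall x, val M t f x <-> x ≈ a) -> (forall x, val M u f x <-> x ≈ b) ->
  ordinal xi -> halt (kpair (cMem t u) f) (a ∈ b) (vsucc xi).
Proof.
  intros Ht Hu Hf Ha Hb Va Vb Ox; apply halt_move; auto.
  - intros Hab w Hw Hm; rewrite move_mem in Hm by auto; destruct Hm as [_ []].
    exists a; split; auto; exists b; split; auto; rewrite Va, Vb; repeat split; auto; reflexivity.
  - intros nab; exists vempty; split; [niceness|]; split; [|apply halt_empty].
    rewrite move_mem by auto; split; [reflexivity|].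
    intros (x & _ & y & _ & Hx & Hy & Hxy); rewrite Va in Hx; rewrite Vb in Hy.
    rewrite Hx, Hy in Hxy; auto.
Qed.

Lemma halt_eq t u f a b xi : t ∈ M -> u ∈ M -> f ∈ M -> a ∈ M -> b ∈ M ->
  (forall x, val M t f x <-> x ≈ a) -> (forall x, val M u f x <-> x ≈ b) ->
  ordinal xi -> halt (kpair (cEq t u) f) (a ≈ b) (vsucc xi).
Proof.
  intros Ht Hu Hf Ha Hb Va Vb Ox; apply halt_move; auto.
  - intros Hab w Hw Hm; rewrite move_eq in Hm by auto; destruct Hm as [_ []].
    exists a; split; auto; exists b; split; auto; rewrite Va, Vb; repeat split; auto; reflexivity.
  - intros nab; exists vempty; split; [niceness|]; split; [|apply halt_empty].
    rewrite move_eq by auto; split; [reflexivity|].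
    intros (x & _ & y & _ & Hx & Hy & Hxy); rewrite Va in Hx; rewrite Vb in Hy.
    rewrite Hx, Hy in Hxy; auto.
Qed.

Lemma halt_neg q f B xi : q ∈ M -> f ∈ M -> ordinal xi ->
  halt (kpair q f) B xi -> halt (kpair (cNeg q) f) (~ B) (vsucc xi).
Proof.
  intros Hq Hf Ox H; apply halt_move; auto; unfold cNeg.
  - intros nB w Hw Hm; rewrite move_nor in Hm by auto.
    eapply halt_iff; [symmetry; destruct Hm as [Hm | Hm]; exact Hm | | intros z; exact id | exact H].
    tauto.
  - intros nB; exists (kpair q f); split; [niceness|]; split.
    + rewrite move_nor by auto; left; reflexivity.
    + eapply halt_iff; [reflexivity | | intros z; exact id | exact H]; tauto.
Qed.

(** A false first conjunct already decides the value, so the second has to settle only if the first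
    is true. This lets a guard protect a self-call that might otherwise never settle. *)
Lemma halt_and q r f B1 B2 xi : q ∈ M -> r ∈ M -> f ∈ M -> ordinal xi ->
  halt (kpair q f) B1 xi -> (B1 -> halt (kpair r f) B2 xi) ->
  halt (kpair (cAnd q r) f) (B1 /\ B2) (osucc 2 xi).
Proof.
  intros Hq Hr Hf Ox H1 H2.
  assert (N1 := halt_neg q f B1 xi Hq Hf Ox H1).
  assert (N2 := fun b => halt_neg r f B2 xi Hr Hf Ox (H2 b)).
  assert (Mq : cNeg q ∈ M) by (unfold cNeg; niceness).
  assert (Mr : cNeg r ∈ M) by (unfold cNeg; niceness).
  apply (halt_move _ _ (vsucc xi)); [apply ordinal_succ; auto | |]; unfold cAnd.
  - intros [b1 b2] w Hw Hm; rewrite move_nor in Hm by auto; destruct Hm as [Hm | Hm].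
    + eapply halt_iff; [symmetry; exact Hm | | intros z; exact id | exact N1]; tauto.
    + eapply halt_iff; [symmetry; exact Hm | | intros z; exact id | exact (N2 b1)]; tauto.
  - intros nB; destruct (classic B1) as [b1 | nb1].
    + exists (kpair (cNeg r) f); split; [niceness|]; split.
      * rewrite move_nor by auto; right; reflexivity.
      * eapply halt_iff; [reflexivity | | intros z; exact id | exact (N2 b1)]; tauto.
    + exists (kpair (cNeg q) f); split; [niceness|]; split.
      * rewrite move_nor by auto; left; reflexivity.
      * eapply halt_iff; [reflexivity | | intros z; exact id | exact N1]; tauto.
Qed.

Lemma halt_all n q f (B : V -> Prop) xi : n ∈ M -> q ∈ M -> f ∈ M -> ordinal xi ->
  (forall y, y ∈ M -> halt (kpair q (ins n y f)) (B y) xi) ->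
  halt (kpair (cAll n q) f) (forall y, y ∈ M -> ~ B y) (vsucc xi).
Proof.
  intros Hn Hq Hf Ox H; apply halt_move; auto.
  - intros nB w Hw Hm; rewrite move_all in Hm by auto; destruct Hm as [y [Hy Hm]].
    eapply halt_iff; [symmetry; exact Hm | | intros z; exact id | exact (H y Hy)].
    specialize (nB y Hy); tauto.
  - intros nB; apply not_all_ex_not in nB; destruct nB as [y nB].
    apply imply_to_and in nB; destruct nB as [Hy nB].
    exists (kpair q (ins n y f)); split; [niceness|]; split.
    + rewrite move_all by auto; exists y; split; auto; reflexivity.
    + eapply halt_iff; [reflexivity | | intros z; exact id | exact (H y Hy)]; tauto.
Qed.

Lemma halt_ex n q f (B : V -> Prop) xi : n ∈ M -> q ∈ M -> f ∈ M -> ordinal xi ->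
  (forall y, y ∈ M -> halt (kpair q (ins n y f)) (B y) xi) ->
  halt (kpair (cEx n q) f) (exists y, y ∈ M /\ B y) (osucc 2 xi).
Proof.
  intros Hn Hq Hf Ox H; unfold cEx; simpl osucc.
  eapply halt_iff; [reflexivity | | intros z; exact id |
    apply halt_neg; [niceness | auto | apply ordinal_succ; auto |
      apply (halt_all n q f B xi); auto]].
  split.
  - intros K; apply NNPP; intros nK; apply K; intros y Hy By; apply nK; eauto.
  - intros [y [Hy By]] K; exact (K y Hy By).
Qed.

(** The only move of a call leads to the called position, so the call denies it; the outer [cNeg]
    restores the value. *)
Lemma halt_cls t u f a c B xi : t ∈ M -> u ∈ M -> f ∈ M -> a ∈ M -> c ∈ M ->
  (forall x, val M t f x <-> x ≈ a) -> (forall x, val M u f x <-> x ≈ c) ->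
  ordinal xi -> halt (kpair c a) B xi ->
  halt (kpair (cNeg (cCls t u)) f) B (osucc 2 xi).
Proof.
  intros Ht Hu Hf Ha Hc Va Vc Ox H.
  apply (halt_iff (kpair (cNeg (cCls t u)) f) _ (~ ~ B) B (osucc 2 xi) _ (veq_refl _)); [tauto | intros z; exact id |].
  apply halt_neg; [niceness | auto | apply ordinal_succ; auto |].
  assert (Hm : forall w, move M (kpair (cCls t u) f) w <-> w ≈ kpair c a).
  { intros w; rewrite move_cls by auto; split.
    - intros (x & _ & y & _ & Hx & Hy & Hw); rewrite Va in Hx; rewrite Vc in Hy.
      rewrite Hw, Hx, Hy; reflexivity.
    - intros Hw; exists a; split; auto; exists c; split; auto; rewrite Va, Vc.
      repeat split; auto; reflexivity. }
  apply halt_move; auto.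
  - intros nB w Hw Hmw; rewrite Hm in Hmw.
    eapply halt_iff; [symmetry; exact Hmw | | intros z; exact id | exact H]; tauto.
  - intros nB; exists (kpair c a); split; [niceness|]; split; [apply Hm; reflexivity|].
    eapply halt_iff; [reflexivity | | intros z; exact id | exact H]; tauto.
Qed.

(** Entering the body of a closure is also a denial, which the negated body compensates. *)
Lemma halt_clos q x B xi : q ∈ M -> x ∈ M -> ordinal xi ->
  halt (kpair q (ins (vnat 1) (cClos (cNeg q)) (ins (vnat 0) x vempty))) B xi ->
  halt (kpair (cClos (cNeg q)) x) B (osucc 2 xi).
Proof.
  intros Hq Hx Ox H.
  set (f := ins (vnat 1) (cClos (cNeg q)) (ins (vnat 0) x vempty)) in *.
  assert (Mq : cNeg q ∈ M) by (unfold cNeg; niceness).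
  assert (Mf : f ∈ M) by (unfold f; niceness).
  assert (Hn := halt_neg q f B xi Hq Mf Ox H).
  apply halt_move; [apply ordinal_succ; auto | |].
  - intros b w Hw Hm; rewrite move_clos in Hm by auto.
    eapply halt_iff; [symmetry; exact Hm | | intros z; exact id | exact Hn]; tauto.
  - intros nB; exists (kpair (cNeg q) f); split; [niceness|]; split.
    + rewrite move_clos by auto; reflexivity.
    + eapply halt_iff; [reflexivity | | intros z; exact id | exact Hn]; tauto.
Qed.

(** * Coding first-order formulas *)

Definition tConst (a : V) : V := kpair (vnat 0) a.
Definition tVar (n : nat) : V := kpair (vnat 1) (vnat n).

(** Stronger than [val]: a variable has exactly one value, and its index lies below the level n, so
    bindings made from level n on cannot disturb it. *)
Definition tval (n : nat) (f t a : V) : Prop :=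
  t ≈ tConst a \/
  exists m, m < n /\ t ≈ tVar m /\ forall x, kpair (vnat m) x ∈ f <-> x ≈ a.

Definition fresh (n : nat) (f : V) : Prop :=
  forall m x, n <= m -> ~ kpair (vnat m) x ∈ f.

Lemma tval_val n f t a : tval n f t a -> forall x, val M t f x <-> x ≈ a.
Proof.
  intros [H | [m [Hm [Ht H]]]] x; unfold val; unfold tConst, tVar in *; split.
  - intros [K | [k [_ [K _]]]]; rewrite H in K; kinv; symmetry; auto.
  - intros ->; left; exact H.
  - intros [K | [k [_ [K Kx]]]]; rewrite Ht in K; kinv.
    apply H; rewrite H1; exact Kx.
  - intros Hx; right; exists (vnat m); split; [niceness|]; split; auto; apply H; auto.
Qed.

Lemma tval_in n f t a : tval n f t a -> a ∈ M -> t ∈ M.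
Proof.
  unfold tConst, tVar; intros [H | [m [_ [H _]]]] Ha; rewrite H;
    unfold tConst, tVar; niceness.
Qed.

Lemma tval_le n n' f t a : n <= n' -> tval n f t a -> tval n' f t a.
Proof.
  intros Hn [H | [m [Hm H]]]; [left; auto | right; exists m; split; auto; lia].
Qed.

Lemma tval_ins n n' f t a y : n <= n' -> tval n f t a -> tval n (ins (vnat n') y f) t a.
Proof.
  intros Hn [H | [m [Hm [Ht H]]]]; [left; auto | right; exists m; split; auto; split; auto].
  intros x; rewrite mem_ins, H; split; auto.
  intros [K | K]; auto; kinv; lia.
Qed.

Lemma tval_var n f y : fresh n f -> tval (S n) (ins (vnat n) y f) (tVar n) y.
Proof.
  intros Hf; right; exists n; split; auto; split; [reflexivity|].
  intros x; rewrite mem_ins, kpair_inj; split.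
  - intros [K | K]; [elim (Hf n x (le_n n) K) | apply K].
  - intros K; right; split; auto; reflexivity.
Qed.

Lemma fresh_ins n f y : fresh n f -> fresh (S n) (ins (vnat n) y f).
Proof.
  intros Hf m x Hm K; rewrite mem_ins in K; destruct K as [K | K].
  - apply (Hf m x); auto; lia.
  - kinv; lia.
Qed.

Lemma fresh_empty : fresh 0 vempty.
Proof. intros m x _; apply mem_empty. Qed.

(** Bound variables are named by level: the quantifier met at level n binds variable n. Class atoms
    are left to [atom], because a class parameter is simply called while the class under recursion
    is called under a guard, itself a formula coded from level n. The instances under [cAll] are
    negated, as [cAll] is their joint denial. *)
Fixpoint code {C X : Set} (atom : nat -> C -> V -> V) (n : nat) (p : fml C X)
    {struct p} : (X -> V) -> V :=
  match p with
  | fMem i j => fun nu => cMem (nu i) (nu j)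
  | fEq i j => fun nu => cEq (nu i) (nu j)
  | fCls i c => fun nu => atom n c (nu i)
  | fBot => fun nu => cMem (tConst vempty) (tConst vempty)
  | fImp q r => fun nu => cNeg (cAnd (code atom n q nu) (cNeg (code atom n r nu)))
  | fAll q => fun nu => cAll (vnat n) (cNeg (code atom (S n) q (ext (tVar n) nu)))
  end.

(** A bound on the ticks needed beyond those of the class atoms; for an implication the sum stands
    in for the maximum. *)
Fixpoint depth {C X : Set} (p : fml C X) : nat :=
  match p with
  | fCls _ _ => 0
  | fImp q r => 4 + (depth q + depth r)
  | fAll q => 2 + depth q
  | _ => 1
  end.

Fixpoint all_cls {C X : Set} (P : C -> Prop) (p : fml C X) : Prop :=
  match p with
  | fCls _ c => P c
  | fImp q r => all_cls P q /\ all_cls P r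
  | fAll q => all_cls P q
  | _ => True
  end.

Lemma code_in {C X : Set} (atom : nat -> C -> V -> V) (p : fml C X) :
  (forall n c t, t ∈ M -> atom n c t ∈ M) ->
  forall n nu, (forall i, nu i ∈ M) -> code atom n p nu ∈ M.
Proof.
  intros Ha; induction p; simpl; intros n nu Hnu;
    unfold cNeg, cAnd, cNeg, tConst; niceness; auto.
  all: apply IHp; intros [i|]; simpl; auto; unfold tVar; niceness.
Qed.

(** [f0] is the environment outside of the formula; the formula only adds variables
    of level at least [n0] to it. *)
Definition atom_halts {C : Set} (atom : nat -> C -> V -> V) (cl : C -> V) (n0 : nat)
    (f0 xi : V) (c : C) : Prop :=
  forall n f t a, n0 <= n -> f ∈ M -> a ∈ M ->
    (forall u b, tval n0 f0 u b -> tval n0 f u b) -> fresh n f -> tval n f t a ->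
    halt (kpair (atom n c t) f) (a ∈ cl c) xi.

Lemma code_halts {C X : Set} (atom : nat -> C -> V -> V) (cl : C -> V) n0 f0 xi
    (p : fml C X) :
  (forall n c t, t ∈ M -> atom n c t ∈ M) -> ordinal xi ->
  all_cls (atom_halts atom cl n0 f0 xi) p ->
  forall n f nu e, n0 <= n -> f ∈ M -> (forall u b, tval n0 f0 u b -> tval n0 f u b) ->
    fresh n f -> (forall i, e i ∈ M) -> (forall i, tval n f (nu i) (e i)) ->
    halt (kpair (code atom n p nu) f) (sat M cl e p) (osucc (depth p) xi).
Proof.
  intros Ha Ox; induction p as [X i j | X i j | X i c | X | X q IHq r IHr | X q IHq];
    intros Hp n f nu e Hn Hf He Hfr Hei Hnu;
    assert (Hnuin : forall i, nu i ∈ M) by (intros k; eapply tval_in; eauto).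
  - apply halt_mem; auto; eapply tval_val; eauto.
  - apply halt_eq; auto; eapply tval_val; eauto.
  - apply (Hp n f (nu i) (e i)); auto.
  - eapply halt_iff; [reflexivity | | intros z; exact id |
      apply (halt_mem _ _ f vempty vempty xi); auto; unfold tConst; niceness].
    + simpl; split; [apply mem_empty | tauto].
    + apply (tval_val 0); left; reflexivity.
    + apply (tval_val 0); left; reflexivity.
  - simpl in Hp; destruct Hp as [Hq Hr]; cbn [code depth sat].
    assert (Mq : code atom n q nu ∈ M) by (apply code_in; auto).
    assert (Mr : code atom n r nu ∈ M) by (apply code_in; auto).
    set (k := depth q + depth r).
    assert (Ok : ordinal (osucc k xi)) by (apply ordinal_osucc; auto).
    (* The first conjunct gets one tick to spare, to share a clock with the negated second one. *)
    assert (H1 : halt (kpair (code atom n q nu) f) (sat M cl e q) (vsucc (osucc k xi))).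
    { eapply halt_iff; [reflexivity | reflexivity | | apply (IHq Hq n f nu e); auto].
      apply (osucc_mono_n (depth q) (S k)); lia. }
    assert (H2 : halt (kpair (code atom n r nu) f) (sat M cl e r) (osucc k xi)).
    { eapply halt_iff; [reflexivity | reflexivity | | apply (IHr Hr n f nu e); auto].
      apply (osucc_mono_n (depth r) k); lia. }
    apply halt_neg in H2; auto.
    assert (Mr' : cNeg (code atom n r nu) ∈ M) by (unfold cNeg; niceness).
    pose proof (halt_and _ _ f _ _ _ Mq Mr' Hf (ordinal_succ _ Ok) H1 (fun _ => H2)) as H3.
    apply halt_neg in H3; [| unfold cAnd, cNeg; niceness | auto |
      apply ordinal_osucc, ordinal_succ; auto].
    eapply halt_iff; [reflexivity | | intros z; exact id | exact H3].
    destruct (classic (sat M cl e r)); tauto.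
  - cbn [code depth sat]; simpl in Hp.
    set (k := depth q).
    assert (Ok : ordinal (osucc k xi)) by (apply ordinal_osucc; auto).
    assert (Mq : code atom (S n) q (ext (tVar n) nu) ∈ M).
    { apply code_in; auto; intros [i|]; simpl; auto; unfold tVar; niceness. }
    eapply halt_iff; [reflexivity | | intros z; exact id |
      apply (halt_all _ _ f (fun a => ~ sat M cl (ext a e) q) (vsucc (osucc k xi)));
        [ niceness | unfold cNeg; niceness | auto | apply ordinal_succ; auto | ]].
    + split; intros K a Ha'; [apply NNPP|]; auto.
    + intros y Hy; apply halt_neg; auto; [niceness|].
      apply (IHq Hp (S n) (ins (vnat n) y f) (ext (tVar n) nu) (ext y e)).
      * lia.
      * niceness.
      * intros u b Hu; apply tval_ins; auto.
      * apply fresh_ins; auto.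
      * intros [i|]; simpl; auto.
      * intros [i|]; simpl; [|apply tval_var; auto].
        apply (tval_le n); auto; apply tval_ins; auto.
Qed.

End Halting.

(** * Definability *)

Lemma sat_veq {C X : Set} M (p : fml C X) : forall (cl cl' : C -> V) (e e' : X -> V),
  (forall c, cl c ≈ cl' c) -> (forall i, e i ≈ e' i) ->
  sat M cl e p <-> sat M cl' e' p.
Proof.
  induction p as [X i j | X i j | X i c | X | X q IHq r IHr | X q IHq];
    intros cl cl' e e' Hc He; simpl.
  - rewrite (He i), (He j); reflexivity.
  - rewrite (He i), (He j); reflexivity.
  - rewrite (He i), (Hc c); reflexivity.
  - reflexivity.
  - rewrite (IHq cl cl' e e'), (IHr cl cl' e e'); auto; reflexivity.
  - assert (E : forall a, sat M cl (ext a e) q <-> sat M cl' (ext a e') q).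
    { intros a; apply IHq; auto; intros [i|]; simpl; auto; reflexivity. }
    split; intros H a Ha; apply E; auto.
Qed.

Fixpoint fmap {C C' X X' : Set} (h : C -> C') (k : X -> X') (p : fml C X)
    {struct p} : fml C' X' :=
  match p with
  | fMem i j => fMem (k i) (k j)
  | fEq i j => fEq (k i) (k j)
  | fCls i c => fCls (k i) (h c)
  | fBot => fBot
  | fImp q r => fImp (fmap h k q) (fmap h k r)
  | fAll q => fAll (fmap h (option_map k) q)
  end.

Lemma sat_fmap {C C' X : Set} M (h : C -> C') (p : fml C X) :
  forall (X' : Set) (k : X -> X') cl e,
  sat M cl e (fmap h k p) <-> sat M (fun c => cl (h c)) (fun i => e (k i)) p.
Proof.
  induction p as [X i j | X i j | X i c | X | X q IHq r IHr | X q IHq];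
    intros X' k cl e; simpl; try reflexivity.
  - rewrite IHq, IHr; reflexivity.
  - split; intros H a Ha; specialize (H a Ha).
    + rewrite IHq in H; eapply sat_veq; [| |exact H]; [reflexivity|].
      intros [i|]; reflexivity.
    + rewrite IHq; eapply sat_veq; [| |exact H]; [reflexivity|].
      intros [i|]; reflexivity.
Qed.

Section Definability.
Context (M : V) (HM : nice M) {W : Type} (ok : (W -> V) -> Prop).

(** Uniform definability over M of a family of relations indexed by [W], from
    class-valued parameters satisfying [ok]. *)
Definition D {X : Set} (P : W -> (X -> V) -> Prop) : Prop :=
  exists (C : Set) (cl : C -> W -> V) (p : fml C X), (forall c, ok (cl c)) /\
    forall w e, (forall i, e i ∈ M) -> (sat M (fun c => cl c w) e p <-> P w e).

Lemma D_ext {X : Set} (P Q : W -> (X -> V) -> Prop) :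
  (forall w e, (forall i, e i ∈ M) -> (P w e <-> Q w e)) -> D P -> D Q.
Proof.
  intros H [C [cl [p [Hc Hp]]]]; exists C, cl, p; split; auto.
  intros w e He; rewrite <- H, Hp; auto; reflexivity.
Qed.

Lemma D_veq {X : Set} (P : W -> (X -> V) -> Prop) w e e' : D P ->
  (forall i, e i ∈ M) -> (forall i, e i ≈ e' i) -> P w e -> P w e'.
Proof.
  intros [C [cl [p [Hc Hp]]]] He Hee H; rewrite <- Hp.
  - rewrite <- Hp in H by auto; eapply sat_veq; [| |exact H]; [reflexivity|].
    intros i; symmetry; auto.
  - intros i; rewrite <- Hee; auto.
Qed.

Lemma D_mem_var {X : Set} (i j : X) : D (fun _ e => e i ∈ e j).
Proof. exists Empty_set, (fun c : Empty_set => match c with end), (fMem i j); split; [intros [] | reflexivity]. Qed.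

Lemma D_eq_var {X : Set} (i j : X) : D (fun _ e => e i ≈ e j).
Proof. exists Empty_set, (fun c : Empty_set => match c with end), (fEq i j); split; [intros [] | reflexivity]. Qed.

Lemma D_cls_var {X : Set} (i : X) (A : W -> V) : ok A -> D (fun w e => e i ∈ A w).
Proof. intros H; exists unit, (fun _ => A), (fCls i tt); split; [auto | reflexivity]. Qed.

Lemma D_bot {X : Set} : D (fun _ (_ : X -> V) => False).
Proof. exists Empty_set, (fun c : Empty_set => match c with end), fBot; split; [intros [] | reflexivity]. Qed.

Lemma D_imp {X : Set} (P Q : W -> (X -> V) -> Prop) :
  D P -> D Q -> D (fun w e => P w e -> Q w e).
Proof.
  intros [C [cl [p [Hc Hp]]]] [C' [cl' [q [Hc' Hq]]]].
  exists (C + C')%type, (fun c => match c with inl c => cl c | inr c => cl' c end),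
    (fImp (fmap inl id p) (fmap inr id q)).
  split; [intros [c|c]; auto|]; intros w e He; simpl; rewrite !sat_fmap.
  rewrite <- Hp, <- Hq by auto; reflexivity.
Qed.

Lemma D_all {X : Set} (P : W -> (X -> V) -> V -> Prop) :
  D (X := option X) (fun w e => P w (fun i => e (Some i)) (e None)) ->
  D (fun w e => forall a, a ∈ M -> P w e a).
Proof.
  intros [C [cl [p [Hc Hp]]]]; exists C, cl, (fAll p); split; auto.
  intros w e He; simpl; split; intros H a Ha; specialize (H a Ha);
    (apply (Hp w (ext a e)); [intros [i|]; simpl; auto | exact H]).
Qed.

Lemma D_not {X : Set} (P : W -> (X -> V) -> Prop) : D P -> D (fun w e => ~ P w e).
Proof. intros H; exact (D_imp _ _ H D_bot). Qed.

Lemma D_and {X : Set} (P Q : W -> (X -> V) -> Prop) :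
  D P -> D Q -> D (fun w e => P w e /\ Q w e).
Proof.
  intros HP HQ; apply (D_ext (fun w e => ~ (P w e -> ~ Q w e))).
  - intros; tauto.
  - apply D_not, D_imp; auto; apply D_not; auto.
Qed.

Lemma D_or {X : Set} (P Q : W -> (X -> V) -> Prop) :
  D P -> D Q -> D (fun w e => P w e \/ Q w e).
Proof.
  intros HP HQ; apply (D_ext (fun w e => ~ P w e -> Q w e)).
  - intros; tauto.
  - apply D_imp; auto; apply D_not; auto.
Qed.

Lemma D_iff {X : Set} (P Q : W -> (X -> V) -> Prop) :
  D P -> D Q -> D (fun w e => P w e <-> Q w e).
Proof. intros; apply D_and; apply D_imp; auto. Qed.

Lemma D_ex {X : Set} (P : W -> (X -> V) -> V -> Prop) :
  D (X := option X) (fun w e => P w (fun i => e (Some i)) (e None)) ->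
  D (fun w e => exists a, a ∈ M /\ P w e a).
Proof.
  intros H; apply (D_ext (fun w e => ~ forall a, a ∈ M -> ~ P w e a)).
  - intros w e He; split.
    + intros K; apply NNPP; intros nK; apply K; intros a Ha Pa; apply nK; eauto.
    + intros [a [Ha Pa]] K; exact (K a Ha Pa).
  - apply D_not, (D_all (fun w e a => ~ P w e a)), D_not; exact H.
Qed.

Lemma D_ren {X Y : Set} (k : X -> Y) (P : W -> (X -> V) -> Prop) :
  D P -> D (fun w e => P w (fun i => e (k i))).
Proof.
  intros [C [cl [p [Hc Hp]]]]; exists C, cl, (fmap id k p); split; auto.
  intros w e He; rewrite sat_fmap; apply Hp; auto.
Qed.

(** An operation of M with definable graph. The language has no function symbols, so terms are
    eliminated through their graphs in [D_sub]. *)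
Definition DT {X : Set} (t : (X -> V) -> V) : Prop :=
  (forall e, (forall i, e i ∈ M) -> t e ∈ M) /\
  D (X := option X) (fun _ e => e None ≈ t (fun i => e (Some i))).

Lemma D_sub {X : Set} (P : W -> (X -> V) -> V -> Prop) (t : (X -> V) -> V) :
  D (X := option X) (fun w e => P w (fun i => e (Some i)) (e None)) -> DT t ->
  D (fun w e => P w e (t e)).
Proof.
  intros HP [Ht1 Ht2]; apply (D_ext (fun w e => forall a, a ∈ M -> a ≈ t e -> P w e a)).
  - intros w e He; split.
    + intros H; apply H; [auto | reflexivity].
    + intros H a Ha Hat.
      apply (D_veq _ w (ext (t e) e) (ext a e) HP); auto.
      * intros [i|]; simpl; auto.
      * intros [i|]; simpl; [reflexivity | symmetry; auto].
  - apply D_all; apply D_imp; auto.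
Qed.

Lemma DT_var {X : Set} (i : X) : DT (fun e => e i).
Proof. split; auto; apply D_eq_var. Qed.

Lemma DT_ren {X Y : Set} (k : X -> Y) (t : (X -> V) -> V) :
  DT t -> DT (fun e => t (fun i => e (k i))).
Proof.
  intros [H1 H2]; split.
  - intros e He; apply H1; auto.
  - exact (D_ren (option_map k) _ H2).
Qed.

Definition D1 (P : W -> V -> Prop) : Prop :=
  D (X := option Empty_set) (fun w e => P w (e None)).
Definition D2 (P : W -> V -> V -> Prop) : Prop :=
  D (X := option (option Empty_set)) (fun w e => P w (e (Some None)) (e None)).
Definition D3 (P : W -> V -> V -> V -> Prop) : Prop :=
  D (X := option (option (option Empty_set)))
    (fun w e => P w (e (Some (Some None))) (e (Some None)) (e None)).

Lemma D_rel1 {X : Set} P (t : (X -> V) -> V) : D1 P -> DT t ->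
  D (fun w e => P w (t e)).
Proof.
  intros HP Ht; apply (D_sub (fun w _ a => P w a)); auto.
  refine (D_ren (fun o : option Empty_set => match o with None => None | Some x => match x with end end) _ HP).
Qed.

Lemma D_rel2 {X : Set} P (t u : (X -> V) -> V) : D2 P -> DT t -> DT u ->
  D (fun w e => P w (t e) (u e)).
Proof.
  intros HP Ht Hu; apply (D_sub (fun w e a => P w (t e) a)); auto.
  refine (D_sub (fun w e a => P w a (e None)) _ _ (DT_ren Some t Ht)).
  refine (D_ren (fun o : option (option Empty_set) => match o with
    None => Some None | Some None => None | Some (Some x) => match x with end end) _ HP).
Qed.

Lemma D_rel3 {X : Set} P (t u v : (X -> V) -> V) : D3 P -> DT t -> DT u -> DT v ->
  D (fun w e => P w (t e) (u e) (v e)).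
Proof.
  intros HP Ht Hu Hv; apply (D_sub (fun w e a => P w (t e) (u e) a)); auto.
  refine (D_sub (fun w e a => P w (t (fun i => e (Some i))) a (e None)) _ _ (DT_ren Some u Hu)).
  refine (D_sub (fun w e a => P w a (e None) (e (Some None))) _ _
    (DT_ren (fun i => Some (Some i)) t Ht)).
  refine (D_ren (fun o : option (option (option Empty_set)) => match o with
    None => Some (Some None) | Some None => Some None | Some (Some None) => None
    | Some (Some (Some x)) => match x with end end) _ HP).
Qed.

Lemma D_mem {X : Set} (t u : (X -> V) -> V) : DT t -> DT u -> D (fun _ e => t e ∈ u e).
Proof. apply (D_rel2 (fun _ => mem)); apply D_mem_var. Qed.

Lemma D_eq {X : Set} (t u : (X -> V) -> V) : DT t -> DT u -> D (fun _ e => t e ≈ u e).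
Proof. apply (D_rel2 (fun _ => veq)); apply D_eq_var. Qed.

Lemma D_cls {X : Set} (t : (X -> V) -> V) (A : W -> V) : ok A -> DT t ->
  D (fun w e => t e ∈ A w).
Proof. intros HA; apply (D_rel1 (fun w a => a ∈ A w)); apply D_cls_var; auto. Qed.

Lemma D_incl {X : Set} (t u : (X -> V) -> V) : DT t -> DT u -> D (fun _ e => t e ⊆ u e).
Proof.
  apply (D_rel2 (fun _ => incl)).
  apply (D_ext (fun _ e => forall z, z ∈ M -> z ∈ e (Some None) -> z ∈ e None)).
  - intros w e He; split; intros H z; auto.
    intros Hz; apply H; auto; exact (nice_trans M HM _ (He _) z Hz).
  - apply D_all, D_imp; apply D_mem_var.
Qed.

(** By extensionality in the transitive set M, y = t(e) says that y has the members prescribed by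
    [P]; a definition of the members is therefore enough. *)
Lemma DT_intro {X : Set} (t : (X -> V) -> V) (P : W -> (X -> V) -> V -> Prop) :
  (forall e, (forall i, e i ∈ M) -> t e ∈ M) ->
  (forall w e, (forall i, e i ∈ M) -> forall z, z ∈ M -> (z ∈ t e <-> P w e z)) ->
  D (X := option X) (fun w e => P w (fun i => e (Some i)) (e None)) -> DT t.
Proof.
  intros H1 H2 HP; split; auto.
  apply (D_ext (fun w e => forall z, z ∈ M -> (z ∈ e None <-> P w (fun i => e (Some i)) z))).
  - intros w e He; split.
    + intros H; apply veq_ext; intros z; split; intros Hz.
      * assert (Mz := nice_trans M HM _ (He None) z Hz).
        apply (H2 w (fun i => e (Some i))); auto; apply H; auto.
      * assert (Mz : z ∈ M) by (refine (nice_trans M HM _ _ z Hz); auto).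
        apply H; auto; apply H2; auto.
    + intros H z Hz; rewrite H; apply H2; auto.
  - apply D_all, D_iff; [apply D_mem_var|].
    exact (D_ren (fun o => match o with None => None | Some i => Some (Some i) end) _ HP).
Qed.

Lemma DT_comp2 {X : Set} (f : V -> V -> V) (t u : (X -> V) -> V) :
  (forall x y, x ∈ M -> y ∈ M -> f x y ∈ M) -> D3 (fun _ x y z => z ≈ f x y) ->
  DT t -> DT u -> DT (fun e => f (t e) (u e)).
Proof.
  intros H1 H2 Ht Hu; split.
  - intros e He; apply H1; [apply Ht | apply Hu]; auto.
  - refine (D_rel3 (fun _ x y z => z ≈ f x y) _ _ _ H2 (DT_ren Some t Ht) (DT_ren Some u Hu) _).
    apply DT_var.
Qed.

Lemma DT_pair {X : Set} (t u : (X -> V) -> V) : DT t -> DT u -> DT (fun e => vpair (t e) (u e)).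
Proof.
  apply DT_comp2; [apply (nice_pair M HM)|].
  apply (DT_intro (X := option (option Empty_set)) (fun e => vpair (e (Some None)) (e None))
    (fun _ e z => z ≈ e (Some None) \/ z ≈ e None)).
  - intros; apply (nice_pair M HM); auto.
  - intros; apply mem_pair.
  - apply D_or; apply D_eq_var.
Qed.

Lemma DT_cup {X : Set} (t u : (X -> V) -> V) : DT t -> DT u -> DT (fun e => vcup (t e) (u e)).
Proof.
  apply DT_comp2; [apply (nice_cup M HM)|].
  apply (DT_intro (X := option (option Empty_set)) (fun e => vcup (e (Some None)) (e None))
    (fun _ e z => z ∈ e (Some None) \/ z ∈ e None)).
  - intros; apply (nice_cup M HM); auto.
  - intros; apply mem_cup.
  - apply D_or; apply D_mem_var.
Qed.

Lemma DT_kpair {X : Set} (t u : (X -> V) -> V) : DT t -> DT u -> DT (fun e => kpair (t e) (u e)).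
Proof. intros; unfold kpair; repeat apply DT_pair; auto. Qed.

Lemma DT_ins {X : Set} (t u v : (X -> V) -> V) : DT t -> DT u -> DT v ->
  DT (fun e => ins (t e) (u e) (v e)).
Proof. intros; unfold ins; apply DT_cup; auto; apply DT_pair; apply DT_kpair; auto. Qed.

Lemma DT_succ {X : Set} (t : (X -> V) -> V) : DT t -> DT (fun e => vsucc (t e)).
Proof. intros; unfold vsucc; apply DT_cup; auto; apply DT_pair; auto. Qed.

Lemma DT_empty {X : Set} : DT (fun _ : X -> V => vempty).
Proof.
  apply (DT_intro _ (fun _ _ _ => False)).
  - intros; apply (nice_empty M HM).
  - intros; split; [apply mem_empty | tauto].
  - apply D_bot.
Qed.

Lemma DT_nat {X : Set} n : DT (fun _ : X -> V => vnat n).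
Proof.
  induction n; [apply DT_empty|].
  apply (DT_succ (fun _ => vnat n)); auto.
Qed.

Lemma DT_const {X : Set} a : ok (fun _ => a) -> a ∈ M -> DT (fun _ : X -> V => a).
Proof.
  intros Ha Ma; apply (DT_intro _ (fun _ _ z => z ∈ a)); auto.
  - intros; reflexivity.
  - apply (D_cls_var None (fun _ => a)); auto.
Qed.

End Definability.

Ltac dstep := cbv beta; first
  [ assumption
  | apply D_cls; [solve [auto] |]
  | apply D_mem
  | apply D_eq
  | apply D_incl; [assumption | |]
  | apply DT_var
  | apply DT_empty; [assumption]
  | apply DT_nat; [assumption]
  | apply DT_const; [assumption | solve [auto] | solve [auto]]
  | apply DT_ins; [assumption | | |]
  | apply DT_kpair; [assumption | |]
  | apply DT_succ; [assumption |]
  | apply DT_pair; [assumption | |]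
  | apply DT_cup; [assumption | |]
  | apply D_ex | apply D_all | apply D_iff | apply D_and | apply D_or | apply D_not
  | apply D_bot | apply D_imp ].
Ltac dsolve := repeat dstep.

(** * Definability of the moves of the game *)

Section GameDefinability.
Context (M : V) (HM : nice M) {W : Type} (ok : (W -> V) -> Prop).

Lemma D3_val : D3 M ok (fun _ t f a => val M t f a).
Proof. unfold D3, val; dsolve. Qed.

Lemma D2_move : D2 M ok (fun _ v w => move M v w).
Proof.
  unfold D2, move, cMem, cEq, cNor, cAll, cCls, cClos.
  repeat first [apply (D_rel3 M ok (fun _ t f a => val M t f a)); [apply D3_val | | |] | dstep].
Qed.
End GameDefinability.

(** * The classes evaluated before time γ·ω *)

(** The power set in the ambient universe, presented by all predicates on the indices of N. It
    bounds X', for which no membership in M is claimed. *)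
Definition vpow (N : V) : V :=
  sup (idx N -> Prop) (fun P => sup {i : idx N | P i} (fun k => el N (proj1_sig k))).

Lemma mem_pow A N : A ∈ vpow N <-> A ⊆ N.
Proof.
  split.
  - intros [P HP] z Hz; rewrite HP in Hz; destruct Hz as [[i Hi] Hz]; exists i; exact Hz.
  - intros H; exists (fun i => el N i ∈ A); apply veq_ext; intros z; split.
    + intros Hz; destruct (H z Hz) as [i Hi].
      assert (Ai : el N i ∈ A) by (rewrite <- Hi; auto).
      exists (exist _ i Ai); exact Hi.
    + intros [[i Hi] Hz]; simpl in Hz; rewrite Hz; exact Hi.
Qed.

Section Classes.
Context (N g : V) (HN : nice N) (Og : ordinal g) (Hw : omega ⊆ g).
Let G := omul g omega.

Let OG : ordinal G.
Proof. apply ordinal_omul; auto. Qed.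

Let G_succ n xi : xi ∈ G -> osucc n xi ∈ G.
Proof. intros H; induction n; simpl; auto; apply omul_omega_succ_closed; auto. Qed.

Let G_ord xi : xi ∈ G -> ordinal xi.
Proof. apply ordinal_mem; exact OG. Qed.

Let G_max x y : x ∈ G -> y ∈ G -> exists z, z ∈ G /\ x ⊆ z /\ y ⊆ z.
Proof.
  intros Hx Hy; destruct (ordinal_incl_total x y (G_ord _ Hx) (G_ord _ Hy)) as [H | H].
  - exists y; repeat split; auto; intros z; auto.
  - exists x; repeat split; auto; [intros z; auto|]; exact (proj1 (G_ord _ Hx) y H).
Qed.

Let G_empty : vempty ∈ G.
Proof.
  apply empty_mem_omul_omega; auto.
Qed.

(** w is the code by which positions call A, and ξ is one clock from which all answers about
    elements of N are correct. *)
Definition class_code (A w xi : V) : Prop :=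
  w ∈ N /\ xi ∈ G /\ forall x, x ∈ N -> halt N G (kpair w x) (x ∈ A) xi.

Definition classes : V := vsep (vpow N) (fun A => exists w xi, class_code A w xi).

Lemma mem_classes A : A ∈ classes <-> A ⊆ N /\ exists w xi, class_code A w xi.
Proof.
  unfold classes; rewrite mem_sep, mem_pow; [reflexivity|].
  intros a b Hab (w & xi & H1 & H2 & H3); exists w, xi; split; auto; split; auto.
  intros x Hx; eapply halt_iff; [reflexivity | | intros z; exact id | exact (H3 x Hx)].
  rewrite Hab; reflexivity.
Qed.

(** Q builds a code that can be inserted at any level and with any terms for the free variables; the
    single clock ξ serves all of these uses. *)
Definition computable {X : Set} (P : (X -> V) -> Prop) : Prop :=
  exists (Q : nat -> (X -> V) -> V) xi, xi ∈ G /\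
    (forall n nu, (forall i, nu i ∈ N) -> Q n nu ∈ N) /\
    forall n f nu e, f ∈ N -> fresh n f -> (forall i, e i ∈ N) ->
      (forall i, tval n f (nu i) (e i)) -> halt N G (kpair (Q n nu) f) (P e) xi.

Lemma all_cls_impl {C X : Set} (P Q : C -> Prop) (p : fml C X) :
  (forall c, P c -> Q c) -> all_cls P p -> all_cls Q p.
Proof. intros H; induction p; simpl; firstorder. Qed.

Lemma all_cls_intro {C X : Set} (P : C -> Prop) (p : fml C X) : (forall c, P c) -> all_cls P p.
Proof. intros H; induction p; simpl; auto. Qed.

(** C may be infinite and the clocks of its classes cofinal in G, but a formula mentions only
    finitely many class variables. For this reason [all_cls] looks at occurring variables only. *)
Lemma all_cls_bound {C X : Set} (T : C -> V) (p : fml C X) : (forall c, T c ∈ G) ->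
  exists xi, xi ∈ G /\ all_cls (fun c => T c ⊆ xi) p.
Proof.
  intros HT; induction p as [X i j | X i j | X i c | X | X q IHq r IHr | X q IHq]; simpl; eauto.
  - exists (T c); split; auto; intros z; auto.
  - destruct IHq as [x [Hx Hq]], IHr as [y [Hy Hr]].
    destruct (G_max x y Hx Hy) as [z [Hz [Hxz Hyz]]]; exists z; split; auto; split.
    + eapply all_cls_impl; [|exact Hq]; intros c Hc u Hu; auto.
    + eapply all_cls_impl; [|exact Hr]; intros c Hc u Hu; auto.
Qed.

Lemma call_halts n f t u a c B xi : f ∈ N -> a ∈ N -> c ∈ N -> tval n f t a ->
  tval n f u c -> ordinal xi -> halt N G (kpair c a) B xi ->
  halt N G (kpair (cNeg (cCls t u)) f) B (osucc 2 xi).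
Proof.
  intros Hf Ha Hc Ht Hu Ox H; apply (halt_cls N G HN OG t u f a c B xi); auto.
  - eapply tval_in; eauto.
  - eapply tval_in; eauto.
  - eapply tval_val; eauto.
  - eapply tval_val; eauto.
Qed.

Lemma fml_computable {C X : Set} (cl : C -> V) (p : fml C X) :
  (forall c, cl c ∈ classes) -> computable (fun e => sat N cl e p).
Proof.
  intros Hcl.
  assert (HW : forall c, exists wx, class_code (cl c) (fst wx) (snd wx)).
  { intros c; destruct (proj1 (mem_classes _) (Hcl c)) as [_ [w [xi H]]]; exists (w, xi); auto. }
  (* Choice in the metatheory fixes a code and a clock for every class variable. *)
  set (W := fun c => proj1_sig (constructive_indefinite_description _ (HW c))).
  assert (HW' : forall c, class_code (cl c) (fst (W c)) (snd (W c)))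
    by (intros c; exact (proj2_sig (constructive_indefinite_description _ (HW c)))).
  destruct (all_cls_bound (fun c => snd (W c)) p) as [xi [Hxi Hall]]; [intros c; apply HW'|].
  set (atom := fun (n : nat) c t => cNeg (cCls t (tConst (fst (W c))))).
  assert (Hat : forall n c t, t ∈ N -> atom n c t ∈ N).
  { intros n c t Ht; destruct (HW' c) as [Hc _]; unfold atom, cNeg, tConst; niceness. }
  exists (fun n nu => code atom n p nu), (osucc (depth p) (osucc 2 xi)).
  split; [apply G_succ, G_succ; auto|]; split.
  - intros n nu Hnu; apply code_in; auto.
  - intros n f nu e Hf Hfr He Hnu.
    apply (code_halts N G HN OG atom cl n f (osucc 2 xi) p); auto.
    eapply all_cls_impl; [|exact Hall]; intros c Hc n' f' t a Hn Hf' Ha He' Hfr' Ht.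
    destruct (HW' c) as [Hc1 [_ Hc2]].
    apply (call_halts n' f' t (tConst (fst (W c))) a (fst (W c))); auto; [left; reflexivity|].
    eapply halt_iff; [reflexivity | reflexivity | exact Hc | apply Hc2; auto].
Qed.

Definition ok_class (A : unit -> V) : Prop := A tt ∈ classes.

Lemma D_computable {X : Set} (P : (X -> V) -> Prop) :
  D N ok_class (fun _ => P) -> computable P.
Proof.
  intros [C [cl [p [Hc Hp]]]].
  destruct (fml_computable (fun c => cl c tt) p Hc) as [Q [xi [H1 [H2 H3]]]].
  exists Q, xi; split; auto; split; auto; intros n f nu e Hf Hfr He Hnu.
  eapply halt_iff; [reflexivity | exact (Hp tt e He) | intros z; exact id | auto].
Qed.

Lemma class_intro q A xi : A ⊆ N -> q ∈ N -> xi ∈ G ->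
  (forall x, x ∈ N ->
     halt N G (kpair q (ins (vnat 1) (cClos (cNeg q)) (ins (vnat 0) x vempty))) (x ∈ A) xi) ->
  A ∈ classes.
Proof.
  intros HA Hq Hxi H; rewrite mem_classes; split; auto.
  exists (cClos (cNeg q)), (osucc 2 xi); split; [unfold cNeg; niceness|]; split; [auto|].
  intros x Hx; apply halt_clos; auto.
Qed.

Lemma computable_comprehension (P : (option nat -> V) -> Prop) (e : nat -> V) :
  (forall a b, a ≈ b -> P (ext a e) -> P (ext b e)) ->
  (forall i, e i ∈ N) -> computable P ->
  exists A, A ∈ classes /\ forall x, x ∈ N -> (x ∈ A <-> P (ext x e)).
Proof.
  intros HP He [Q [xi [H1 [H2 H3]]]].
  set (nu := ext (tVar 0) (fun i => tConst (e i))).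
  assert (Hnu : forall i, nu i ∈ N).
  { intros [i|]; simpl; unfold tVar, tConst; specialize (He); niceness; auto. }
  assert (HA : forall x, x ∈ vsep N (fun x => P (ext x e)) <-> x ∈ N /\ P (ext x e))
    by (intros x; apply mem_sep; exact HP).
  exists (vsep N (fun x => P (ext x e))); split.
  (* Level 2, because variables 0 and 1 hold the argument and the code of the class itself. *)
  - apply (class_intro (Q 2 nu) _ xi); auto; [intros x Hx; apply (sep_sub _ _ _ Hx)|].
    intros x Hx; eapply halt_iff; [reflexivity | | intros z; exact id | apply (H3 2 _ nu (ext x e))].
    + rewrite HA; tauto.
    + assert (Q 2 nu ∈ N) by auto; unfold cNeg; niceness.
    + apply fresh_ins, fresh_ins, fresh_empty.
    + intros [i|]; simpl; auto.
    + intros [i|]; unfold nu; cbn [ext]; [left; reflexivity|].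
      apply (tval_le 1); auto; apply tval_ins; auto; apply tval_var, fresh_empty.
  - intros x Hx; rewrite HA; tauto.
Qed.

Lemma classes_comprehension (C : Set) (p : fml C (option nat)) (cl : C -> V) (e : nat -> V) :
  (forall c, cl c ∈ classes) -> (forall i, e i ∈ N) ->
  exists A, A ∈ classes /\ forall x, x ∈ N -> (x ∈ A <-> sat N cl (ext x e) p).
Proof.
  intros Hcl He; apply (computable_comprehension (fun e => sat N cl e p)); auto.
  - intros a b Hab; apply sat_veq; [reflexivity|].
    intros [i|]; simpl; [reflexivity | symmetry; auto].
  - apply fml_computable; auto.
Qed.

(** * Recursion of length γ *)

Section Recursion.
Context (phi : fml etr_var unit) (A R rho : V).
Context (HA : A ∈ classes) (HR : R ∈ classes).
Context (Hfun : functional rho).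
Context (Hrank : forall r, dom R r -> exists u, kpair r u ∈ rho /\
    forall d, d ∈ u <->
      exists r' v, rel R r' r /\ kpair r' v ∈ rho /\ (d ∈ v \/ d ≈ v)).
Context (Hle : forall r u, dom R r -> kpair r u ∈ rho -> u ∈ g).

Let RN x y : rel R x y -> x ∈ N /\ y ∈ N.
Proof.
  intros H; apply kpair_mem_trans; [apply nice_trans; auto|].
  apply (proj1 (proj1 (mem_classes R) HR)); exact H.
Qed.

Let rank_rel r' r u' u : rel R r' r -> kpair r' u' ∈ rho -> kpair r u ∈ rho -> u' ∈ u.
Proof.
  intros H Hu' Hu; destruct (Hrank r) as [v [Hv Hd]]; [exists r'; right; auto|].
  rewrite (Hfun _ _ _ Hu Hv), Hd; exists r', u'; split; auto; split; auto; right; reflexivity.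
Qed.

(** The values of ρ decrease along R and are sets of the ambient universe, so R is well founded
    outright and not just with respect to the classes of X'. *)
Lemma rel_ind (P : V -> Prop) :
  (forall s, (forall s', rel R s' s -> P s') -> P s) -> forall s, P s.
Proof.
  intros H.
  assert (K : forall u s, kpair s u ∈ rho -> P s).
  { intros u; induction u as [u IH] using mem_ind; intros s Hs; apply H; intros s' Hs'.
    destruct (Hrank s') as [u' [Hu' _]]; [exists s; left; auto|].
    apply (IH u'); auto; apply (rank_rel s' s); auto. }
  intros s; apply H; intros s' Hs'.
  destruct (Hrank s') as [u' [Hu' _]]; [exists s; left; auto|]; eauto.
Qed.

Lemma lt_rel_dom r' r : lt_rel R r' r -> dom R r' /\ dom R r.
Proof. induction 1 as [x y H | x y z _ IH1 _ IH2]; [|tauto].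
  split; [exists y; left | exists x; right]; exact H.
Qed.

Lemma lt_rel_veq r' r s : r ≈ s -> lt_rel R r' r -> lt_rel R r' s.
Proof.
  intros H K; revert s H; induction K as [x y H | x y z H1 _ _ IH2]; intros s Hs.
  - apply t_step; rewrite <- Hs; exact H.
  - eapply t_trans; [exact H1 | apply IH2; auto].
Qed.

Lemma lt_rel_rank r' r u' u : lt_rel R r' r -> kpair r' u' ∈ rho -> kpair r u ∈ rho -> u' ∈ u.
Proof.
  intros H; revert u' u; induction H as [x y H | x y z H1 IH1 H2 IH2]; intros u' u Hu' Hu.
  - eapply rank_rel; eauto.
  - destruct (Hrank y) as [v [Hv _]]; [apply (lt_rel_dom x y); auto|].
    assert (Ou : ordinal u).
    { apply (ordinal_mem g); auto; apply (Hle z); auto; apply (lt_rel_dom y z); auto. }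
    exact (proj1 Ou v (IH2 v u Hv Hu) u' (IH1 u' v Hu' Hv)).
Qed.

(** Since R is well founded, a set in which every element other than r' has a predecessor
    contains, below each of its elements, a path down to r'. *)
Lemma lt_rel_chain r' r : r' ∈ N -> r ∈ N ->
  lt_rel R r' r <-> exists c, c ∈ N /\ (exists s, s ∈ N /\ s ∈ c /\ kpair s r ∈ R) /\
    forall s, s ∈ N -> s ∈ c -> s ≈ r' \/ exists s', s' ∈ N /\ s' ∈ c /\ kpair s' s ∈ R.
Proof.
  intros Hr' Hr; split.
  - intros H; clear Hr' Hr; induction H as [x y H | x y z _ [c1 [Hc1 [[s1 [N1 [S1 T1]]] D1]]]
      _ [c2 [Hc2 [[s2 [N2 [S2 T2]]] D2]]]].
    + destruct (RN _ _ H) as [Hx Hy]; exists (vpair x x); split; [apply nice_pair; auto|]; split.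
      * exists x; split; auto; split; auto; rewrite mem_pair; left; reflexivity.
      * intros s _ Hs; rewrite mem_pair in Hs; tauto.
    (* The chains are glued at y: an element of c2 equal to y has the top s1 of c1 as
       predecessor. *)
    + exists (vcup c1 c2); split; [apply nice_cup; auto|]; split.
      * exists s2; rewrite mem_cup; auto.
      * intros s Ns Hs; rewrite mem_cup in Hs; destruct Hs as [Hs | Hs].
        -- destruct (D1 s Ns Hs) as [K | [s' [K1 [K2 K3]]]]; auto.
           right; exists s'; rewrite mem_cup; auto.
        -- right; destruct (D2 s Ns Hs) as [K | [s' [K1 [K2 K3]]]].
           ++ exists s1; rewrite mem_cup, K; auto.
           ++ exists s'; rewrite mem_cup; auto.
  - intros (c & Hc & (s & Ns & Hs & Hsr) & H).
    assert (K : forall s, s ∈ N -> s ∈ c -> r' ≈ s \/ lt_rel R r' s).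
    { intros t; induction t as [t IH] using rel_ind; intros Nt Ht.
      destruct (H t Nt Ht) as [K | [t' [K1 [K2 K3]]]]; [left; symmetry; auto|]; right.
      destruct (IH t' K3 K1 K2) as [L | L].
      - apply t_step; rewrite L; exact K3.
      - eapply t_trans; [exact L | apply t_step; exact K3]. }
    destruct (K s Ns Hs) as [L | L].
    + apply t_step; rewrite L; exact Hsr.
    + eapply t_trans; [exact L | apply t_step; exact Hsr].
Qed.

(** The test on the argument z of the recursion; from the outermost variable inwards the variables
    are z, r and x. *)
Let guard_dom : computable (X := option (option unit)) (fun e =>
  e (Some (Some tt)) ≈ kpair (e (Some None)) (e None) /\ dom R (e (Some None))).
Proof.
  apply D_computable.
  apply (D_ext _ _ (fun _ e => e (Some (Some tt)) ≈ kpair (e (Some None)) (e None) /\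
    exists y, y ∈ N /\ (kpair (e (Some None)) y ∈ R \/ kpair y (e (Some None)) ∈ R))).
  - intros _ e He; apply and_iff_compat_l; split; intros [y Hy]; exists y; [apply Hy|].
    split; auto; destruct Hy as [Hy | Hy]; apply RN in Hy; tauto.
  - pose (cR := fun _ : unit => R); assert (ok_class cR) by exact HR.
    change R with (cR tt).
    dsolve; apply (D_cls _ ok_class _ cR); auto; dsolve.
Qed.

(** By [lt_rel_chain] the transitive closure of R is first-order over N with parameter R, as the
    finite chains are elements of N. It thus settles within one fixed clock, as a guard must. *)
Let guard_lt : computable (X := option unit) (fun e =>
  exists r' x, lt_rel R r' (e None) /\ e (Some tt) ≈ kpair r' x).
Proof.
  apply D_computable.
  apply (D_ext _ _ (fun _ e => exists r', r' ∈ N /\ exists x, x ∈ N /\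
    e (Some tt) ≈ kpair r' x /\
    exists c, c ∈ N /\ (exists s, s ∈ N /\ s ∈ c /\ kpair s (e None) ∈ R) /\
    forall s, s ∈ N -> s ∈ c -> s ≈ r' \/ exists s', s' ∈ N /\ s' ∈ c /\ kpair s' s ∈ R)).
  - intros _ e He; split.
    + intros (r' & Hr' & x & Hx & Hp & H); exists r', x; split; auto.
      apply lt_rel_chain; auto.
    + intros (r' & x & H & Hp).
      assert (Hk : kpair r' x ∈ N) by (rewrite <- Hp; auto).
      apply kpair_mem_trans in Hk; [|apply nice_trans; auto]; destruct Hk as [Hr' Hx].
      exists r'; split; auto; exists x; split; auto; split; auto; apply lt_rel_chain; auto.
  - pose (cR := fun _ : unit => R); assert (ok_class cR) by exact HR.
    change R with (cR tt).
    dsolve; apply (D_cls _ ok_class _ cR); auto; dsolve.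
Qed.

(** The code [wS] describes its own class: the body says that z is a pair (r, x) with r in dom R and
    φ holding of x, where Y is replaced by calls to [wS] guarded by the first coordinate lying below
    r. S is read off at the clock L, and induction on ranks shows that all answers have settled by
    then. *)
Lemma etr_solution : exists S, S ∈ classes /\
  (forall p, p ∈ S -> exists r x, dom R r /\ x ∈ N /\ p ≈ kpair r x) /\
  (forall r, dom R r -> forall x, x ∈ N ->
    (kpair r x ∈ S <-> sat N (etr_cl (restr R S r) A) (fun _ => x) phi)).
Proof.
  destruct guard_dom as [QG [x1 [Hx1 [QGin QGh]]]].
  destruct guard_lt as [QL [x2 [Hx2 [QLin QLh]]]].
  destruct (proj1 (mem_classes A) HA) as [HAN [wA [x3 [HwA [Hx3 HAh]]]]].
  destruct (G_max x1 x2 Hx1 Hx2) as [x4 [Hx4 [H14 H24]]].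
  (* From l on both guards and the parameter A have settled; only the self-calls remain to be
     timed. *)
  destruct (G_max x3 x4 Hx3 Hx4) as [l [Hl [H3l H4l]]].
  assert (H1l : x1 ⊆ l) by (intros z; auto); assert (H2l : x2 ⊆ l) by (intros z; auto).
  clear x4 Hx4 H14 H24 H4l.
  (* Variables 0 to 3 will hold z, [wS], r and x, so φ is coded from level 4. *)
  set (atom := fun (n : nat) c t => match c with
    | varA => cNeg (cCls t (tConst wA))
    | varY => cAnd (QL n (fun o => match o with None => tVar 2 | Some _ => t end))
                (cNeg (cCls t (tVar 1))) end).
  assert (TV : forall n, tVar n ∈ N) by (intros; unfold tVar; niceness).
  assert (Hat : forall n c t, t ∈ N -> atom n c t ∈ N).
  { intros n [|] t Ht; unfold atom, cAnd, cNeg, tConst; niceness; auto;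
      apply QLin; intros [[]|]; auto. }
  set (nu3 := fun o : option (option unit) => match o with
    | None => tVar 3 | Some None => tVar 2 | Some (Some _) => tVar 0 end).
  set (qphi := code atom 4 phi (fun _ => tVar 3)).
  assert (Hqphi : qphi ∈ N) by (apply code_in; auto).
  assert (HqG : QG 4 nu3 ∈ N) by (apply QGin; intros [[[]|]|]; simpl; auto).
  set (qS := cEx (vnat 2) (cEx (vnat 3) (cAnd (QG 4 nu3) qphi))).
  assert (Hq1 : cAnd (QG 4 nu3) qphi ∈ N) by (unfold cAnd, cNeg; niceness).
  assert (Hq2 : cEx (vnat 3) (cAnd (QG 4 nu3) qphi) ∈ N) by (unfold cEx, cNeg; niceness).
  assert (HqS : qS ∈ N) by (unfold qS, cEx at 1, cNeg; niceness).
  set (wS := cClos (cNeg qS)).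
  assert (HwS : wS ∈ N) by (unfold wS, cNeg; niceness).
  set (B := fun S r x => sat N (etr_cl (restr R S r) A) (fun _ => x) phi).
  (* The cost of one pass through the body: 4 for a guarded call, [depth phi] for φ, 2 for the
     conjunction with the test on z, 2 for each of the two ∃, and 2 for the closure. *)
  set (K := 12 + depth phi).
  (* One pass, with S still arbitrary: if the calls below r have settled by ξ as S prescribes, the
     call at z settles to the right-hand side of the recursion K ticks later. *)
  assert (Hstep : forall S z xi, S ⊆ N -> z ∈ N -> ordinal xi -> l ⊆ xi ->
    (forall r x r' x', z ≈ kpair r x -> dom R r -> lt_rel R r' r -> x' ∈ N ->
      halt N G (kpair wS (kpair r' x')) (kpair r' x' ∈ S) xi) ->
    halt N G (kpair wS z)
      (exists r, r ∈ N /\ exists x, x ∈ N /\ (z ≈ kpair r x /\ dom R r) /\ B S r x)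
      (osucc K xi)).
  { intros S z xi HS Hz Ox Hlx Hlow.
    assert (Os : forall n, ordinal (osucc n xi)) by (intros; apply ordinal_osucc; auto).
    apply (halt_clos N G HN OG qS z _ (osucc (10 + depth phi) xi)); auto.
    fold wS; set (f1 := ins (vnat 1) wS (ins (vnat 0) z vempty)).
    assert (Hf1 : f1 ∈ N) by (unfold f1; niceness).
    assert (F1 : fresh 2 f1) by (apply fresh_ins, fresh_ins, fresh_empty).
    assert (T0 : tval 2 f1 (tVar 0) z).
    { apply (tval_le 1); auto; apply tval_ins; auto; apply tval_var, fresh_empty. }
    assert (T1 : tval 2 f1 (tVar 1) wS) by (apply tval_var, fresh_ins, fresh_empty).
    apply (halt_ex N G HN OG (vnat 2) _ f1 _ (osucc (8 + depth phi) xi)); auto; [niceness|].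
    intros r Hr; set (f2 := ins (vnat 2) r f1).
    assert (Hf2 : f2 ∈ N) by (unfold f2; niceness).
    assert (F2 : fresh 3 f2) by (apply fresh_ins; auto).
    assert (T2 : tval 3 f2 (tVar 2) r) by (apply tval_var; auto).
    apply (tval_ins 2 2 _ _ _ r (le_n 2)) in T0, T1; fold f2 in T0, T1.
    apply (halt_ex N G HN OG (vnat 3) _ f2 _ (osucc (6 + depth phi) xi)); auto; [niceness|].
    intros x Hx; set (f3 := ins (vnat 3) x f2).
    assert (Hf3 : f3 ∈ N) by (unfold f3; niceness).
    assert (F3 : fresh 4 f3) by (apply fresh_ins; auto).
    assert (T3 : tval 4 f3 (tVar 3) x) by (apply tval_var; auto).
    apply (tval_ins 2 3 _ _ _ x (le_S _ _ (le_n 2))) in T0, T1.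
    apply (tval_ins 3 3 _ _ _ x (le_n 3)) in T2; fold f3 in T0, T1, T2.
    apply (tval_le 2 4) in T0, T1; [|lia|lia]; apply (tval_le 3 4) in T2; [|lia].
    apply (halt_and N G HN OG _ _ f3 _ _ (osucc (4 + depth phi) xi)); auto.
    - eapply halt_iff; [reflexivity | | |
        apply (QGh 4 f3 nu3 (fun o => match o with
          None => x | Some None => r | Some (Some _) => z end)); auto].
      + reflexivity.
      + intros u Hu; apply osucc_incl; auto.
      + intros [[[]|]|]; auto.
      + intros [[[]|]|]; simpl; auto.
    (* φ has to settle only when z = (r, x) and r is in dom R, which is exactly when the hypothesis
       on calls applies. *)
    - intros [Hzrx Hdom].
      eapply halt_iff; [reflexivity | reflexivity | |
        apply (code_halts N G HN OG atom (etr_cl (restr R S r) A) 4 f3 (osucc 4 xi) phi)]; auto.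
      + rewrite osucc_add; apply osucc_mono_n; lia.
      + assert (AH : forall c, atom_halts N G atom (etr_cl (restr R S r) A) 4 f3 (osucc 4 xi) c).
        2:{ apply all_cls_intro; exact AH. }
        intros [|] n f t a Hn Hf Ha Hext Hfr Ht.
        * assert (E1 := tval_le 4 n f _ _ Hn (Hext _ _ T1)).
          assert (E2 := tval_le 4 n f _ _ Hn (Hext _ _ T2)).
          assert (Ht' : t ∈ N) by (eapply tval_in; eauto).
          eapply halt_iff; [reflexivity | | intros u; exact id |
            apply (halt_and N G HN OG _ _ f
              (exists r' x', lt_rel R r' r /\ a ≈ kpair r' x') (a ∈ S) (osucc 2 xi)); auto].
          -- cbn [etr_cl]; unfold restr; rewrite mem_sep; [tauto|].
             intros u v Huv (r' & x' & H1 & H2); exists r', x'; rewrite <- Huv; auto.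
          -- apply QLin; intros [[]|]; auto.
          -- unfold cNeg; niceness; auto.
          -- eapply halt_iff; [reflexivity | reflexivity | |
               apply (QLh n f _ (fun o => match o with None => r | Some _ => a end)); auto].
             ++ intros u Hu; apply osucc_incl; auto.
             ++ intros [[]|]; auto.
             ++ intros [[]|]; auto.
          -- intros (r' & x' & Hlt & Hax).
             apply (call_halts n f t (tVar 1) a wS); auto.
             assert (Hk : kpair r' x' ∈ N) by (rewrite <- Hax; auto).
             apply kpair_mem_trans in Hk; [|apply nice_trans; auto].
             eapply halt_iff; [| | intros u; exact id | apply (Hlow r x r' x'); tauto].
             ++ rewrite Hax; reflexivity.
             ++ rewrite Hax; reflexivity.
        * eapply halt_iff; [reflexivity | reflexivity | |
            apply (call_halts n f t (tConst wA) a wA _ xi); auto; [left; reflexivity|]].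
          -- apply (osucc_mono_n 2 4); lia.
          -- eapply halt_iff; [reflexivity | reflexivity | | apply HAh; auto].
             intros u Hu; auto. }
  (* L bounds all times l + ξ + k with ξ < γ and k finite, and is still below γ·ω. *)
  set (L := oadd l (oadd g omega)).
  assert (HL : L ∈ G) by (apply omul_omega_closed; auto).
  assert (OL := G_ord _ HL).
  assert (Ol := G_ord _ Hl).
  assert (HlL : forall k xi, xi ∈ g -> oadd l (osucc k xi) ⊆ L).
  { intros k xi Hxi; apply oadd_incl_r; intros z Hz.
    apply (osucc_mono k xi g) in Hz; auto; [| exact (ordinal_mem _ _ Og Hxi) | exact (proj1 Og xi Hxi)].
    rewrite <- (oadd_empty g) in Hz; rewrite <- oadd_osucc, osucc_empty in Hz.
    revert z Hz; apply oadd_incl_r; intros z Hz.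
    exact (nat_incl_omega k z Hz). }
  set (S := vsep N (fun z => win N L (kpair wS z))).
  assert (HS : forall z, z ∈ S <-> z ∈ N /\ win N L (kpair wS z)).
  { intros z; apply (mem_sep z N (fun z => win N L (kpair wS z))); intros a b Hab; rewrite Hab; auto. }
  assert (HSN : S ⊆ N) by (intros z Hz; apply HS; auto).
  (* The number k depends on ξ alone, not on r or x: a successor step adds K to it, and at a limit
     it starts again from K. *)
  assert (Htime : forall xi, xi ∈ g -> exists k, forall r u x, dom R r -> kpair r u ∈ rho ->
    u ⊆ xi -> x ∈ N -> halt N G (kpair wS (kpair r x)) (B S r x) (oadd l (osucc k xi))).
  { assert (Hpred : forall T : V, ordinal T -> l ⊆ T -> forall r x, dom R r -> x ∈ N ->
      (forall r' x', lt_rel R r' r -> x' ∈ N ->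
        halt N G (kpair wS (kpair r' x')) (kpair r' x' ∈ S) T) ->
      halt N G (kpair wS (kpair r x)) (B S r x) (osucc K T)).
    { intros T OT HlT r x Hr Hx Hlow.
      assert (Nr : r ∈ N) by (destruct Hr as [y [Hy | Hy]]; apply RN in Hy; tauto).
      eapply halt_iff; [reflexivity | | intros z; exact id |
        apply (Hstep S (kpair r x) T); auto; [niceness|]].
      - split.
        + intros (r1 & _ & y & _ & [Hp _] & HB); apply kpair_inj in Hp; destruct Hp as [P1 P2].
          unfold B in *; eapply sat_veq; [| |exact HB]; [|intros i; exact P2].
          intros [|]; cbn [etr_cl]; [|reflexivity].
          unfold restr; apply veq_ext; intros z; rewrite !mem_sep; [| |].
          * apply and_iff_compat_l; split; intros (r' & x' & H1 & H2); exists r', x'; split; auto.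
            -- apply (lt_rel_veq r' r r1); auto.
            -- apply (lt_rel_veq r' r1 r); auto; symmetry; auto.
          * intros a b Hab (r' & x' & H1 & H2); exists r', x'; rewrite <- Hab; auto.
          * intros a b Hab (r' & x' & H1 & H2); exists r', x'; rewrite <- Hab; auto.
        + intros HB; exists r; split; auto; exists x; split; auto; split; auto.
          split; auto; reflexivity.
      - intros r1 y r' x' Hp _ Hlt Hx'; apply kpair_inj in Hp; destruct Hp as [P1 _].
        apply Hlow; auto; apply (lt_rel_veq r' r1 r); auto; symmetry; auto. }
    (* A value that settles before L is the one S records at L, so the right-hand side may be traded
       for membership in S. *)
    assert (Hself : forall k xi r x, xi ∈ g -> r ∈ N -> x ∈ N ->
      halt N G (kpair wS (kpair r x)) (B S r x) (oadd l (osucc k xi)) ->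
      halt N G (kpair wS (kpair r x)) (kpair r x ∈ S) (oadd l (osucc k xi))).
    { intros k xi r x Hxi Hr Hx H; eapply halt_iff; [reflexivity | | intros z; exact id | exact H].
      rewrite HS, (H L HL (HlL k xi Hxi)); split; [|tauto]; split; auto; niceness. }
    intros xi; induction xi as [xi IH] using mem_ind; intros Hxi.
    assert (Oxi := ordinal_mem _ _ Og Hxi).
    assert (Hin : forall eta, eta ∈ xi -> eta ∈ g) by exact (proj1 Og xi Hxi).
    destruct (classic (exists eta, eta ∈ xi /\ xi ≈ vsucc eta)) as [[eta [He Hs]] | Hns].
    - destruct (IH eta He (Hin _ He)) as [k Hk]; exists (K + k); intros r u x Hr Hu Hux Hx.
      eapply halt_iff; [reflexivity | reflexivity | |
        apply (Hpred (oadd l (osucc k eta))); auto].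
      + rewrite <- oadd_osucc, osucc_add; apply oadd_incl_r.
        apply osucc_mono; [exact (ordinal_mem _ _ Oxi He) | auto |].
        rewrite Hs; apply incl_succ.
      + apply ordinal_oadd; auto; apply ordinal_osucc; exact (ordinal_mem _ _ Oxi He).
      + apply oadd_incl_l.
      + intros r' x' Hlt Hx'; destruct (lt_rel_dom _ _ Hlt) as [Hd _].
        assert (Nr : r' ∈ N) by (destruct Hd as [y [Hy | Hy]]; apply RN in Hy; tauto).
        destruct (Hrank r' Hd) as [u' [Hu' _]].
        apply Hself; auto; apply (Hk r' u'); auto.
        assert (Hu1 : u' ∈ xi) by (apply Hux, (lt_rel_rank r' r); auto).
        rewrite Hs, mem_succ in Hu1; destruct Hu1 as [Hu1 | ->]; [|intros z; auto].
        exact (proj1 (ordinal_mem _ _ Oxi He) u' Hu1).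
    (* ξ is zero or a limit, so l + η + k < l + ξ for all η < ξ and finite k: every predecessor has
       settled by l + ξ, whatever its own k. *)
    - exists K; intros r u x Hr Hu Hux Hx.
      eapply halt_iff; [reflexivity | reflexivity | | apply (Hpred (oadd l xi)); auto].
      + rewrite <- oadd_osucc; intros z; auto.
      + apply ordinal_oadd; auto.
      + apply oadd_incl_l.
      + intros r' x' Hlt Hx'; destruct (lt_rel_dom _ _ Hlt) as [Hd _].
        assert (Nr : r' ∈ N) by (destruct Hd as [y [Hy | Hy]]; apply RN in Hy; tauto).
        destruct (Hrank r' Hd) as [u' [Hu' _]].
        assert (Hu1 : u' ∈ xi) by (apply Hux, (lt_rel_rank r' r); auto).
        destruct (IH u' Hu1 (Hin _ Hu1)) as [k Hk].
        eapply halt_iff; [reflexivity | reflexivity | |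
          apply (Hself k u'); auto; apply (Hk r' u'); auto; intros z; auto].
        apply (proj1 (ordinal_oadd l xi Ol Oxi)), oadd_mem_r.
        apply nonsucc_osucc; auto; intros y Hy Hxy; apply Hns; eauto. }
  assert (Hdom : forall r x, dom R r -> x ∈ N ->
    halt N G (kpair wS (kpair r x)) (B S r x) L).
  { intros r x Hr Hx; destruct (Hrank r Hr) as [u [Hu _]].
    destruct (Htime u (Hle r u Hr Hu)) as [k Hk].
    eapply halt_iff; [reflexivity | reflexivity | apply (HlL k u), (Hle r); auto |].
    apply (Hk r u); auto; intros z; auto. }
  assert (Hsol : forall r, dom R r -> forall x, x ∈ N -> (kpair r x ∈ S <-> B S r x)).
  { intros r Hr x Hx.
    assert (Nr : r ∈ N) by (destruct Hr as [y [Hy | Hy]]; apply RN in Hy; tauto).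
    rewrite HS, (Hdom r x Hr Hx L HL (fun z => id)).
    split; [tauto|]; split; auto; niceness. }
  (* A code of a class must settle on all of N. Where z is no pair over dom R the test on z fails,
     and one pass from l suffices. *)
  assert (Hnot : forall z, z ∈ N -> ~ (exists r x, z ≈ kpair r x /\ dom R r) ->
    halt N G (kpair wS z) False L).
  { intros z Hz Hno; eapply halt_iff; [reflexivity | | | apply (Hstep S z l); auto].
    - split; [|tauto]; intros (r & _ & x & _ & H & _); apply Hno; eauto.
    - rewrite <- (oadd_empty l) at 1; rewrite <- oadd_osucc.
      apply (HlL K); apply Hw; exists 0; reflexivity.
    - intros z'; auto.
    - intros r x r' x' Hp Hr; elim Hno; eauto. }
  exists S; split; [|split].
  - rewrite mem_classes; split; auto; exists wS, L; split; auto; split; auto.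
    intros z Hz; destruct (classic (exists r x, z ≈ kpair r x /\ dom R r)) as [(r & x & Hp & Hr) | Hno].
    + assert (Hk : kpair r x ∈ N) by (rewrite <- Hp; auto).
      apply kpair_mem_trans in Hk; [|apply nice_trans; auto].
      eapply halt_iff; [| | intros u; exact id | apply (Hdom r x); tauto].
      * rewrite Hp; reflexivity.
      * rewrite Hp, Hsol; tauto.
    + eapply halt_iff; [reflexivity | | intros u; exact id | apply Hnot; auto].
      rewrite HS, (Hnot z Hz Hno L HL (fun z => id)); tauto.
  - intros z Hz; pose proof (HSN z Hz) as Nz; apply NNPP; intros Hno.
    refine (proj1 (Hnot z Nz _ L HL (fun u => id)) (proj2 (proj1 (HS z) Hz))).
    intros (r & x & Hp & Hr); apply Hno; exists r, x; split; auto; split; auto.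
    rewrite Hp in Nz; apply kpair_mem_trans in Nz; [tauto | apply nice_trans; auto].
  - exact Hsol.
Qed.

End Recursion.

Lemma classes_etr : ETR_ord g N classes.
Proof.
  intros phi A R HA HR _ _ [rho [_ [[Hfun Hrank] Hle]]].
  exact (etr_solution phi A R rho HA HR Hfun Hrank Hle).
Qed.

End Classes.

(** * Set theory inside a transitive model of GB *)

(** y belongs to the transitive closure of {x}, up to bisimulation. *)
Inductive tc : V -> V -> Prop :=
| tc_eq x y : y ≈ x -> tc x y
| tc_in x z y : z ∈ x -> tc z y -> tc x y.

Lemma tc_mem x y z : tc x y -> z ∈ y -> tc x z.
Proof.
  induction 1 as [x y H | x w y H _ IH]; intros Hz.
  - rewrite H in Hz; apply (tc_in x z z Hz), tc_eq; reflexivity.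
  - apply (tc_in x w); auto.
Qed.

(** * Absoluteness of the moves between transitive sets *)

Section Absoluteness.
Context (M N : V) (TN : transitive N) (HNM : N ⊆ M).

Lemma val_abs t f a : t ∈ N -> f ∈ N -> val N t f a <-> val M t f a.
Proof.
  intros Ht Hf; unfold val; split; (intros [H | (n & Hn & E & H)]; [left; exact H|]); right; exists n.
  - split; auto.
  - split; auto; rewrite E in Ht; apply (kpair_mem_trans N _ _ TN Ht).
Qed.

Lemma val_in t f a : t ∈ N -> f ∈ N -> val M t f a -> a ∈ N.
Proof.
  intros Ht Hf [H | (n & _ & _ & H)].
  - rewrite H in Ht; apply (kpair_mem_trans N _ _ TN Ht).
  - apply (kpair_mem_trans N n a TN), (TN f Hf); exact H.
Qed.

Lemma atom_abs (r : V -> V -> Prop) t u f : t ∈ N -> u ∈ N -> f ∈ N ->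
  (exists a, a ∈ N /\ exists b, b ∈ N /\ val N t f a /\ val N u f b /\ r a b) <->
  (exists a, a ∈ M /\ exists b, b ∈ M /\ val M t f a /\ val M u f b /\ r a b).
Proof.
  intros Ht Hu Hf; split; intros (a & Ha & b & Hb & H1 & H2 & H3); exists a.
  - rewrite val_abs in H1, H2 by auto; split; auto; exists b; auto.
  - pose proof (val_in t f a Ht Hf H1); pose proof (val_in u f b Hu Hf H2).
    split; auto; exists b; rewrite !val_abs by auto; auto.
Qed.

(** The parts of v lie in every transitive set containing v, and the instance y chosen at a
    quantifier can be read off the environment in w. So the quantifiers in [move] find their
    witnesses already in N. *)
Lemma move_abs v w : v ∈ N -> w ∈ N -> move N v w <-> move M v w.
Proof.
  intros Hv Hw; unfold move; unfold cMem, cEq, cNor, cAll, cCls, cClos.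
  assert (KP : forall x y z, z ∈ N -> z ≈ kpair x y -> x ∈ N /\ y ∈ N).
  { intros x y z Hz E; rewrite E in Hz; apply (kpair_mem_trans N x y TN Hz). }
  split.
  - intros (q & Hq & f & Hf & E & H); exists q; split; auto; exists f; split; auto; split; auto.
    destruct H as [H | [H | [H | [H | [H | H]]]]].
    + left; destruct H as (t & Ht & u & Hu & E1 & E2 & H); exists t; split; auto; exists u.
      rewrite <- (atom_abs mem) by auto; auto.
    + right; left; destruct H as (t & Ht & u & Hu & E1 & E2 & H); exists t; split; auto; exists u.
      rewrite <- (atom_abs veq) by auto; auto.
    + do 2 right; left; destruct H as (t & Ht & u & Hu & E1 & H); exists t; split; auto; exists u; auto.
    + do 3 right; left; destruct H as (t & Ht & u & Hu & E1 & y & Hy & H).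
      exists t; split; auto; exists u; split; auto; split; auto; exists y; auto.
    + do 4 right; left; destruct H as (t & Ht & u & Hu & E1 & a & Ha & c & Hc & H1 & H2 & H3).
      rewrite val_abs in H1, H2 by auto.
      exists t; split; auto; exists u; split; auto; split; auto; exists a; split; auto; exists c; auto.
    + do 5 right; destruct H as (t & Ht & H); exists t; auto.
  - intros (q & _ & f & _ & E & H); destruct (KP q f v Hv E) as [Hq Hf].
    exists q; split; auto; exists f; split; auto; split; auto.
    destruct H as [H | [H | [H | [H | [H | H]]]]].
    + left; destruct H as (t & _ & u & _ & E1 & E2 & H).
      destruct (KP _ _ q Hq E1) as [_ K]; destruct (KP _ _ _ K (veq_refl _)) as [Ht Hu].
      exists t; split; auto; exists u; rewrite (atom_abs mem) by auto; auto.
    + right; left; destruct H as (t & _ & u & _ & E1 & E2 & H).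
      destruct (KP _ _ q Hq E1) as [_ K]; destruct (KP _ _ _ K (veq_refl _)) as [Ht Hu].
      exists t; split; auto; exists u; rewrite (atom_abs veq) by auto; auto.
    + do 2 right; left; destruct H as (t & _ & u & _ & E1 & H).
      destruct (KP _ _ q Hq E1) as [_ K]; destruct (KP _ _ _ K (veq_refl _)) as [Ht Hu].
      exists t; split; auto; exists u; auto.
    + do 3 right; left; destruct H as (t & _ & u & _ & E1 & y & _ & H).
      destruct (KP _ _ q Hq E1) as [_ K]; destruct (KP _ _ _ K (veq_refl _)) as [Ht Hu].
      exists t; split; auto; exists u; split; auto; split; auto; exists y; split; auto.
      destruct (KP _ _ w Hw H) as [_ Hi].
      apply (kpair_mem_trans N t y TN), (TN _ Hi); rewrite mem_ins; right; reflexivity.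
    + do 4 right; left; destruct H as (t & _ & u & _ & E1 & a & _ & c & _ & H1 & H2 & H3).
      destruct (KP _ _ q Hq E1) as [_ K]; destruct (KP _ _ _ K (veq_refl _)) as [Ht Hu].
      destruct (KP _ _ w Hw H3) as [Hc Ha].
      exists t; split; auto; exists u; split; auto; split; auto; exists a; split; auto; exists c.
      rewrite !val_abs by auto; auto.
    + do 5 right; destruct H as (t & _ & E1 & H).
      destruct (KP _ _ q Hq E1) as [_ Ht]; exists t; auto.
Qed.

End Absoluteness.

(** * Elementary set constructions in M *)

Section Model.
Context (M X : V) (TM : transitive M) (HS : so_structure M X) (HGB : GB M X).
Let HZF : ZF M := gb_zf M X HGB.

Lemma model_nice : nice M.
Proof.
  assert (HP : forall x y, x ∈ M -> y ∈ M -> vpair x y ∈ M).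
  { intros x y Hx Hy; destruct (zf_pairing M HZF x y Hx Hy) as [p [Hp H]].
    assert (E : vpair x y ≈ p); [|rewrite E; exact Hp].
    apply veq_ext; intros z; rewrite mem_pair; split.
    - intros K; apply H; auto; destruct K as [-> | ->]; auto.
    - intros K; apply H; auto; exact (TM p Hp z K). }
  assert (HE : vempty ∈ M).
  { destruct (zf_infinity M HZF) as [w [Hw [[o [Ho [_ H]]] _]]].
    assert (E : vempty ≈ o); [|rewrite E; exact Ho].
    apply veq_ext; intros z; split; intros K; [elim (mem_empty _ K)|].
    elim (H z); auto; exact (TM o Ho z K). }
  split; auto; intros x y Hx Hy.
  destruct (zf_union M HZF (vpair x y) (HP x y Hx Hy)) as [u [Hu H]].
  assert (E : vcup x y ≈ u); [|rewrite E; exact Hu].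
  apply veq_ext; intros z; rewrite mem_cup; split.
  - intros K; apply H; [destruct K as [K | K]; eapply TM; [|exact K| |exact K]; auto|].
    destruct K as [K | K]; [exists x | exists y]; rewrite mem_pair; repeat split; auto;
      [left | right]; reflexivity.
  - intros K; apply H in K; [|exact (TM u Hu z K)].
    destruct K as [t [_ [Ht K]]]; rewrite mem_pair in Ht.
    destruct Ht as [Ht | Ht]; rewrite Ht in K; auto.
Qed.
Let HM := model_nice.

Definition okX (A : unit -> V) : Prop := A tt ∈ X.

Lemma comprehension (P : V -> Prop) : D1 M okX (fun _ => P) ->
  exists A, A ∈ X /\ A ⊆ M /\ forall x, x ∈ M -> (x ∈ A <-> P x).
Proof.
  intros [C [cl [p [Hc Hp]]]].
  destruct (gb_comprehension M X HGB C
    (fmap id (fun o : option Empty_set => match o with None => None | Some x => match x with end end) p)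
    (fun c => cl c tt) (fun _ => vempty)) as [A [HA H]]; auto.
  { intros _; apply (nice_empty M HM). }
  exists A; split; auto; split; [apply HS; auto|].
  intros x Hx; rewrite (H x Hx), sat_fmap.
  apply (Hp tt (fun i => ext x (fun _ : nat => vempty) match i with
    | None => None | Some x => match x with end end)).
  intros [[]|]; auto.
Qed.

Lemma set_class a : a ∈ M -> a ∈ X.
Proof.
  intros Ha.
  destruct (gb_comprehension M X HGB Empty_set (fMem None (Some 0)) (fun c => match c with end)
    (fun _ => a)) as [A [HA H]]; auto; [intros []|].
  assert (E : a ≈ A); [|rewrite E; exact HA].
  apply veq_ext; intros z; split; intros Hz.
  - apply H; auto; exact (TM a Ha z Hz).
  - apply (H z); auto; exact (HS A HA z Hz).
Qed.

Lemma ok_set a : a ∈ M -> okX (fun _ => a).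
Proof. exact (set_class a). Qed.

Ltac dstepM := first
  [ dstep
  | apply DT_const; [exact HM | apply ok_set; assumption | assumption] ].
Ltac dsolveM := repeat dstepM.

Lemma replacement (P : V -> V -> Prop) a : D2 M okX (fun _ => P) -> a ∈ M ->
  (forall x y y', x ∈ a -> y ∈ M -> y' ∈ M -> P x y -> P x y' -> y ≈ y') ->
  exists b, b ∈ M /\ forall y, y ∈ b <-> y ∈ M /\ exists x, x ∈ a /\ P x y.
Proof.
  intros HP Ha Hfun.
  assert (HPv : forall x y x' y', x ∈ M -> y ∈ M -> x ≈ x' -> y ≈ y' -> P x y -> P x' y').
  { intros x y x' y' Hx Hy Exx Eyy.
    apply (D_veq M okX _ tt
      (fun o : option (option Empty_set) => match o with None => y | Some _ => x end)
      (fun o => match o with None => y' | Some _ => x' end) HP).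
    - intros [|]; auto.
    - intros [|]; auto. }
  destruct (comprehension (fun p => exists x, x ∈ M /\ exists y, y ∈ M /\
    p ≈ kpair x y /\ x ∈ a /\ P x y)) as [F [HF [HFM H]]].
  { unfold D1; dsolveM.
    apply (D_rel2 M okX (fun _ => P)); auto; dsolveM. }
  assert (HF' : forall x y, kpair x y ∈ F <-> x ∈ M /\ y ∈ M /\ x ∈ a /\ P x y).
  { intros x y; split.
    - intros K; pose proof (HFM _ K) as Mk; pose proof (kpair_mem_trans M x y TM Mk) as [Hx Hy].
      apply H in K; auto; destruct K as (x' & Hx' & y' & Hy' & E & Ha' & HP').
      apply kpair_inj in E; destruct E as [E1 E2]; repeat split; auto.
      + rewrite E1; auto.
      + apply (HPv x' y'); auto; symmetry; auto.
    - intros (Hx & Hy & Hxa & K); apply H; [apply nice_kpair; auto|].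
      exists x; split; auto; exists y; split; auto; split; auto; reflexivity. }
  destruct (gb_class_replacement M X HGB F a HF) as [b [Hb Hb']]; auto.
  { intros x y y' K K'; rewrite HF' in K, K'; apply (Hfun x); tauto. }
  exists b; split; auto; intros y; split.
  - intros Hy; pose proof (TM b Hb y Hy) as My; split; auto.
    apply Hb' in Hy; auto; destruct Hy as [x [_ [Hx K]]]; exists x; rewrite HF' in K; tauto.
  - intros [My [x [Hx K]]]; apply Hb'; auto; exists x; rewrite HF'.
    pose proof (TM a Ha x Hx); tauto.
Qed.

Lemma separation (P : V -> Prop) a : D1 M okX (fun _ => P) -> a ∈ M ->
  exists b, b ∈ M /\ forall x, x ∈ b <-> x ∈ a /\ P x.
Proof.
  intros HP Ha.
  assert (HPv : forall x y, x ∈ M -> x ≈ y -> P x -> P y).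
  { intros x y Hx E.
    apply (D_veq M okX _ tt (fun _ : option Empty_set => x) (fun _ => y) HP); auto. }
  destruct (replacement (fun x y => x ≈ y /\ P x) a) as [b [Hb H]]; auto.
  - unfold D2; dsolveM; apply (D_rel1 M okX (fun _ => P)); auto; dsolveM.
  - intros x y y' _ _ _ [H _] [H' _]; rewrite <- H; auto.
  - exists b; split; auto; intros x; rewrite H; split.
    + intros [Mx [y [Hy [E Py]]]]; split; [rewrite <- E; auto|].
      apply (HPv y); auto; exact (TM a Ha y Hy).
    + intros [Hx Px]; split; [exact (TM a Ha x Hx)|]; exists x; repeat split; auto; reflexivity.
Qed.

Lemma union x : x ∈ M -> exists u, u ∈ M /\ forall z, z ∈ u <-> exists y, y ∈ x /\ z ∈ y.
Proof.
  intros Hx; destruct (zf_union M HZF x Hx) as [u [Hu H]]; exists u; split; auto.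
  intros z; split.
  - intros Hz; apply H in Hz; [|exact (TM u Hu z Hz)]; destruct Hz as [y [_ Hy]]; eauto.
  - intros [y [Hy Hz]]; pose proof (TM x Hx y Hy) as My.
    apply H; [exact (TM y My z Hz)|]; eauto.
Qed.

Lemma powerset x : x ∈ M -> exists p, p ∈ M /\ forall y, y ∈ p <-> y ∈ M /\ y ⊆ x.
Proof.
  intros Hx; destruct (zf_powerset M HZF x Hx) as [p [Hp H]]; exists p; split; auto.
  intros y; split.
  - intros Hy; pose proof (TM p Hp y Hy) as My; split; auto.
    intros z Hz; apply (H y My); auto; exact (TM y My z Hz).
  - intros [My K]; apply H; auto.
Qed.

Lemma union_replacement (K : V -> V -> Prop) a : D2 M okX (fun _ => K) -> a ∈ M ->
  (forall x y y', x ∈ a -> y ∈ M -> y' ∈ M -> K x y -> K x y' -> y ≈ y') ->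
  exists b, b ∈ M /\ forall u, u ∈ b <-> exists x y, x ∈ a /\ y ∈ M /\ K x y /\ u ∈ y.
Proof.
  intros HK Ha Hfun; destruct (replacement K a HK Ha Hfun) as [c [Hc H]].
  destruct (union c Hc) as [b [Hb H']]; exists b; split; auto; intros u; rewrite H'; split.
  - intros [y [Hy Hu]]; rewrite H in Hy; destruct Hy as [My [x [Hx Hk]]]; exists x, y; auto.
  - intros (x & y & Hx & My & Hk & Hu); exists y; rewrite H; split; auto; split; eauto.
Qed.

Lemma omega_in : omega ∈ M.
Proof.
  destruct (zf_infinity M HZF) as [w [Hw [[o [Ho [How Ho']]] Hs]]].
  assert (Hn : forall n, vnat n ∈ w).
  { induction n as [|n IH].
    - assert (E : vnat 0 ≈ o); [|rewrite E; auto].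
      apply veq_ext; intros z; split; intros K; [elim (mem_empty _ K)|].
      elim (Ho' z); auto; exact (TM o Ho z K).
    - destruct (Hs _ (nice_nat M n HM) IH) as [s [Ms [Hsw H]]].
      assert (E : vnat (S n) ≈ s); [|rewrite E; auto].
      apply veq_ext; intros z; cbn [vnat]; rewrite mem_succ; split; intros K.
      + apply H; auto; destruct K as [K | ->]; [|apply nice_nat; auto].
        exact (TM _ (nice_nat M n HM) z K).
      + apply H; auto; exact (TM s Ms z K). }
  (* Every y in x ∪ {x} is empty or a successor. As ∈ is well founded, this first-order condition
     singles out the true natural numbers. *)
  set (nat_like := fun x => forall y, y ∈ M -> y ∈ x \/ y ≈ x ->
    y ≈ vempty \/ exists z, z ∈ M /\ y ≈ vsucc z).
  destruct (separation nat_like w) as [b [Hb H]]; auto.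
  { unfold D1, nat_like; dsolveM. }
  assert (E : omega ≈ b); [|rewrite E; auto].
  apply veq_ext; intros x; rewrite H; split.
  - intros [n En]; simpl in En; split; [rewrite En; auto|].
    assert (K : nat_like (vnat n)).
    { clear - HM; induction n as [|n IH]; intros y My Hy.
      - left; destruct Hy as [Hy | Hy]; auto; elim (mem_empty _ Hy).
      - cbn [vnat] in Hy; rewrite mem_succ in Hy; destruct Hy as [Hy | Hy]; auto.
        right; exists (vnat n); split; auto; apply nice_nat; auto. }
    intros y My Hy; rewrite En in Hy; apply (K y); auto.
  - intros [Hx Kx]; pose proof (TM w Hw x Hx) as Mx; clear Hx.
    induction x as [x IH] using mem_ind.
    destruct (Kx x Mx) as [K | [z [Mz K]]]; [right; reflexivity| |].
    + exists 0; exact K.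
    + destruct (IH z) as [n Hn']; auto.
      * rewrite K; apply mem_self_succ.
      * intros y My Hy; apply (Kx y My); left; rewrite K, mem_succ; auto.
      * exists (S n); simpl in *; rewrite K, Hn'; reflexivity.
Qed.

(** ** Recursion on ∈ *)

Section SetRecursion.
Context (P : V -> V -> V -> Prop) (HPv : Proper (veq ==> veq ==> veq ==> iff) P).
Context (HPD : D3 M okX (fun _ => P)).
Context (HPset : forall a h, a ∈ M -> h ∈ M ->
  exists y, y ∈ M /\ forall u, u ∈ y <-> u ∈ M /\ P a h u).

(** [P a h u] says that u belongs to the value with history h. The recursion is carried out in the
    ambient universe, where it is structural; the attempts below serve to show that M contains its
    values and defines them. *)
Fixpoint recF (a x : V) {struct x} : V :=
  match x with
  | sup J f => vsep M (P a (sup J (fun i => kpair (f i) (recF a (f i)))))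
  end.

Definition graph (a x : V) : V := sup (idx x) (fun i => kpair (el x i) (recF a (el x i))).

Lemma mem_recF_graph a x u : u ∈ recF a x <-> u ∈ M /\ P a (graph a x) u.
Proof.
  destruct x as [J f]; simpl; rewrite mem_sep; [reflexivity|].
  intros b c E; rewrite E; auto.
Qed.

#[local] Instance recF_proper : Proper (veq ==> veq ==> veq) recF.
Proof.
  intros a a' Ha x; induction x as [J f IH]; intros [J' f'] [H1 H2].
  apply veq_ext; intros u; rewrite !mem_recF_graph.
  assert (E : graph a (sup J f) ≈ graph a' (sup J' f')); [|rewrite E, Ha; reflexivity].
  split.
  - intros i; destruct (H1 i) as [j Hj]; exists j; apply kpair_proper; [exact Hj | exact (IH i _ Hj)].
  - intros j; destruct (H2 j) as [i Hi]; exists i; apply kpair_proper; [exact Hi | exact (IH i _ Hi)].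
Qed.

Lemma mem_graph a x p : p ∈ graph a x <-> exists z, z ∈ x /\ p ≈ kpair z (recF a z).
Proof.
  split.
  - intros [i Hi]; exists (el x i); split; auto; apply el_mem.
  - intros [z [[i Hi] Hp]]; exists i; simpl; rewrite Hp, Hi; reflexivity.
Qed.

(** A partial solution in the sense of M. Its domain is closed under elements, and h is the
    restriction of f to the elements of x, the history at x. *)
Definition attempt (a f : V) : Prop := forall p, p ∈ M -> p ∈ f ->
  exists x, x ∈ M /\ exists y, y ∈ M /\ p ≈ kpair x y /\
  exists h, h ∈ M /\
    (forall q, q ∈ M -> (q ∈ h <->
      q ∈ f /\ exists z, z ∈ M /\ exists u, u ∈ M /\ q ≈ kpair z u /\ z ∈ x)) /\
    (forall z, z ∈ M -> z ∈ x -> exists u, u ∈ M /\ kpair z u ∈ f) /\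
    forall u, u ∈ M -> (u ∈ y <-> P a h u).

Lemma D2_attempt : D2 M okX (fun _ => attempt).
Proof.
  unfold D2, attempt; dsolveM; apply (D_rel3 M okX (fun _ => P)); auto; dsolveM.
Qed.

Ltac dsolve_attempt := repeat first
  [ apply (D_rel2 M okX (fun _ => attempt)); [exact D2_attempt | |] | dstepM ].

Lemma attempt_sound a f x : f ∈ M -> attempt a f ->
  forall y, kpair x y ∈ f -> y ≈ recF a x.
Proof.
  intros Hf H; induction x as [x IH] using mem_ind; intros y Hxy.
  pose proof (TM f Hf _ Hxy) as Mk.
  destruct (H _ Mk Hxy) as (x' & Mx & y' & My & E & h & Mh & Hh & Htot & Hy).
  apply kpair_inj in E; destruct E as [E1 E2].
  assert (Eh : h ≈ graph a x).
  { apply veq_ext; intros q; rewrite mem_graph; split.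
    - intros Hq; apply Hh in Hq; [|exact (TM h Mh q Hq)].
      destruct Hq as [Hqf (z & Mz & u & Mu & Eq & Hz)]; rewrite <- E1 in Hz.
      exists z; split; auto; rewrite Eq in Hqf; rewrite Eq, (IH z Hz u Hqf); reflexivity.
    - intros [z [Hz Eq]]; pose proof Hz as Hz'; rewrite E1 in Hz'.
      pose proof (TM x' Mx z Hz') as Mz; destruct (Htot z Mz Hz') as [u [Mu Hu]].
      rewrite (IH z Hz u Hu) in Hu; rewrite <- Eq in Hu.
      pose proof (TM f Hf q Hu) as Mq; apply Hh; auto; split; auto.
      exists z; split; auto; exists (recF a z).
      rewrite Eq in Mq; pose proof (kpair_mem_trans M _ _ TM Mq) as [_ Mr]; auto. }
  rewrite E2; apply veq_ext; intros u; rewrite mem_recF_graph, <- Eh; split.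
  - intros Hu; pose proof (TM y' My u Hu); split; auto; apply Hy; auto.
  - intros [Mu Pu]; apply Hy; auto.
Qed.

Definition tc_graph (a x f : V) : Prop :=
  forall p, p ∈ f <-> exists y, tc x y /\ p ≈ kpair y (recF a y).

Lemma graph_in a y f : f ∈ M -> y ∈ M ->
  (forall z, z ∈ y -> kpair z (recF a z) ∈ f) ->
  (forall z u, kpair z u ∈ f -> u ≈ recF a z) -> graph a y ∈ M.
Proof.
  intros Hf My H1 H2.
  destruct (separation (fun q => exists z, z ∈ M /\ exists u, u ∈ M /\ q ≈ kpair z u /\ z ∈ y) f)
    as [h [Mh Hh]]; auto.
  { unfold D1; dsolveM. }
  assert (E : graph a y ≈ h); [|rewrite E; auto].
  apply veq_ext; intros q; rewrite mem_graph, Hh; split.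
  - intros [z [Hz Eq]]; pose proof (H1 z Hz) as K; rewrite <- Eq in K; split; auto.
    pose proof (TM f Hf q K) as Mq; rewrite Eq in Mq.
    pose proof (kpair_mem_trans M _ _ TM Mq) as [Mz Mr]; exists z; split; auto; eauto.
  - intros [Hq (z & Mz & u & Mu & Eq & Hz)]; exists z; split; auto.
    rewrite Eq in Hq; rewrite Eq, (H2 z u Hq); reflexivity.
Qed.

Lemma tc_graph_sound a x f z u : tc_graph a x f -> kpair z u ∈ f -> u ≈ recF a z.
Proof.
  intros H K; rewrite (H _) in K; destruct K as [y [_ E]].
  apply kpair_inj in E; destruct E as [E1 E2]; rewrite E2, E1; reflexivity.
Qed.

Lemma tc_graph_attempt a x f : f ∈ M -> tc_graph a x f -> attempt a f.
Proof.
  intros Hf H p Mp Hp; destruct (proj1 (H p) Hp) as [y [Ty Ep]].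
  rewrite Ep in Mp; destruct (kpair_mem_trans M _ _ TM Mp) as [My Mr].
  assert (K : forall z, z ∈ y -> kpair z (recF a z) ∈ f).
  { intros z Hz; apply H; exists z; split; [|reflexivity]; apply (tc_mem x y); auto. }
  exists y; split; auto; exists (recF a y); split; auto; split; auto.
  exists (graph a y); split; [|split; [|split]].
  - apply (graph_in a y f); auto; intros z u; apply (tc_graph_sound a x f); auto.
  - intros q Mq; rewrite mem_graph; split.
    + intros [z [Hz Eq]]; split; [rewrite Eq; auto|].
      rewrite Eq in Mq; destruct (kpair_mem_trans M _ _ TM Mq) as [Mz Mu].
      exists z; split; auto; exists (recF a z); auto.
    + intros [Hq (z & Mz & u & Mu & Eq & Hz)]; exists z; split; auto.
      rewrite Eq in Hq; rewrite Eq, (tc_graph_sound a x f z u H Hq); reflexivity.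
  - intros z Mz Hz; exists (recF a z); split; auto.
    pose proof (TM f Hf _ (K z Hz)) as Mk; apply (kpair_mem_trans M _ _ TM Mk).
  - intros u Mu; rewrite mem_recF_graph; tauto.
Qed.

(** An attempt contains the history of each of its arguments. Defined at x, it is therefore defined
    on the whole transitive closure, and soundness fixes its values. This yields a unique least
    attempt. *)
Lemma tc_graph_minimal a x f f' : tc_graph a x f -> f' ∈ M -> attempt a f' ->
  (exists u, u ∈ M /\ kpair x u ∈ f') -> f ⊆ f'.
Proof.
  intros H Mf' Hf' Hx p Hp; rewrite (H p) in Hp; destruct Hp as [y [Ty Ep]]; rewrite Ep; clear p Ep.
  clear f H; induction Ty as [x y E | x z y Hz _ IH]; destruct Hx as [u [Mu Hu]].
  - rewrite E, <- (attempt_sound a f' x Mf' Hf' u Hu); auto.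
  - apply IH; pose proof (TM f' Mf' _ Hu) as Mk.
    destruct (Hf' _ Mk Hu) as (x' & Mx & y' & My & E & h & Mh & Hh & Htot & Hy).
    apply kpair_inj in E; destruct E as [E1 E2]; rewrite E1 in Hz.
    apply Htot; auto; exact (TM x' Mx z Hz).
Qed.

Lemma recF_tc_graph_in a x : a ∈ M -> x ∈ M ->
  recF a x ∈ M /\ exists f, f ∈ M /\ tc_graph a x f.
Proof.
  intros Ma; induction x as [x IH] using mem_ind; intros Mx.
  assert (IH' : forall z, z ∈ x -> exists f, f ∈ M /\ tc_graph a z f).
  { intros z Hz; apply IH; auto; exact (TM x Mx z Hz). }
  (* Many attempts are defined at z; taking the least one under inclusion makes the relation
     functional, as Replacement requires. *)
  destruct (union_replacement (fun z f => attempt a f /\ (exists u, u ∈ M /\ kpair z u ∈ f) /\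
    forall f', f' ∈ M -> attempt a f' -> (exists u, u ∈ M /\ kpair z u ∈ f') -> f ⊆ f') x)
    as [U [MU HU]]; auto.
  { unfold D2; dsolve_attempt. }
  { intros z f f' _ Mf Mf' (A1 & B1 & C1) (A2 & B2 & C2); apply incl_antisym; auto. }
  assert (HU' : forall p, p ∈ U <-> exists z, z ∈ x /\ exists y, tc z y /\ p ≈ kpair y (recF a y)).
  { intros p; rewrite HU; split.
    - intros (z & f & Hz & Mf & (A1 & B1 & C1) & Hp); exists z; split; auto.
      destruct (IH' z Hz) as [f' [Mf' Hf']]; apply Hf'.
      pose proof (tc_graph_attempt a z f' Mf' Hf').
      apply (C1 f'); auto.
      assert (K : kpair z (recF a z) ∈ f') by (apply Hf'; exists z; split; [apply tc_eq|]; reflexivity).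
      exists (recF a z); split; auto; exact (proj2 (kpair_mem_trans M _ _ TM (TM _ Mf' _ K))).
    - intros (z & Hz & y & Ty & Ep); destruct (IH' z Hz) as [f [Mf Hf]].
      assert (K : kpair z (recF a z) ∈ f) by (apply Hf; exists z; split; [apply tc_eq|]; reflexivity).
      exists z, f; split; auto; split; auto; split; [|apply Hf; eauto].
      split; [apply (tc_graph_attempt a z); auto|]; split.
      + exists (recF a z); split; auto; exact (proj2 (kpair_mem_trans M _ _ TM (TM _ Mf _ K))).
      + intros f' Mf' Af' Bf'; apply (tc_graph_minimal a z); auto. }
  assert (MG : graph a x ∈ M).
  { apply (graph_in a x U); auto.
    - intros z Hz; apply HU'; exists z; split; auto; exists z; split; [apply tc_eq|]; reflexivity.
    - intros z u K; rewrite HU' in K; destruct K as (z' & _ & y & _ & E).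
      apply kpair_inj in E; destruct E as [E1 E2]; rewrite E2, E1; reflexivity. }
  assert (MF : recF a x ∈ M).
  { destruct (HPset a (graph a x) Ma MG) as [y [My Hy]].
    assert (E : recF a x ≈ y); [|rewrite E; auto].
    apply veq_ext; intros u; rewrite mem_recF_graph, Hy; reflexivity. }
  split; auto; exists (ins x (recF a x) U); split; [apply nice_ins; auto|].
  intros p; rewrite mem_ins, HU'; split.
  - intros [(z & Hz & y & Ty & Ep) | Ep].
    + exists y; split; auto; apply (tc_in x z); auto.
    + exists x; split; auto; apply tc_eq; reflexivity.
  - intros [y [Ty Ep]]; destruct Ty as [x y E | x z y Hz Ty].
    + right; rewrite Ep, E; reflexivity.
    + left; exists z; split; auto; eauto.
Qed.

Lemma recF_in a x : a ∈ M -> x ∈ M -> recF a x ∈ M.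
Proof. intros; apply recF_tc_graph_in; auto. Qed.

Lemma D3_recF : D3 M okX (fun _ a x y => y ≈ recF a x).
Proof.
  unfold D3; apply (D_ext M okX (fun _ e => exists f, f ∈ M /\
    attempt (e (Some (Some None))) f /\ kpair (e (Some None)) (e None) ∈ f)).
  - intros _ e He; split.
    + intros [f [Mf [Af Hf]]]; apply (attempt_sound _ f); auto.
    + intros E; destruct (recF_tc_graph_in (e (Some (Some None))) (e (Some None))) as [_ [f [Mf Hf]]]; auto.
      exists f; split; auto; split; [apply (tc_graph_attempt _ (e (Some None))); auto|].
      apply Hf; exists (e (Some None)); split; [apply tc_eq; reflexivity|].
      rewrite E; reflexivity.
  - dsolve_attempt.
Qed.

Lemma DT_recF {Y : Set} (t u : (Y -> V) -> V) :
  DT M okX t -> DT M okX u -> DT M okX (fun e => recF (t e) (u e)).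
Proof. apply DT_comp2; [exact recF_in | exact D3_recF]. Qed.

End SetRecursion.

(** ** Ordinal arithmetic and the cumulative hierarchy of M *)

Definition Padd (a h u : V) : Prop := u ∈ a \/ exists y, y ∈ M /\ kpair y u ∈ h.

#[local] Instance Padd_proper : Proper (veq ==> veq ==> veq ==> iff) Padd.
Proof.
  intros a a' Ha h h' Hh u u' Hu; unfold Padd.
  setoid_rewrite Ha; setoid_rewrite Hh; setoid_rewrite Hu; reflexivity.
Qed.

Lemma D3_Padd : D3 M okX (fun _ => Padd).
Proof. unfold D3, Padd; dsolveM. Qed.

Lemma Padd_set a h : a ∈ M -> h ∈ M ->
  exists y, y ∈ M /\ forall u, u ∈ y <-> u ∈ M /\ Padd a h u.
Proof.
  intros Ma Mh.
  destruct (replacement (fun q u => exists y, y ∈ M /\ q ≈ kpair y u) h) as [b [Mb Hb]]; auto.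
  { unfold D2; dsolveM. }
  { intros x y y' _ _ _ [z [_ E]] [z' [_ E']]; rewrite E in E'; apply kpair_inj in E'; tauto. }
  exists (vcup a b); split; [apply (nice_cup M HM); auto|].
  intros u; rewrite mem_cup, Hb; unfold Padd; split.
  - intros [Hu | [Mu [q [Hq [y [My E]]]]]].
    + split; auto; exact (TM a Ma u Hu).
    + split; auto; right; exists y; rewrite <- E; auto.
  - intros [Mu [Hu | [y [My Hy]]]]; auto; right; split; auto.
    exists (kpair y u); split; auto; exists y; split; auto; reflexivity.
Qed.

Lemma oadd_recF a b : a ∈ M -> b ∈ M -> oadd a b ≈ recF Padd a b.
Proof.
  intros Ma; induction b as [b IH] using mem_ind; intros Mb.
  pose proof (recF_proper Padd _) as RP.
  apply veq_ext; intros u; rewrite mem_oadd, mem_recF_graph by exact _; unfold Padd at 1.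
  setoid_rewrite mem_graph; [|exact _]; split.
  - intros [Hu | [c [Hc E]]]; [split; auto; exact (TM a Ma u Hu)|].
    pose proof (TM b Mb c Hc) as Mc; rewrite (IH c Hc Mc) in E; split.
    + rewrite E; apply (recF_in Padd _ D3_Padd Padd_set); auto.
    + right; exists c; split; auto; exists c; split; auto; rewrite E; reflexivity.
  - intros [Mu [Hu | [y [My [c [Hc E]]]]]]; auto; right; exists c; split; auto.
    apply kpair_inj in E; destruct E as [_ E]; rewrite E; symmetry; apply IH; auto.
    exact (TM b Mb c Hc).
Qed.

Lemma DT_ext {Y : Set} (t u : (Y -> V) -> V) :
  (forall e, (forall i, e i ∈ M) -> t e ≈ u e) -> DT M okX u -> DT M okX t.
Proof.
  intros H [H1 H2]; split.
  - intros e He; rewrite (H e He); auto.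
  - eapply D_ext; [|exact H2]; intros w e He; rewrite (H (fun i => e (Some i))); auto; reflexivity.
Qed.

Lemma DT_oadd {Y : Set} (t u : (Y -> V) -> V) :
  DT M okX t -> DT M okX u -> DT M okX (fun e => oadd (t e) (u e)).
Proof.
  intros Ht Hu; apply (DT_ext _ (fun e => recF Padd (t e) (u e))).
  - intros e He; apply oadd_recF; [apply Ht | apply Hu]; auto.
  - apply (DT_recF Padd _ D3_Padd Padd_set); auto.
Qed.

Lemma oadd_in a b : a ∈ M -> b ∈ M -> oadd a b ∈ M.
Proof.
  intros; rewrite oadd_recF by auto; apply (recF_in Padd _ D3_Padd Padd_set); auto.
Qed.

Definition Pmul (a h u : V) : Prop :=
  exists y, y ∈ M /\ exists z, z ∈ M /\ kpair y z ∈ h /\ u ∈ oadd z a.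

#[local] Instance Pmul_proper : Proper (veq ==> veq ==> veq ==> iff) Pmul.
Proof.
  intros a a' Ha h h' Hh u u' Hu; unfold Pmul.
  setoid_rewrite Ha; setoid_rewrite Hh; setoid_rewrite Hu; reflexivity.
Qed.

Lemma D3_Pmul : D3 M okX (fun _ => Pmul).
Proof. unfold D3, Pmul; repeat first [apply DT_oadd | dstepM]. Qed.

Lemma Pmul_set a h : a ∈ M -> h ∈ M ->
  exists y, y ∈ M /\ forall u, u ∈ y <-> u ∈ M /\ Pmul a h u.
Proof.
  intros Ma Mh.
  destruct (union_replacement (fun q s => exists y, y ∈ M /\ exists z, z ∈ M /\
    q ≈ kpair y z /\ s ≈ oadd z a) h) as [b [Mb Hb]]; auto.
  { unfold D2; repeat first [apply DT_oadd | dstepM]. }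
  { intros x y y' _ _ _ (z & _ & s & _ & E & Es) (z' & _ & s' & _ & E' & Es').
    rewrite E in E'; apply kpair_inj in E'; destruct E' as [_ E']; rewrite Es, Es', E'; reflexivity. }
  exists b; split; auto; intros u; rewrite Hb; unfold Pmul; split.
  - intros (q & s & Hq & Ms & (y & My & z & Mz & E & Es) & Hu); split; [exact (TM s Ms u Hu)|].
    exists y; split; auto; exists z; rewrite <- E, <- Es; auto.
  - intros (Mu & y & My & z & Mz & Hq & Hu); exists (kpair y z), (oadd z a).
    split; auto; split; [apply oadd_in; auto|]; split; auto.
    exists y; split; auto; exists z; split; auto; split; reflexivity.
Qed.

(** The ambient product agrees with a recursion performed inside M. Hence γ·ω is an element of M and
    can be the length of the recursion that produces S. *)
Lemma omul_recF a b : a ∈ M -> b ∈ M -> omul a b ≈ recF Pmul a b.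
Proof.
  intros Ma; induction b as [b IH] using mem_ind; intros Mb.
  apply veq_ext; intros u; rewrite mem_omul, mem_recF_graph by exact _; unfold Pmul at 1.
  setoid_rewrite mem_graph; [|exact _].
  assert (IH' : forall c, c ∈ b -> c ∈ M /\ omul a c ≈ recF Pmul a c /\ recF Pmul a c ∈ M).
  { intros c Hc; pose proof (TM b Mb c Hc) as Mc; split; auto; split; auto.
    apply (recF_in Pmul _ D3_Pmul Pmul_set); auto. }
  split.
  - intros [c [Hc Hu]]; destruct (IH' c Hc) as [Mc [E Mr]]; rewrite E in Hu; split.
    + exact (TM _ (oadd_in _ _ Mr Ma) u Hu).
    + exists c; split; auto; exists (recF Pmul a c); split; auto; split; auto.
      exists c; split; auto; reflexivity.
  - intros [Mu (y & My & z & Mz & [c [Hc E]] & Hu)]; exists c; split; auto.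
    destruct (IH' c Hc) as [_ [E' _]]; apply kpair_inj in E; destruct E as [_ E].
    rewrite E', <- E; exact Hu.
Qed.

Lemma omul_in a b : a ∈ M -> b ∈ M -> omul a b ∈ M.
Proof.
  intros; rewrite omul_recF by auto; apply (recF_in Pmul _ D3_Pmul Pmul_set); auto.
Qed.

Definition Ppow (a h u : V) : Prop :=
  exists y, y ∈ M /\ exists z, z ∈ M /\ kpair y z ∈ h /\ u ⊆ z.

#[local] Instance Ppow_proper : Proper (veq ==> veq ==> veq ==> iff) Ppow.
Proof.
  intros a a' Ha h h' Hh u u' Hu; unfold Ppow.
  setoid_rewrite Hh; setoid_rewrite Hu; reflexivity.
Qed.

Lemma D3_Ppow : D3 M okX (fun _ => Ppow).
Proof. unfold D3, Ppow; dsolveM. Qed.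

Lemma Ppow_set a h : a ∈ M -> h ∈ M ->
  exists y, y ∈ M /\ forall u, u ∈ y <-> u ∈ M /\ Ppow a h u.
Proof.
  intros Ma Mh.
  destruct (union_replacement (fun q s => exists y, y ∈ M /\ exists z, z ∈ M /\
    q ≈ kpair y z /\ forall u, u ∈ M -> (u ∈ s <-> u ⊆ z)) h) as [b [Mb Hb]]; auto.
  { unfold D2; dsolveM. }
  { intros x s s' _ Ms Ms' (y & _ & z & _ & E & Es) (y' & _ & z' & _ & E' & Es').
    rewrite E in E'; apply kpair_inj in E'; destruct E' as [_ E'].
    apply veq_ext; intros u; split; intros Hu.
    - pose proof (TM s Ms u Hu); apply Es'; auto; rewrite <- E'; apply Es; auto.
    - pose proof (TM s' Ms' u Hu); apply Es; auto; rewrite E'; apply Es'; auto. }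
  exists b; split; auto; intros u; rewrite Hb; unfold Ppow; split.
  - intros (q & s & Hq & Ms & (y & My & z & Mz & E & Es) & Hu); pose proof (TM s Ms u Hu).
    split; auto; exists y; split; auto; exists z; rewrite <- E, <- Es; auto.
  - intros (Mu & y & My & z & Mz & Hq & Hu); destruct (powerset z Mz) as [p [Mp Hp]].
    exists (kpair y z), p; split; auto; split; auto; split; [|apply Hp; auto].
    exists y; split; auto; exists z; split; auto; split; [reflexivity|].
    intros v Mv; rewrite Hp; tauto.
Qed.

(** [Vr x] is the stage of the cumulative hierarchy of M indexed by the rank of x. *)
Definition Vr (x : V) : V := recF Ppow vempty x.

#[local] Instance Vr_proper : Proper (veq ==> veq) Vr.
Proof. intros x y E; unfold Vr; apply recF_proper; auto; [exact _ | reflexivity]. Qed.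

Lemma Vr_in x : x ∈ M -> Vr x ∈ M.
Proof.
  intros; apply (recF_in Ppow _ D3_Ppow Ppow_set); auto; apply (nice_empty M HM).
Qed.

Lemma DT_Vr {Y : Set} (t : (Y -> V) -> V) : DT M okX t -> DT M okX (fun e => Vr (t e)).
Proof.
  intros Ht; apply (DT_recF Ppow _ D3_Ppow Ppow_set (fun _ => vempty) t); auto; dsolveM.
Qed.

Lemma mem_Vr x u : x ∈ M -> u ∈ Vr x <-> u ∈ M /\ exists y, y ∈ x /\ u ⊆ Vr y.
Proof.
  intros Mx; unfold Vr at 1; rewrite mem_recF_graph by exact _; unfold Ppow at 1.
  setoid_rewrite mem_graph; [|exact _]; apply and_iff_compat_l; split.
  - intros (y & My & z & Mz & [c [Hc E]] & Hu); exists c; split; auto.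
    apply kpair_inj in E; destruct E as [_ E]; rewrite E in Hu; exact Hu.
  - intros [y [Hy Hu]]; pose proof (TM x Mx y Hy) as My; exists y; split; auto.
    exists (Vr y); split; [apply Vr_in; auto|]; split; auto; exists y; split; auto; reflexivity.
Qed.

Lemma Vr_super x u v : x ∈ M -> u ∈ M -> u ⊆ v -> v ∈ Vr x -> u ∈ Vr x.
Proof.
  intros Mx Mu Huv; rewrite !mem_Vr by auto; intros [_ [y [Hy Hv]]]; split; auto.
  exists y; split; auto; intros z Hz; auto.
Qed.

Lemma Vr_trans x : x ∈ M -> transitive (Vr x).
Proof.
  induction x as [x IH] using mem_ind; intros Mx u Hu v Hv.
  rewrite mem_Vr in Hu by auto; destruct Hu as [Mu [y [Hy Hu]]].
  rewrite mem_Vr by auto; split; [exact (TM u Mu v Hv)|]; exists y; split; auto.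
  apply (IH y Hy (TM x Mx y Hy)); auto.
Qed.

Lemma Vr_incl x : x ∈ M -> x ⊆ Vr x.
Proof.
  induction x as [x IH] using mem_ind; intros Mx y Hy; pose proof (TM x Mx y Hy) as My.
  rewrite mem_Vr by auto; split; auto; exists y; split; auto.
Qed.

(** Let u ∈ Vr x be missing from Vr y, with u ⊆ Vr x' and x' ∈ x. For y' ∈ y, Vr x' ⊆ Vr y' would
    give u ∈ Vr y, so Vr y' ∈ Vr x' by induction. Thus Vr y ⊆ Vr x', and Vr y ∈ Vr x. *)
Lemma Vr_total x y : x ∈ M -> y ∈ M -> Vr x ⊆ Vr y \/ Vr y ∈ Vr x.
Proof.
  revert y; induction x as [x IH] using mem_ind; intros y Mx My.
  destruct (classic (Vr x ⊆ Vr y)) as [H | H]; auto; right.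
  apply not_all_ex_not in H; destruct H as [u H]; apply imply_to_and in H; destruct H as [Hu Hn].
  rewrite mem_Vr in Hu by auto; destruct Hu as [Mu [x' [Hx' Hu]]].
  pose proof (TM x Mx x' Hx') as Mx'.
  rewrite mem_Vr by auto; split; [apply Vr_in; auto|]; exists x'; split; auto.
  intros v Hv; rewrite mem_Vr in Hv by auto; destruct Hv as [Mv [y' [Hy' Hv]]].
  pose proof (TM y My y' Hy') as My'.
  destruct (IH x' Hx' y' Mx' My') as [K | K].
  - elim Hn; rewrite mem_Vr by auto; split; auto; exists y'; split; auto; intros z Hz; auto.
  - apply (Vr_super x' v (Vr y')); auto.
Qed.

(** Scott's trick: instead of choosing a witness, M takes the least stage with the property. Indices
    are arbitrary sets, so a minimal index need not be unique, but [Vr_total] makes its stage the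
    least. *)
Lemma Vr_least (Q : V -> Prop) x : x ∈ M -> Q (Vr x) ->
  (forall s s', s ⊆ s' -> Q s -> Q s') ->
  exists x0, x0 ∈ M /\ Q (Vr x0) /\ forall y, y ∈ M -> Q (Vr y) -> Vr x0 ⊆ Vr y.
Proof.
  intros Mx HQ Hup; destruct (mem_minimal (fun x => x ∈ M /\ Q (Vr x)) x) as [x0 [[M0 Q0] Hmin]]; auto.
  exists x0; split; auto; split; auto; intros y My Qy.
  destruct (Vr_total x0 y M0 My) as [K | K]; auto.
  rewrite mem_Vr in K by auto; destruct K as [_ [z [Hz K]]].
  elim (Hmin z Hz); split; [exact (TM x0 M0 z Hz) | exact (Hup _ _ K Qy)].
Qed.

(** ** Truth in the game as a class *)

(** ETR is applied to the relation x ∈ y ∈ d, whose rank function is the identity on d. Closure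
    under successor puts every ξ < d into the field of this relation. *)
Lemma win_class d : d ∈ M -> ordinal d -> (forall xi, xi ∈ d -> vsucc xi ∈ d) ->
  ETR_ord d M X ->
  exists S, S ∈ X /\ forall xi v, xi ∈ d -> v ∈ M -> (kpair xi v ∈ S <-> win M xi v).
Proof.
  intros Md Od Hsucc HE.
  (* The clause defining [win] is a formula in v and Y = S↾ξ only. The clocks below ξ are recovered
     as the z with (z, ∅) ∈ Y, since ∅ is won at every clock. The chosen [ok] forces each class
     variable to denote Y. *)
  assert (HD : D M (fun f : V -> V => f = (fun Y => Y)) (X := unit) (fun Y e =>
    forall z, z ∈ M -> kpair z vempty ∈ Y -> exists y, y ∈ M /\ kpair y vempty ∈ Y /\ z ⊆ y /\
      forall w, w ∈ M -> move M (e tt) w -> ~ kpair y w ∈ Y)).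
  { assert (HY : forall (Z : Set) (t : (Z -> V) -> V),
      DT M (fun f : V -> V => f = (fun Y => Y)) t -> D M (fun f : V -> V => f = (fun Y => Y)) (fun Y e => t e ∈ Y)).
    { intros Z t Ht; apply (D_cls M _ t (fun Y => Y)); auto. }
    repeat first [apply HY | apply (D_rel2 M _ (fun _ v w => move M v w)); [apply D2_move; exact HM | |] | dstepM]. }
  destruct HD as [C [cl [p [Hc Hp]]]].
  destruct (comprehension (fun q => exists x, x ∈ M /\ exists y, y ∈ M /\ q ≈ kpair x y /\ x ∈ y /\ y ∈ d))
    as [R [HR [HRM HR']]].
  { unfold D1; dsolveM. }
  assert (HRel : forall x y, rel R x y <-> x ∈ y /\ y ∈ d).
  { intros x y; unfold rel; split.
    - intros K; apply HR' in K; [|auto]; destruct K as (x' & _ & y' & _ & E & H).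
      apply kpair_inj in E; destruct E as [E1 E2]; rewrite E1, E2; exact H.
    - intros [H1 H2]; pose proof (TM d Md y H2) as My; pose proof (TM y My x H1) as Mx.
      apply HR'; [apply nice_kpair; auto|].
      exists x; split; auto; exists y; split; auto; split; [reflexivity | auto]. }
  assert (Hdom : forall x, dom R x <-> x ∈ d).
  { intros x; unfold dom; setoid_rewrite HRel; split.
    - intros [y [[H1 H2] | [H1 H2]]]; auto; exact (proj1 Od y H2 x H1).
    - intros Hx; exists (vsucc x); left; split; [apply mem_self_succ | auto]. }
  assert (Hlt : forall x y, lt_rel R x y <-> x ∈ y /\ y ∈ d).
  { intros x y; split.
    - induction 1 as [x y H | x y z _ [A1 A2] _ [B1 B2]]; [apply HRel; auto|]; split; auto.
      exact (proj1 (ordinal_mem _ _ Od B2) y B1 x A1).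
    - intros H; apply t_step, HRel; auto. }
  destruct (comprehension (fun q => exists x, x ∈ M /\ q ≈ kpair x x /\ x ∈ d))
    as [rho [Hrho [HrhoM Hrho']]].
  { unfold D1; dsolveM. }
  assert (Hr : forall x y, kpair x y ∈ rho <-> x ≈ y /\ x ∈ d).
  { intros x y; split.
    - intros K; apply Hrho' in K; [|auto]; destruct K as (x' & _ & E & H).
      apply kpair_inj in E; destruct E as [E1 E2]; rewrite E1, E2; split; auto; reflexivity.
    - intros [E H]; pose proof (TM d Md x H) as Mx; rewrite <- E.
      apply Hrho'; [apply nice_kpair; auto|].
      exists x; split; auto; split; [reflexivity | auto]. }
  destruct (HE (fmap (fun _ => varY) id p) R R HR HR) as [S [HSX [_ HS']]].
  - intros q Hq; apply HR' in Hq; [|auto]; destruct Hq as (x & _ & y & _ & E & _); eauto.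
  - intros C' _ [x Hx]; destruct (mem_minimal (fun x => x ∈ C') x Hx) as [m [Hm Hmin]].
    exists m; split; auto; intros y Hy K; rewrite HRel in K; exact (Hmin y (proj1 K) Hy).
  - exists rho; split; auto; split; [split|].
    + intros x y y' H H'; rewrite Hr in H, H'; rewrite <- (proj1 H); apply H'.
    + intros r Hrd; rewrite Hdom in Hrd; exists r; split; [apply Hr; split; auto; reflexivity|].
      intros z; setoid_rewrite HRel; setoid_rewrite Hr; split.
      * intros Hz; exists z, z; repeat split; auto; [reflexivity | exact (proj1 Od r Hrd z Hz) |].
        right; reflexivity.
      * intros (r' & v & [H1 H2] & [E H3] & [K | K]); rewrite <- E in K.
        -- exact (proj1 (ordinal_mem _ _ Od Hrd) r' H1 z K).
        -- rewrite K; auto.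
    + intros r u _ H; rewrite Hr in H; rewrite <- (proj1 H); apply H.
  - exists S; split; auto; intros xi v Hxi Hv; revert v Hv.
    induction xi as [xi IH] using mem_ind; intros v Hv.
    rewrite (HS' xi (proj2 (Hdom xi) Hxi) v Hv), sat_fmap.
    set (Y := restr R S xi).
    assert (Esat : forall e, sat M (fun _ => Y) e p <-> sat M (fun c => cl c Y) e p).
    { intros e; apply sat_veq; [|reflexivity]; intros c; pose proof (Hc c) as E; cbv beta in E; rewrite E; reflexivity. }
    cbn [etr_cl]; rewrite Esat, Hp by auto; clear Esat; rewrite win_iff.
    assert (HY : forall eta w, w ∈ M -> kpair eta w ∈ Y <-> eta ∈ xi /\ win M eta w).
    { intros eta w Hw; unfold Y, restr; rewrite mem_sep.
      2:{ intros a b E (r' & x' & H1 & H2); exists r', x'; rewrite <- E; auto. }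
      split.
      - intros [K (r' & x' & K1 & K2)]; apply kpair_inj in K2; destruct K2 as [K2 K3].
        apply Hlt in K1; rewrite <- K2 in K1; destruct K1 as [K1 _]; split; auto.
        apply IH; auto; exact (proj1 Od xi Hxi eta K1).
      - intros [K1 K2]; split.
        + apply IH; auto; exact (proj1 Od xi Hxi eta K1).
        + exists eta, w; split; [apply Hlt; auto | reflexivity]. }
    assert (M0 := nice_empty M HM).
    assert (HY0 : forall eta, kpair eta vempty ∈ Y <-> eta ∈ xi).
    { intros eta; rewrite HY by auto; split; [tauto|]; split; auto.
      rewrite win_iff; intros z Hz; exists z; split; auto; split; [intros u; auto|].
      intros w _ K; elim (move_empty M w K). }
    assert (Mxi := TM d Md xi Hxi).
    split.
    + intros H z Hz; destruct (H z (TM xi Mxi z Hz)) as (y & My & Hy & Hzy & K); [apply HY0; auto|].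
      rewrite HY0 in Hy; exists y; split; auto; split; auto; intros w Mw Hm Hwin.
      apply (K w Mw Hm), HY; auto.
    + intros H z Mz Hz; rewrite HY0 in Hz; destruct (H z Hz) as (y & Hy & Hzy & K).
      exists y; split; [exact (TM xi Mxi y Hy)|]; rewrite HY0; split; auto; split; auto.
      intros w Mw Hm; rewrite HY by auto; intros [_ Hwin]; exact (K w Mw Hm Hwin).
Qed.

(** ** A chain of reflecting stages *)

Section Chain.
Context (S : V) (HSX : S ∈ X).

Definition wit (xi v w : V) : Prop := move M v w /\ kpair xi w ∈ S.

(** h is the graph of the chain so far. Besides a, the set t contains each earlier link as an
    element and a winning answer to each question (ξ, v) in an earlier link that has one in M. *)
Definition reflects (a h t : V) : Prop := a ∈ t /\
  forall y, y ∈ M -> forall s, s ∈ M -> kpair y s ∈ h -> s ∈ t /\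
  forall xi, xi ∈ M -> forall v, v ∈ M -> kpair xi v ∈ s ->
    (exists w, w ∈ M /\ wit xi v w) -> exists w, w ∈ M /\ w ∈ t /\ wit xi v w.

(** [recF] wants the next link described by its members: it is the intersection of all reflecting
    stages, which is the least of them, so no stage is chosen. *)
Definition Pchain (a h u : V) : Prop :=
  forall x, x ∈ M -> reflects a h (Vr x) -> u ∈ Vr x.

#[local] Instance wit_proper : Proper (veq ==> veq ==> veq ==> iff) wit.
Proof. intros x x' E y y' E' z z' E''; unfold wit; rewrite E, E', E''; reflexivity. Qed.

#[local] Instance Pchain_proper : Proper (veq ==> veq ==> veq ==> iff) Pchain.
Proof.
  intros a a' Ha h h' Hh u u' Hu; unfold Pchain, reflects.
  setoid_rewrite Ha; setoid_rewrite Hh; setoid_rewrite Hu; reflexivity.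
Qed.

Lemma D3_wit : D3 M okX (fun _ => wit).
Proof.
  unfold D3, wit; apply D_and.
  - apply (D_rel2 M okX (fun _ v w => move M v w)); [apply D2_move; exact HM | |]; dsolveM.
  - apply (D_cls M okX _ (fun _ => S)); [exact HSX|]; dsolveM.
Qed.

Ltac dsolve_wit := repeat first
  [ apply (D_rel3 M okX (fun _ => wit)); [exact D3_wit | | |] | apply DT_Vr | dstepM ].

Lemma D3_Pchain : D3 M okX (fun _ => Pchain).
Proof. unfold D3, Pchain, reflects; dsolve_wit. Qed.

Lemma reflects_up a h s t : s ⊆ t -> reflects a h s -> reflects a h t.
Proof.
  intros H [H1 H2]; split; auto; intros y My r Mr Hr; destruct (H2 y My r Mr Hr) as [K1 K2].
  split; auto; intros xi Mxi v Mv Hv Hw; destruct (K2 xi Mxi v Mv Hv Hw) as (w & Mw & Hw1 & Hw2).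
  exists w; auto.
Qed.

Lemma reflects_ex a h : a ∈ M -> h ∈ M -> exists x, x ∈ M /\ reflects a h (Vr x).
Proof.
  intros Ma Mh.
  destruct (union_replacement (fun q s => exists y, y ∈ M /\ q ≈ kpair y s) h) as [b [Mb Hb]]; auto.
  { unfold D2; dsolveM. }
  { intros q s s' _ _ _ [y [_ E]] [y' [_ E']]; rewrite E in E'; apply kpair_inj in E'; tauto. }
  set (has := fun t xi v => exists w, w ∈ M /\ w ∈ t /\ wit xi v w).
  (* Each question in b is sent to the least stage containing an answer, which is unique although
     the answer is not. *)
  destruct (union_replacement (fun p s => exists xi, xi ∈ M /\ exists v, v ∈ M /\ p ≈ kpair xi v /\
    (exists x, x ∈ M /\ s ≈ Vr x /\ has s xi v) /\
    forall x, x ∈ M -> has (Vr x) xi v -> s ⊆ Vr x) b) as [u [Mu Hu]]; auto.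
  { unfold D2, has; dsolve_wit. }
  { intros p s s' _ _ _ (xi & _ & v & _ & E & (x & Mx & Es & Hs) & Hmin)
      (xi' & _ & v' & _ & E' & (x' & Mx' & Es' & Hs') & Hmin').
    rewrite E in E'; apply kpair_inj in E'; destruct E' as [E1 E2].
    apply incl_antisym.
    - rewrite Es'; apply Hmin; auto; destruct Hs' as (w & Mw & Hw & K).
      exists w; rewrite <- Es', E1, E2; auto.
    - rewrite Es; apply Hmin'; auto; destruct Hs as (w & Mw & Hw & K).
      exists w; rewrite <- Es, <- E1, <- E2; auto. }
  (* u is the union of the stages with answers; with a and b added as elements, a and every s ⊆ b in
     M become elements of [Vr x]. *)
  set (x := vcup u (vpair a b)).
  assert (Mx' : x ∈ M) by (apply (nice_cup M HM); auto; apply (nice_pair M HM); auto).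
  exists x; split; auto; split.
  - apply Vr_incl; auto; unfold x; rewrite mem_cup, mem_pair; right; left; reflexivity.
  - intros y My s Ms Hs.
    assert (Hsb : s ⊆ b).
    { intros z Hz; apply Hb; exists (kpair y s), s; split; auto; split; auto; split; auto.
      exists y; split; auto; reflexivity. }
    split.
    + apply (Vr_super x s b); auto; apply Vr_incl; auto.
      unfold x; rewrite mem_cup, mem_pair; right; right; reflexivity.
    + intros xi Mxi v Mv Hv (w0 & Mw0 & Hw0).
      destruct (Vr_least (fun t => has t xi v) (vpair w0 w0)) as [x0 [M0 [K0 Hmin]]].
      * apply (nice_pair M HM); auto.
      * exists w0; split; auto; split; auto; apply Vr_incl; [apply (nice_pair M HM); auto|].
        rewrite mem_pair; left; reflexivity.
      * intros r t Hrt (w & Mw & Hw & K); exists w; auto.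
      * destruct K0 as (w & Mw & Hw & K); exists w; split; auto; split; auto.
        apply Vr_incl; auto; unfold x; rewrite mem_cup; left; apply Hu.
        exists (kpair xi v), (Vr x0); split; auto; split; [apply Vr_in; auto|]; split; auto.
        exists xi; split; auto; exists v; split; auto; split; [reflexivity|]; split; auto.
        exists x0; split; auto; split; [reflexivity|]; exists w; auto.
Qed.

Lemma Pchain_least a h : a ∈ M -> h ∈ M -> exists x, x ∈ M /\ reflects a h (Vr x) /\
  forall u, u ∈ Vr x <-> u ∈ M /\ Pchain a h u.
Proof.
  intros Ma Mh; destruct (reflects_ex a h Ma Mh) as [x [Mx Hx]].
  destruct (Vr_least (reflects a h) x Mx Hx (reflects_up a h)) as [x0 [M0 [H0 Hmin]]].
  exists x0; split; auto; split; auto; intros u; split.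
  - intros Hu; split; [exact (TM _ (Vr_in x0 M0) u Hu)|]; intros y My Hy; apply (Hmin y); auto.
  - intros [_ Hu]; apply Hu; auto.
Qed.

Lemma Pchain_set a h : a ∈ M -> h ∈ M ->
  exists y, y ∈ M /\ forall u, u ∈ y <-> u ∈ M /\ Pchain a h u.
Proof.
  intros Ma Mh; destruct (Pchain_least a h Ma Mh) as [x [Mx [_ H]]]; exists (Vr x).
  split; auto; apply Vr_in; auto.
Qed.

(** The recursion runs through all sets of M, but only its values at natural numbers are used. As it
    is definable in (M, X), Replacement on ω puts the union of the chain into M. *)
Lemma chain_ex a : a ∈ M -> exists (N : V) (H : nat -> V), N ∈ M /\
  (forall z, z ∈ N <-> exists n, z ∈ H n) /\ a ∈ N /\
  (forall n, transitive (H n)) /\ (forall n, H n ∈ H (Datatypes.S n)) /\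
  (forall n u v, u ∈ M -> u ⊆ v -> v ∈ H n -> u ∈ H n) /\
  (forall n xi v, kpair xi v ∈ H n -> (exists w, w ∈ M /\ wit xi v w) ->
    exists w, w ∈ H (Datatypes.S n) /\ wit xi v w).
Proof.
  intros Ma; set (F := recF Pchain a).
  assert (RP : Proper (veq ==> veq) F).
  { intros x y E; apply recF_proper; auto; [exact _ | reflexivity]. }
  assert (MF : forall x, x ∈ M -> F x ∈ M).
  { intros; apply (recF_in Pchain _ D3_Pchain Pchain_set); auto. }
  assert (MG : forall x, x ∈ M -> graph Pchain a x ∈ M).
  { intros x Mx.
    destruct (replacement (fun z p => p ≈ kpair z (F z)) x) as [b [Mb Hb]]; auto.
    - unfold D2; apply D_eq; [dsolveM | apply DT_kpair; [exact HM | dsolveM|]].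
      apply (DT_recF Pchain _ D3_Pchain Pchain_set (fun _ => a)); dsolveM.
    - intros z p p' _ _ _ E E'; rewrite E, E'; reflexivity.
    - assert (E : graph Pchain a x ≈ b); [|rewrite E; auto].
      apply veq_ext; intros p; rewrite mem_graph by exact _; rewrite Hb; split; [|tauto].
      intros [z [Hz E]]; split; eauto; rewrite E; pose proof (TM x Mx z Hz).
      apply nice_kpair; auto; apply MF; auto. }
  assert (HF : forall x, x ∈ M -> exists y, y ∈ M /\ F x ≈ Vr y /\
    reflects a (graph Pchain a x) (F x)).
  { intros x Mx; destruct (Pchain_least a _ Ma (MG x Mx)) as [y [My [H1 H2]]].
    assert (E : F x ≈ Vr y).
    { apply veq_ext; intros u; unfold F; rewrite mem_recF_graph, H2 by exact _; reflexivity. }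
    exists y; split; auto; split; auto.
    apply (reflects_up _ _ (Vr y)); auto; rewrite E; intros z; auto. }
  assert (Mn : forall n, vnat n ∈ M) by (intros; apply nice_nat; auto).
  destruct (union_replacement (fun x y => y ≈ F x) omega) as [N [MN HN]].
  { unfold D2; apply D_eq; [dsolveM|].
    apply (DT_recF Pchain _ D3_Pchain Pchain_set (fun _ => a)); dsolveM. }
  { exact omega_in. }
  { intros x y y' _ _ _ E E'; rewrite E, E'; reflexivity. }
  assert (HN' : forall z, z ∈ N <-> exists n, z ∈ F (vnat n)).
  { intros z; rewrite HN; split.
    - intros (x & y & [n E] & _ & E' & Hz); simpl in E; exists n.
      rewrite <- (RP _ _ E), <- E'; exact Hz.
    - intros [n Hz]; exists (vnat n), (F (vnat n)); split; [exists n; reflexivity|].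
      split; [apply MF; auto|]; split; auto; reflexivity. }
  assert (Hg : forall n, kpair (vnat n) (F (vnat n)) ∈ graph Pchain a (vnat (Datatypes.S n))).
  { intros n; rewrite mem_graph by exact _; exists (vnat n); split; [apply mem_self_succ | reflexivity]. }
  exists N, (fun n => F (vnat n)); split; auto; split; auto; split; [|split; [|split; [|split]]].
  - apply HN'; exists 0; destruct (HF (vnat 0) (Mn 0)) as (y & _ & _ & K & _); exact K.
  - intros n; destruct (HF (vnat n) (Mn n)) as (y & My & E & _); rewrite E; apply Vr_trans; auto.
  - intros n; destruct (HF _ (Mn (Datatypes.S n))) as (y & _ & _ & _ & K).
    apply (K (vnat n) (Mn n) (F (vnat n)) (MF _ (Mn n)) (Hg n)).
  - intros n u v Mu Huv; destruct (HF (vnat n) (Mn n)) as (y & My & E & _).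
    rewrite !E; apply Vr_super; auto.
  - intros n xi v Hv Hw; destruct (HF _ (Mn (Datatypes.S n))) as (y & _ & _ & _ & K).
    pose proof (TM _ (MF _ (Mn n)) _ Hv) as Mk; destruct (kpair_mem_trans M _ _ TM Mk) as [Mxi Mv].
    destruct (K (vnat n) (Mn n) (F (vnat n)) (MF _ (Mn n)) (Hg n)) as [_ K'].
    destruct (K' xi Mxi v Mv Hv Hw) as (w & _ & Hw1 & Hw2); eauto.
Qed.

End Chain.

(** ** Reflection *)

Section Reflection.
Context (g : V) (Og : ordinal g) (Hw : omega ⊆ g).
Let G := omul g omega.

Let OG : ordinal G.
Proof. apply ordinal_omul; auto. Qed.

Let G_succ xi : xi ∈ G -> vsucc xi ∈ G.
Proof. apply omul_omega_succ_closed; auto. Qed.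

Context (S : V) (HSX : S ∈ X).
Context (HS' : forall xi v, xi ∈ G -> v ∈ M -> (kpair xi v ∈ S <-> win M xi v)).
Context (N : V) (H : nat -> V) (MN : N ∈ M).
Context (HN : forall z, z ∈ N <-> exists n, z ∈ H n) (HGg : kpair G g ∈ N).
Context (HT : forall n, transitive (H n)) (HH : forall n, H n ∈ H (Datatypes.S n)).
Context (Hsuper : forall n u v, u ∈ M -> u ⊆ v -> v ∈ H n -> u ∈ H n).
Context (Hrefl : forall n xi v, kpair xi v ∈ H n -> (exists w, w ∈ M /\ wit S xi v w) ->
    exists w, w ∈ H (Datatypes.S n) /\ wit S xi v w).

Let H_le m n : m <= n -> H m ⊆ H n.
Proof. induction 1; intros z Hz; auto; apply (HT _ _ (HH m0)); auto. Qed.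

Let TN : transitive N.
Proof.
  intros y Hy z Hz; rewrite HN in *; destruct Hy as [n Hn]; exists n; exact (HT n y Hn z Hz).
Qed.

Let NM : N ⊆ M.
Proof. exact (TM N MN). Qed.

Let H_sub n u : u ∈ M -> u ⊆ H n -> u ∈ H (Datatypes.S n).
Proof. intros Mu Hu; exact (Hsuper _ u _ Mu Hu (HH n)). Qed.

Let H_in n z : z ∈ H n -> z ∈ N.
Proof. intros Hz; apply HN; eauto. Qed.

Let H_pair n x y : x ∈ H n -> y ∈ H n -> vpair x y ∈ H (Datatypes.S n).
Proof.
  intros Hx Hy; apply H_sub.
  - apply (nice_pair M HM); apply NM; eauto.
  - intros z Hz; rewrite mem_pair in Hz; destruct Hz as [-> | ->]; auto.
Qed.

Let H_cup n x y : x ∈ H n -> y ∈ H n -> vcup x y ∈ H (Datatypes.S n).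
Proof.
  intros Hx Hy; apply H_sub.
  - apply (nice_cup M HM); apply NM; eauto.
  - intros z Hz; rewrite mem_cup in Hz; destruct Hz as [Hz | Hz].
    + exact (HT n x Hx z Hz).
    + exact (HT n y Hy z Hz).
Qed.

Let H_kpair n x y : x ∈ H n -> y ∈ H n -> kpair x y ∈ H (2 + n).
Proof. intros; unfold kpair; repeat apply H_pair; auto. Qed.

Let H_both x y : x ∈ N -> y ∈ N -> exists n, x ∈ H n /\ y ∈ H n.
Proof.
  intros Hx Hy; rewrite HN in Hx, Hy; destruct Hx as [m Hm], Hy as [n Hn].
  exists (m + n); split; [apply (H_le m) | apply (H_le n)]; auto; lia.
Qed.

Let N_sub u v : u ∈ M -> u ⊆ v -> v ∈ N -> u ∈ N.
Proof. intros Mu Huv Hv; rewrite HN in *; destruct Hv as [n Hn]; exists n; eapply Hsuper; eauto. Qed.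

Let Gg : G ∈ N /\ g ∈ N.
Proof. apply kpair_mem_trans; auto. Qed.

Let G_in xi : xi ∈ G -> xi ∈ N.
Proof. apply TN, Gg. Qed.

Lemma stage_nice : nice N.
Proof.
  split; auto.
  - apply G_in; apply empty_mem_omul_omega; auto.
  - intros x y Hx Hy; destruct (H_both x y Hx Hy) as [n [K1 K2]]; eauto.
  - intros x y Hx Hy; destruct (H_both x y Hx Hy) as [n [K1 K2]]; eauto.
Qed.
Let nN := stage_nice.

(** If some move from v is won in M at clock η, then (η, v), which is in N because γ·ω is, lies in
    some link, and the next link contains a winning move. So the moves in N suffice to refute v. *)
Lemma win_abs xi v : xi ∈ G -> v ∈ N -> win N xi v <-> win M xi v.
Proof.
  revert v; induction xi as [xi IH] using mem_ind; intros v Hxi Hv.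
  assert (E : forall eta, eta ∈ xi ->
    ((forall w, w ∈ N -> move N v w -> ~ win N eta w) <->
     (forall w, w ∈ M -> move M v w -> ~ win M eta w))).
  { intros eta He; pose proof (proj1 OG xi Hxi eta He) as Ge; split.
    - intros K w Mw Hm Hwin.
      pose proof (nice_kpair N eta v nN (G_in eta Ge) Hv) as Hk; rewrite HN in Hk.
      destruct Hk as [n Hn]; destruct (Hrefl n eta v Hn) as [w' [Hw' [Hm' Hs']]].
      + exists w; split; auto; split; auto; apply HS'; auto.
      + pose proof (H_in _ _ Hw') as Nw'; apply (K w' Nw').
        * apply (move_abs M N TN NM v w' Hv Nw'); auto.
        * apply IH; auto; apply HS'; auto.
    - intros K w Nw Hm Hwin; apply (K w (NM w Nw)).
      + apply (move_abs M N TN NM v w Hv Nw); auto.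
      + apply IH; auto. }
  rewrite !win_iff; split; intros K z Hz; destruct (K z Hz) as (eta & He & Hze & Hwin);
    exists eta; (split; [exact He|]); (split; [exact Hze|]); apply E; auto.
Qed.

(** A formula without class variables settles after finitely many ticks, by the same code in N and
    in M, and such clocks are absolute by [win_abs]. Thus γ keeps its value in N. *)
Lemma sat_abs (p : fml Empty_set unit) h : h ∈ N ->
  sat_set N (fun _ => h) p <-> sat_set M (fun _ => h) p.
Proof.
  intros Hh; unfold sat_set.
  set (atom := fun (_ : nat) (c : Empty_set) (_ : V) => match c return V with end).
  set (q := code atom 0 p (fun _ => tConst h)).
  assert (K : forall U, nice U -> h ∈ U ->
    halt U G (kpair q vempty) (sat U no_class (fun _ => h) p) (osucc (depth p) vempty)).
  { intros U nU Uh.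
    apply (code_halts U G nU OG atom no_class 0 vempty vempty p); auto.
    - intros _ [].
    - apply ordinal_empty.
    - apply all_cls_intro; intros [].
    - apply (nice_empty U nU).
    - apply fresh_empty.
    - intros i; left; reflexivity. }
  assert (HGd : osucc (depth p) vempty ∈ G).
  { generalize (depth p); intros k; induction k; simpl; auto.
    apply empty_mem_omul_omega; auto. }
  rewrite <- (K N nN Hh _ HGd (fun z => id)), <- (K M HM (NM h Hh) _ HGd (fun z => id)).
  apply win_abs; auto; apply nice_kpair; auto; [|apply (nice_empty N nN)].
  apply code_in; auto; [intros _ [] | intros _; apply nice_kpair; auto; apply (nice_nat N 0); auto].
Qed.

(** * The axioms of GB in N *)

Let X' := classes N g.

Let X'_sub A : A ∈ X' -> A ⊆ N.
Proof. intros HA; apply (mem_classes N g A); auto. Qed.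

(** A is not known to be a class of X, but S records its membership question. A subset of a defined
    from A is thus obtained by Separation in (M, X), and N contains it, being closed under those
    subsets of its elements that are in M. *)
Let class_sep (A : V) a (P : V -> V -> Prop) w xi : class_code N g A w xi -> a ∈ N ->
  D2 M okX (fun _ => P) ->
  exists b, b ∈ N /\ forall y, y ∈ b <-> y ∈ a /\ exists x, x ∈ M /\ P y x /\ kpair xi (kpair w x) ∈ S.
Proof.
  intros (Nw & Gxi & _) Ha HP.
  pose proof (NM w Nw) as Mw; pose proof (NM _ (G_in xi Gxi)) as Mxi.
  destruct (separation (fun y => exists x, x ∈ M /\ P y x /\ kpair xi (kpair w x) ∈ S) a)
    as [b [Mb Hb]]; auto.
  { unfold D1; apply D_ex, D_and; [apply (D_rel2 M okX (fun _ => P)); auto; dsolveM|].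
    apply (D_cls M okX _ (fun _ => S)); [exact HSX|]; dsolveM. }
  exists b; split; auto; apply (N_sub b a); auto; intros y Hy; apply Hb; auto.
Qed.

Let class_win A w xi x : class_code N g A w xi -> x ∈ N ->
  kpair xi (kpair w x) ∈ S <-> x ∈ A.
Proof.
  intros (Nw & Gxi & K) Hx; assert (Hk : kpair w x ∈ N) by (apply nice_kpair; auto).
  rewrite HS', <- win_abs by auto; apply (K x Hx xi); auto; intros z; auto.
Qed.

(** The values must be bounded in N. The position [v x] denies all instances y of (x, y) ∈ F, so its
    winning moves carry the values of F at x. For x ∈ a these questions lie in one link, so answers
    lie in the next, and functionality identifies them with the values. *)
Lemma stage_class_replacement F a : F ∈ X' -> functional F -> a ∈ N ->
  exists b, b ∈ N /\ forall y, y ∈ N -> (y ∈ b <-> exists x, x ∈ N /\ x ∈ a /\ kpair x y ∈ F).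
Proof.
  intros HF Hfun Ha.
  assert (HC : computable N g (X := option unit) (fun e => kpair (e (Some tt)) (e None) ∈ F)).
  { apply D_computable; auto; apply (D_cls N _ _ (fun _ => F)); [exact HF|]; dsolve. }
  destruct HC as [Q [tau [Gt [HQ1 HQ2]]]].
  set (q := Q 2 (fun o => match o with None => tVar 1 | Some _ => tVar 0 end)).
  assert (Nq : q ∈ N) by (apply HQ1; intros [[]|]; unfold tVar; niceness).
  set (v := fun x => kpair (cAll (vnat 1) q) (ins (vnat 0) x vempty)).
  (* Packing all ingredients of the positions into one set yields a common index m. *)
  assert (Nc : kpair a (kpair tau (kpair (cAll (vnat 1) q) (kpair (vnat 0) vempty))) ∈ N).
  { pose proof (G_in tau Gt); niceness. }
  rewrite HN in Nc; destruct Nc as [m Hm].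
  destruct (kpair_mem_trans (H m) _ _ (HT m) Hm) as [ma Hm1].
  destruct (kpair_mem_trans (H m) _ _ (HT m) Hm1) as [mt Hm2].
  destruct (kpair_mem_trans (H m) _ _ (HT m) Hm2) as [mq Hm3].
  destruct (kpair_mem_trans (H m) _ _ (HT m) Hm3) as [m0 me].
  (* A [kpair] climbs two links, a [vpair] or a [vcup] one: the environment lies in H (4 + m), the
     position in H (6 + m), and the question with its clock in H (8 + m). *)
  assert (Hv : forall x, x ∈ a -> kpair tau (v x) ∈ H (8 + m)).
  { intros x Hx; pose proof (HT m a ma x Hx) as mx.
    apply (H_kpair (6 + m)); [apply (H_le m); auto; lia|].
    apply (H_kpair (4 + m)); [apply (H_le m); auto; lia|].
    apply (H_cup (3 + m)); [apply (H_le m); auto; lia|].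
    apply (H_pair (2 + m)); apply (H_kpair m); auto. }
  assert (Henv : forall x y, x ∈ N -> y ∈ N ->
    (win N tau (kpair q (ins (vnat 1) y (ins (vnat 0) x vempty))) <-> kpair x y ∈ F)).
  { intros x y Nx Ny.
    apply (HQ2 2 (ins (vnat 1) y (ins (vnat 0) x vempty)) _
      (fun o => match o with None => y | Some _ => x end)); auto.
    - niceness.
    - apply fresh_ins, fresh_ins, fresh_empty.
    - intros [[]|]; auto.
    - intros [[]|].
      + apply (tval_le 1); auto; apply tval_ins; auto; apply tval_var, fresh_empty.
      + apply tval_var, fresh_ins, fresh_empty.
    - intros z; auto. }
  assert (Hc : forall x y, x ∈ a -> y ∈ N -> kpair x y ∈ F -> y ∈ H (9 + m)).
  { intros x y Hx Ny Hxy; pose proof (TN a Ha x Hx) as Nx.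
    assert (Nf : ins (vnat 0) x vempty ∈ N) by niceness.
    assert (Nall : cAll (vnat 1) q ∈ N) by niceness.
    destruct (Hrefl (8 + m) tau (v x) (Hv x Hx)) as [w [Hw1 [Hw2 Hw3]]].
    - exists (kpair q (ins (vnat 1) y (ins (vnat 0) x vempty))).
      assert (Nw : kpair q (ins (vnat 1) y (ins (vnat 0) x vempty)) ∈ N) by niceness.
      split; [auto|]; split.
      + apply move_all; auto; try (apply NM; auto; niceness).
        exists y; split; auto; reflexivity.
      + apply HS'; auto; rewrite <- win_abs by auto; apply Henv; auto.
    - pose proof (H_in _ _ Hw1) as Nw.
      rewrite HS' in Hw3 by auto; rewrite <- win_abs in Hw3 by auto.
      apply (move_abs M N TN NM) in Hw2; [| unfold v; niceness | auto].
      unfold v in Hw2; rewrite move_all in Hw2 by (auto; niceness).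
      destruct Hw2 as [y' [Ny' E]]; rewrite E in Hw3.
      rewrite Henv in Hw3 by auto; rewrite (Hfun _ _ _ Hxy Hw3).
      rewrite E in Hw1; destruct (kpair_mem_trans _ _ _ (HT _) Hw1) as [_ Hi].
      apply (kpair_mem_trans _ (vnat 1) y' (HT (9 + m))), (HT _ _ Hi).
      rewrite mem_ins; right; reflexivity. }
  destruct (proj1 (mem_classes N g F) HF) as [_ [w [xi HwF]]].
  pose proof (NM a Ha) as Ma.
  destruct (class_sep F (H (9 + m)) (fun y p => exists x, x ∈ M /\ x ∈ a /\ p ≈ kpair x y) w xi HwF)
    as [b [Nb Hb]].
  - apply (H_in (10 + m)), HH.
  - unfold D2; dsolveM.
  - exists b; split; auto; intros y Ny; rewrite Hb; split.
    + intros [Hy (p & Mp & (x & Mx & Hx & Ep) & K)]; pose proof (TN a Ha x Hx) as Nx.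
      exists x; split; auto; split; auto; rewrite Ep in K.
      apply (class_win F w xi); auto; niceness.
    + intros (x & Nx & Hx & Hxy); split; [apply (Hc x); auto|].
      exists (kpair x y); split; [apply nice_kpair; auto|]; split.
      * exists x; split; auto; split; auto; reflexivity.
      * apply (class_win F w xi); auto; niceness.
Qed.

Let stage_set_class a : a ∈ N -> a ∈ X'.
Proof.
  intros Ha.
  destruct (classes_comprehension N g nN Og Hw Empty_set (fMem None (Some 0)) (fun c => match c with end)
    (fun _ => a)) as [A [HA K]]; auto; [intros []|].
  assert (E : a ≈ A); [|rewrite E; exact HA].
  apply veq_ext; intros z; split; intros Hz.
  - apply K; auto; exact (TN a Ha z Hz).
  - apply (K z); auto; exact (X'_sub A HA z Hz).
Qed.

(** For Separation and Replacement the formula first defines a class of X', to which [class_sep] or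
    class replacement applies. Union, Power set and Pairing hold because each link is transitive,
    closed under subsets in M, and an element of the next. *)
Lemma stage_ZF : ZF N.
Proof.
  split.
  - intros x y Hx Hy K; apply veq_ext; intros z; split; intros Hz; apply K; auto;
      eapply TN; [|exact Hz| |exact Hz]; auto.
  - intros x Hx [y [Ny Hy]]; destruct (mem_minimal (fun y => y ∈ x) y Hy) as [m [Hm Hmin]].
    exists m; split; [exact (TN x Hx m Hm)|]; split; auto; intros (z & _ & Hz & Hzm); exact (Hmin z Hzm Hz).
  - intros x y Hx Hy; exists (vpair x y); split; [apply (nice_pair N nN); auto|].
    intros z _; apply mem_pair.
  - intros x Hx; destruct (union x (NM x Hx)) as [u [Mu Hu]].
    pose proof Hx as Hx'; rewrite HN in Hx'; destruct Hx' as [n Hn].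
    exists u; split.
    + apply (H_in (Datatypes.S n)), H_sub; auto; intros z Hz; rewrite Hu in Hz.
      destruct Hz as [y [Hy Hz]]; exact (HT n y (HT n x Hn y Hy) z Hz).
    + intros z _; rewrite Hu; split; [|intros (y & _ & Hy & Hz); exists y; auto].
      intros [y [Hy Hz]]; exists y; split; auto; exact (TN x Hx y Hy).
  - intros x Hx; destruct (powerset x (NM x Hx)) as [u [Mu Hu]].
    pose proof Hx as Hx'; rewrite HN in Hx'; destruct Hx' as [n Hn].
    exists u; split.
    + apply (H_in (Datatypes.S n)), H_sub; auto; intros z Hz; rewrite Hu in Hz.
      apply (Hsuper n z x); tauto.
    + intros y Ny; rewrite Hu; split.
      * intros [_ K] z _; auto.
      * intros K; split; [auto|]; intros z Hz; apply K; auto; exact (TN y Ny z Hz).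
  - exists omega; split; [apply (N_sub omega g); [exact omega_in | auto | apply Gg]|]; split.
    + exists vempty; split; [apply (nice_empty N nN)|]; split; [exists 0; reflexivity|].
      intros z _; apply mem_empty.
    + intros x Nx [n En]; exists (vsucc x); split; [apply nice_succ; auto|]; split.
      * exists (Datatypes.S n); exact (vsucc_proper _ _ En).
      * intros z _; apply mem_succ.
  - intros p e a He Ha.
    destruct (classes_comprehension N g nN Og Hw Empty_set p no_class e) as [A [HA K]]; auto; [intros []|].
    destruct (proj1 (mem_classes N g A) HA) as [_ [w [xi HwA]]].
    destruct (class_sep A a (fun y x => x ≈ y) w xi HwA Ha) as [b [Nb Hb]].
    { unfold D2; dsolveM. }
    exists b; split; auto; intros x Nx; rewrite Hb; unfold sat_set; rewrite <- K by auto.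
    apply and_iff_compat_l; split.
    + intros (y & _ & E & L); rewrite E in L; apply (class_win A w xi); auto.
    + intros L; exists x; split; auto; split; [reflexivity|]; apply (class_win A w xi); auto.
  - intros p e a He Ha Hfun.
    (* The graph is cut down to arguments in a, where the formula is functional, so that the class F
       is functional outright. *)
    set (P := fun e' : option nat -> V => exists x, x ∈ N /\ exists y, y ∈ N /\
      e' None ≈ kpair x y /\ x ∈ a /\ sat_set N (ext y (ext x (fun i => e' (Some i)))) p).
    destruct (computable_comprehension N g nN Og Hw P e) as [F [HF KF]]; auto.
    { intros z z' E (x & Nx & y & Ny & E' & K); exists x; split; auto; exists y; split; auto.
      cbn [ext] in *; rewrite <- E; auto. }
    { apply D_computable; auto; unfold P.
      apply D_ex, D_ex, D_and; [dsolve|]; apply D_and.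
      - apply (D_cls N _ _ (fun _ => a)); [apply stage_set_class; auto|]; dsolve.
      - apply (D_ext N _ (fun _ e' => sat N no_class (fun i => e' (match i with
          None => None | Some None => Some None | Some (Some j) => Some (Some (Some j)) end)) p)).
        + intros u e' He'; unfold sat_set; apply sat_veq; [reflexivity|].
          intros [[i|]|]; reflexivity.
        + apply (D_ren N _ (fun i : option (option nat) => match i with
            None => None | Some None => Some None | Some (Some j) => Some (Some (Some j)) end)
            (fun _ e' => sat N no_class e' p)).
          exists Empty_set, (fun c : Empty_set => match c with end), p; split; [intros []|].
          intros u e' He'; apply sat_veq; [intros [] | reflexivity]. }
    assert (KF' : forall x y, kpair x y ∈ F <-> x ∈ N /\ y ∈ N /\ x ∈ a /\ sat_set N (ext y (ext x e)) p).
    { intros x y; split.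
      - intros K; pose proof (X'_sub F HF _ K) as Nk; destruct (kpair_mem_trans N _ _ TN Nk) as [Nx Ny].
        apply KF in K; auto; destruct K as (x' & _ & y' & _ & E & Hx & K); cbn [ext] in E, K.
        apply kpair_inj in E; destruct E as [E1 E2]; rewrite E1 at 2; repeat split; auto.
        unfold sat_set in *; eapply sat_veq; [| |exact K]; [reflexivity|].
        intros [[i|]|]; simpl; auto; reflexivity.
      - intros (Nx & Ny & Hx & K); apply KF; [apply nice_kpair; auto|].
        exists x; split; auto; exists y; split; auto; split; [reflexivity|]; split; auto. }
    destruct (stage_class_replacement F a HF) as [b [Nb Hb]]; auto.
    { intros x y y' K K'; rewrite KF' in K, K'; apply (Hfun x); tauto. }
    exists b; split; auto; intros y Ny; rewrite (Hb y Ny); split.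
    + intros (x & Nx & Hx & K); rewrite KF' in K; exists x; tauto.
    + intros (x & Nx & Hx & K); exists x; rewrite KF'; tauto.
Qed.

Lemma stage_GB : GB N X'.
Proof.
  split.
  - exact stage_ZF.
  - intros A B HA HB K; apply veq_ext; intros z; split; intros Hz; apply K; auto;
      eapply X'_sub; [|exact Hz| |exact Hz]; auto.
  - exact stage_class_replacement.
  - intros C p cl e Hcl He; exact (classes_comprehension N g nN Og Hw C p cl e Hcl He).
Qed.

End Reflection.

Theorem reflection g : g ∈ M -> ordinal g -> omega ⊆ g -> ETR_ord (omul g omega) M X ->
  exists N, N ∈ M /\ transitive N /\ g ∈ N /\
    (exists X', so_structure N X' /\ GB N X' /\ ETR_ord g N X') /\
    forall (p : fml Empty_set unit) h, h ∈ N ->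
      (sat_set N (fun _ => h) p <-> sat_set M (fun _ => h) p).
Proof.
  intros Mg Og Hw HE.
  assert (MG : omul g omega ∈ M) by (apply omul_in; auto; exact omega_in).
  destruct (win_class (omul g omega)) as [S [HSX HS']]; auto.
  { apply ordinal_omul; auto. }
  { intros xi; apply omul_omega_succ_closed; auto. }
  (* Starting the chain at the pair (γ·ω, γ) puts both ordinals into N. *)
  destruct (chain_ex S HSX (kpair (omul g omega) g)) as (N & H & MN & HN & Ha & HT & HH & Hs & Hr).
  { apply nice_kpair; auto. }
  assert (TN : transitive N).
  { intros y Hy z Hz; rewrite HN in *; destruct Hy as [n Hn]; exists n; exact (HT n y Hn z Hz). }
  exists N; split; auto; split; auto; split; [apply (kpair_mem_trans N _ _ TN Ha)|]; split.
  - exists (classes N g); split; [intros A HA; apply (mem_classes N g A); auto|]; split.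
    + exact (stage_GB g Og Hw S HSX HS' N H MN HN Ha HT HH Hs Hr).
    + apply classes_etr; auto; exact (stage_nice g Og Hw N H MN HN Ha HT HH Hs).
  - exact (sat_abs g Og Hw S HS' N H MN HN Ha HT HH Hs Hr).
Qed.

End Model.

Theorem theorem5p12 (gamma : fml Empty_set unit)
    (hgamma : ordinal_name_ge (oexp omega omega) gamma) :
  (exists M X, transitive_model (GB_ETR_omega gamma) M X) ->
  exists M, transitive M /\ ZF M /\
    realizable (GB_ETR gamma) M /\ ~ realizable (GB_ETR_omega gamma) M.
Proof.
  intros [M [X HMX]]; revert X HMX.
  induction M as [M IH] using mem_ind; intros X [TM [HS [HGB [g [Hg HE]]]]].
  destruct (hgamma M g TM (gb_zf M X HGB) Hg) as [Og Hge].
  assert (Hw : omega ⊆ g) by (intros z Hz; apply Hge, omega_incl_oexp; exact Hz).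
  destruct Hg as [Mg [Sg Ug]].
  destruct (reflection M X TM HS HGB g Mg Og Hw HE)
    as (N & MN & TN & Ng & (X' & HS' & HGB' & HE') & Habs).
  destruct (classic (realizable (GB_ETR_omega gamma) N)) as [[Y [HY HT]] | Hno].
  - apply (IH N MN Y); split; auto.
  - exists N; split; auto; split; [exact (gb_zf N X' HGB')|]; split; auto.
    exists X'; split; auto; split; auto; exists g; split; auto.
    split; auto; split; [apply Habs; auto|].
    (* Uniqueness of the value of γ passes down: another candidate in N would satisfy the formula in
       M as well. *)
    intros h Nh Sh; apply Ug; [exact (TM N MN h Nh) | apply Habs; auto].
Qed.
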